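(* Let $\mathcal{H}$ be a Hilbert space, let $J\subseteq\mathbb{R}$ be an interval and let $f:J\to\mathbb{R}$ be a continuous function. Then $f$ is operator convex if and only if the operator epigraph $$\mathrm{OE}(f)=\{(X,Y)\in sp(J)\times\mathcal{B}(\mathcal{H});\ f(X)\leq Y\}$$ is $C^*$-convex.
   Context: $\mathcal{H}$ is a fixed Hilbert space and $\mathcal{B}(\mathcal{H})$ is the $C^*$-algebra of all bounded linear operators on $\mathcal{H}$, with identity $I$. An operator $X\in\mathcal{B}(\mathcal{H})$ is positive ($X\geq 0$) if $\langle Xa,a\rangle\geq 0$ for every $a\in\mathcal{H}$, and $A\leq B$ means $B-A\geq 0$. For a real interval $J$, $sp(J)$ is the set of all self-adjoint operators on $\mathcal{H}$ whose spectra are contained in $J$; for $X\in sp(J)$, $f(X)$ is defined by the continuous functional calculus. A continuous function $f:J\to\mathbb{R}$ is operator convex if $f\left(\frac{X+Y}{2}\right)\leq\frac{f(X)+f(Y)}{2}$ for all $X,Y\in sp(J)$. A set $\mathcal{K}\subseteq\mathcal{B}(\mathcal{H})\times\mathcal{B}(\mathcal{H})$ is $C^*$-convex if $(X_1,Y_1),\dots,(X_n,Y_n)\in\mathcal{K}$ and $C_1,\dots,C_n\in\mathcal{B}(\mathcal{H})$ with $\sum_{i=1}^n C_i^*C_i=I$ (any $n\in\mathbb{N}$) imply $$\left(\sum_{i=1}^n C_i^*X_iC_i,\ \sum_{i=1}^n C_i^*Y_iC_i\right)\in\mathcal{K}.$$ *)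

(* Defs.v *)
From HB Require Import structures.
From mathcomp Require Import all_boot all_order all_algebra.
From mathcomp Require Import complex.
From mathcomp Require Import all_classical all_reals all_analysis.

Set Implicit Arguments.
Unset Strict Implicit.
Unset Printing Implicit Defensive.

Import Order.TTheory GRing.Theory Num.Theory.
Import numFieldNormedType.Exports.
Local Open Scope classical_set_scope.
Local Open Scope complex_scope.
Local Open Scope ring_scope.

(* Complex Hilbert spaces. The inner product is linear in its first argument
   and conjugate-linear in its second; completeness is that of the norm. *)
HB.mixin Record NormedModule_hasInner (R : realType) H
    of NormedModule R[i] H := {
  inner : {dot H for (@Num.conj R[i])};
  inner_norm : forall x : H, inner x x = `|x| ^+ 2
}.

#[short(type="hilbertType")]
HB.structure Definition Hilbert (R : realType) :=
  {H of CompleteNormedModule R[i] H & NormedModule_hasInner R H}.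

Section BoundedOperators.
Context {R : realType} (H : hilbertType R).

Definition bounded_linear_op (A : H -> H) : Prop :=
  linear A /\ exists M : R, forall x, `|A x| <= M%:C * `|x|.

Definition bounded_linear_pred : {pred H -> H} :=
  [pred A | `[< bounded_linear_op A >]].

Record bop := Bop { bop_fun :> H -> H ; _ : bop_fun \in bounded_linear_pred }.

HB.instance Definition _ := [isSub for bop_fun].
HB.instance Definition _ := [Choice of bop by <:].

Lemma bopP (A : bop) : bounded_linear_op A.
Proof. by case: A => A /= /asboolP. Qed.

Lemma bounded_linear_submod_closed : submod_closed bounded_linear_pred.
Proof.
split=> [|a f g /asboolP[lf [M fM]] /asboolP[lg [N gN]]]; apply/asboolP.
  split=> [b x y|]; first by rewrite scaler0 addr0.
  by exists 0 => x; rewrite normr0 mul0r.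
split=> [b x y|].
  rewrite !fctE lf lg !scalerDr !scalerA (mulrC a) -!addrA; congr (_ + _).
  by rewrite addrCA.
have Da : (complex.Re `|a|)%:C = `|a| by rewrite RRe_real ?normr_real.
exists (complex.Re `|a| * M + N) => x; rewrite !fctE (le_trans (ler_normD _ _))//.
rewrite [X in X * _]raddfD /= [X in (X + _) * _]rmorphM.
by rewrite [X in (X * _ + _) * _]Da mulrDl lerD// normrZ -mulrA ler_wpM2l.
Qed.

HB.instance Definition _ := GRing.isSubmodClosed.Build _ _ bounded_linear_pred
  bounded_linear_submod_closed.
HB.instance Definition _ := [SubChoice_isSubLmodule of bop by <:].

Lemma bounded_linear_id : (fun x : H => x) \in bounded_linear_pred.
Proof.
by apply/asboolP; split=> [//|]; exists 1 => x; rewrite rmorph1 mul1r.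
Qed.

Lemma bounded_linear_comp (A B : bop) :
  (fun x => A (B x)) \in bounded_linear_pred.
Proof.
case: (bopP A) (bopP B) => lA [M AM] [lB [N BN]]; apply/asboolP.
split=> [a x y|]; first by rewrite lB lA.
exists (`|M| * N) => x; rewrite (le_trans (AM _))//.
apply: (@le_trans _ _ (`|M|%:C * `|B x|)).
  by rewrite ler_wpM2r// lecR ler_norm.
by rewrite rmorphM/= -mulrA ler_wpM2l// (lecR 0).
Qed.

Definition bop_one : bop := Bop bounded_linear_id.
Definition bop_mul (A B : bop) : bop := Bop (bounded_linear_comp A B).

Lemma bopD (A B : bop) x : (A + B) x = A x + B x. Proof. by []. Qed.
Lemma bopZ (a : R[i]) (A : bop) x : (a *: A) x = a *: A x. Proof. by []. Qed.

Fact bop_mulA : associative bop_mul. Proof. by move=> *; exact: val_inj. Qed.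
Fact bop_mul1 : left_id bop_one bop_mul.
Proof. by move=> *; exact: val_inj. Qed.
Fact bop_mulr1 : right_id bop_one bop_mul.
Proof. by move=> *; exact: val_inj. Qed.
Fact bop_mulDl : left_distributive bop_mul +%R.
Proof. by move=> *; exact: val_inj. Qed.
Fact bop_mulDr : right_distributive bop_mul +%R.
Proof.
move=> A B C; apply/val_inj/funext => x /=.
by have [+ _] := bopP A => /(_ 1 (B x) (C x)); rewrite !scale1r.
Qed.

(* Only a pzRing, since this ring is trivial when H is the zero space. *)
HB.instance Definition _ := GRing.Zmodule_isPzRing.Build bop
  bop_mulA bop_mul1 bop_mulr1 bop_mulDl bop_mulDr.

Lemma bop1E x : (1 : bop) x = x. Proof. by []. Qed.
Lemma bopM (A B : bop) x : (A * B) x = A (B x). Proof. by []. Qed.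

Implicit Types A B X Y T : bop.

(* ||A|| = sup { ||A x|| : ||x|| <= 1 }; norms on H are elements of R[i]. *)
Definition opnorm A : R :=
  sup [set complex.Re `|A x| | x in [set x : H | `|x| <= 1]].

(* The adjoint exists and is unique by the Riesz representation theorem; the
   default value 0 is never used. *)
Definition adjoint A : bop :=
  xget 0 [set B : bop | forall x y, inner (A x) y = inner x (B y)].

Definition selfadjoint A : Prop := adjoint A = A.

Definition positive A : Prop := forall a : H, 0 <= inner (A a) a.

Definition ople A B : Prop := positive (B - A).

Definition spectrum A : set R[i] :=
  [set z : R[i] | ~ exists B : bop,
    B * (A - z *: (1 : bop)) = 1 /\ (A - z *: (1 : bop)) * B = 1].

Definition sp (J : interval R) : set bop :=
  [set X | selfadjoint X /\ spectrum X `<=` [set t%:C | t in [set` J]]].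

Definition poly_op (p : {poly R}) X : bop :=
  \sum_(i < size p) (p`_i)%:C *: X ^+ i.

(* f(X) for self-adjoint X and f continuous on the spectrum of X: the limit in
   operator norm of p_n(X), for real polynomials p_n converging to f uniformly
   on the spectrum. It exists by the Weierstrass theorem, does not depend on
   (p_n) nor on the values of f off the spectrum, and the default value 0 is
   never used. *)
Definition is_cfc (f : R -> R) X T : Prop :=
  exists p : {poly R} ^nat,
    {uniform [set t : R | spectrum X t%:C],
      (fun n t => (p n).[t]) @ \oo --> f} /\
    opnorm (poly_op (p n) X - T) @[n --> \oo] --> (0 : R).

Definition cfc (f : R -> R) X : bop := xget 0 [set T | is_cfc f X T].

Definition operator_convex (J : interval R) (f : R -> R) : Prop :=
  forall X Y, sp J X -> sp J Y ->
    ople (cfc f (2^-1 *: (X + Y))) (2^-1 *: (cfc f X + cfc f Y)).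

Definition cstar_convex (K : set (bop * bop)) : Prop :=
  forall (n : nat) (X Y C : 'I_n -> bop), (0 < n)%N ->
    (forall i, K (X i, Y i)) ->
    \sum_(i < n) adjoint (C i) * C i = 1 ->
    K (\sum_(i < n) adjoint (C i) * X i * C i,
       \sum_(i < n) adjoint (C i) * Y i * C i).

Definition operator_epigraph (J : interval R) (f : R -> R) :
    set (bop * bop) :=
  [set XY | sp J XY.1 /\ ople (cfc f XY.1) XY.2].

End BoundedOperators.

Arguments operator_convex {R} H J f.
Arguments operator_epigraph {R} H J f _.

(* Main.v *)
Require Import Defs.
From HB Require Import structures.
From mathcomp Require Import all_boot all_order all_algebra.
From mathcomp Require Import complex.
From mathcomp Require Import all_classical all_reals all_analysis.
From mathcomp Require Import ring lra.

Set Implicit Arguments.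
Unset Strict Implicit.
Unset Printing Implicit Defensive.

Import Order.TTheory GRing.Theory Num.Theory.
Import numFieldNormedType.Exports.
Local Open Scope classical_set_scope.
Local Open Scope complex_scope.
Local Open Scope ring_scope.

(* The point is Jensen's operator inequality
     f (sum_i C_i^* X_i C_i) <= sum_i C_i^* f(X_i) C_i,
   which is proved without the dilation H = H + H, so that H may have finite
   dimension: all arguments take place at some order n <= dim H.

   Compression to Krylov subspaces reduces the inequality to matrices, where it
   follows by summation from a certificate: for nodes b_1, ..., b_n the secants
   l_ij of f through b_i and b_j (tangents if i = j) satisfy
     sum_ij y_i y_j l_ij(x) <= f(x) (sum_i y_i)^2.
   Multiplied by the squared node polynomial, this says that q^2 f, for some q of
   degree < n, dominates at x its Hermite interpolant at the doubled nodes; by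
   Rolle's theorem this is a consequence of (q^2 f)^(2n) >= 0.

   The latter comes from testing operator convexity on t + e (B + W), t + e (B - W)
   and their mean t + e B, where B is the adjacency operator of a path
   e_0, ..., e_(n-1) of orthonormal vectors and W is the projection on e_(n-1).
   As W B^k e_0 = 0 for k < n - 1, the vector v = q(.) e_0 is the same for the
   three operators, so that the convexity defect at v is a linear functional of
   q^2 f; it kills the degrees below 2n and is positive on the degree 2n, and
   e -> 0 extracts the derivative. Differentiability is gained beforehand by
   iterated Steklov averages. *)

(** * Real inner product *)

(** The usual argument dilates the [C_i] to a unitary on several copies of [H] and uses convexity
    there; in dimension [d] only order [d] is given, so at most [d] nodes may be used. They are the
    eigenvalues [b_k], with eigenvectors [u_k], of the compression of [T = sum_i C_i^* X_i C_i] to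
    the span of the vectors [T^j v]. The certificate is evaluated on the spectrum of each [X_i],
    with [y_k] read off from [C_i u_k]. When summed over [i], the relation [sum_i C_i^* C_i = 1]
    turns the terms of degree 0 in [x] into [<u_k, u_l>] and those of degree 1 into [<T u_k, u_l>].
    Both are diagonal, so only [l_kk(b_k) = f(b_k)] survives. This is why every [l_ij] has to be
    affine: no higher power of the [X_i] can be carried over to [T].

    A merely continuous [f] has no tangents, and [J] may be closed, so there is no room for averages
    near its ends. The segment is therefore contracted affinely before averaging, which preserves
    affine functions. All estimates carry an error [e], removed at the very end by [le0_small]. *)

Lemma invS_small {R : realType} (e : R) : 0 < e ->
  exists N, forall n, (N <= n)%N -> n.+1%:R^-1 <= e.
Proof.
move=> e0; exists (Num.truncn e^-1) => m nm.
rewrite -[leRHS]invrK lef_pV2 ?posrE ?invr_gt0// ltW//.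
by rewrite (lt_le_trans (truncnS_gt _))// ler_nat.
Qed.

Lemma le0_small {R : realType} (x K : R) :
  (forall e, 0 < e -> x <= e * K) -> x <= 0.
Proof.
move=> h; have [K0|K0] := lerP K 0.
  by rewrite (le_trans (h 1 ltr01))// mul1r.
apply/ler_addgt0Pr => e e0; rewrite add0r.
by have := h (e / K) (divr_gt0 e0 K0); rewrite divfK// gt_eqF.
Qed.

Section RealInner.
Context {R : realType} (H : hilbertType R).
Implicit Types (x y z : H) (a : R[i]) (t : R).

Lemma innerDl x y z : inner (x + y) z = inner x z + inner y z.
Proof. exact: linearDl. Qed.

Lemma innerZl a x z : inner (a *: x) z = a * inner x z.
Proof. exact: linearZl_LR. Qed.

Lemma inner_conj x y : inner x y = ((inner y x)^*)%C.
Proof. by rewrite hermC expr0 mul1r. Qed.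

Lemma innerDr x y z : inner z (x + y) = inner z x + inner z y.
Proof. by rewrite inner_conj innerDl rmorphD /= -!inner_conj. Qed.

Lemma innerZr a x z : inner z (a *: x) = (a^*)%C * inner z x.
Proof. by rewrite inner_conj innerZl rmorphM /= -inner_conj. Qed.

Lemma inner0l x : inner 0 x = 0.
Proof. by rewrite -(scale0r 0) innerZl mul0r. Qed.

Lemma inner0r x : inner x 0 = 0.
Proof. by rewrite inner_conj inner0l conjc0. Qed.

Lemma innerNl x y : inner (- x) y = - inner x y.
Proof. by rewrite -scaleN1r innerZl mulN1r. Qed.

Lemma innerNr x y : inner x (- y) = - inner x y.
Proof. by rewrite inner_conj innerNl rmorphN /= -inner_conj. Qed.

Lemma inner_suml (I : Type) (r : seq I) (P : pred I) (F : I -> H) x :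
  inner (\sum_(i <- r | P i) F i) x = \sum_(i <- r | P i) inner (F i) x.
Proof. exact: (big_morph (inner^~ x) (fun y z => innerDl y z x) (inner0l x)). Qed.

Lemma inner_sumr (I : Type) (r : seq I) (P : pred I) (F : I -> H) x :
  inner x (\sum_(i <- r | P i) F i) = \sum_(i <- r | P i) inner x (F i).
Proof. exact: (big_morph (inner x) (fun y z => innerDr y z x) (inner0r x)). Qed.

(** Estimates are made in [R], whose order is total and where [lra] applies; [inner_rdot] recovers
    the complex inner product from real parts. *)
Definition rdot x y : R := complex.Re (inner x y).
Definition hnorm x : R := complex.Re `|x|.

Lemma hnormE x : (hnorm x)%:C = `|x|.
Proof. by rewrite RRe_real ?normr_real. Qed.

Lemma ReD (u v : R[i]) : complex.Re (u + v) = complex.Re u + complex.Re v.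
Proof. by case: u v => [? ?] [? ?]. Qed.

Lemma ReN (u : R[i]) : complex.Re (- u) = - complex.Re u.
Proof. by case: u. Qed.

Lemma ReZ t (u : R[i]) : complex.Re (t%:C * u) = t * complex.Re u.
Proof. by case: u => ? ? /=; rewrite mul0r subr0. Qed.

Lemma Re_sum (I : Type) (r : seq I) (P : pred I) (F : I -> R[i]) :
  complex.Re (\sum_(i <- r | P i) F i) = \sum_(i <- r | P i) complex.Re (F i).
Proof. exact: (big_morph (@complex.Re R) ReD erefl). Qed.

Lemma Re_le (u v : R[i]) : u <= v -> complex.Re u <= complex.Re v.
Proof. by rewrite lecE => /andP[]. Qed.

Lemma inner_rdot x y : inner x y = rdot x y +i* rdot x ('i *: y).
Proof.
rewrite /rdot innerZr; case: (inner x y) => u v /=.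
by rewrite mul0r mulN1r opprK add0r.
Qed.

Lemma rdotC x y : rdot x y = rdot y x.
Proof. by rewrite /rdot inner_conj; case: (inner y x). Qed.

Lemma rdotxx x : rdot x x = hnorm x ^+ 2.
Proof. by rewrite /rdot inner_norm -hnormE expr2 ReZ expr2. Qed.

Lemma rdotDl x y z : rdot (x + y) z = rdot x z + rdot y z.
Proof. by rewrite /rdot innerDl ReD. Qed.
Lemma rdotDr x y z : rdot z (x + y) = rdot z x + rdot z y.
Proof. by rewrite /rdot innerDr ReD. Qed.
Lemma rdotNl x y : rdot (- x) y = - rdot x y.
Proof. by rewrite /rdot innerNl ReN. Qed.
Lemma rdotNr x y : rdot x (- y) = - rdot x y.
Proof. by rewrite /rdot innerNr ReN. Qed.
Lemma rdotZl t x y : rdot (t%:C *: x) y = t * rdot x y.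
Proof. by rewrite /rdot innerZl ReZ. Qed.
Lemma rdotZr t x y : rdot x (t%:C *: y) = t * rdot x y.
Proof. by rewrite rdotC rdotZl rdotC. Qed.
Lemma rdot0l x : rdot 0 x = 0. Proof. by rewrite /rdot inner0l. Qed.
Lemma rdot0r x : rdot x 0 = 0. Proof. by rewrite /rdot inner0r. Qed.

Lemma hnorm_ge0 x : 0 <= hnorm x.
Proof. by have := normr_ge0 x => /Re_le. Qed.

Lemma hnorm0 : hnorm 0 = 0 :> R.
Proof. by rewrite /hnorm normr0. Qed.

Lemma hnorm_eq0 x : hnorm x = 0 -> x = 0.
Proof. by move=> x0; apply/normr0_eq0; rewrite -hnormE x0. Qed.

Lemma hnormD x y : hnorm (x + y) <= hnorm x + hnorm y.
Proof. by have /Re_le := ler_normD x y; rewrite ReD. Qed.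

Lemma hnormN x : hnorm (- x) = hnorm x.
Proof. by rewrite /hnorm normrN. Qed.

Lemma hnormB x y : hnorm (x - y) = hnorm (y - x).
Proof. by rewrite -hnormN opprB. Qed.

Lemma hnormZ t x : hnorm (t%:C *: x) = `|t| * hnorm x.
Proof.
by rewrite /hnorm normrZ normc_def /= expr0n addr0 sqrtr_sqr ReZ.
Qed.

Lemma rdot_le x y : rdot x y <= hnorm x * hnorm y.
Proof.
have [x0|x0] := eqVneq (hnorm x) 0.
  by rewrite (hnorm_eq0 x0) rdot0l hnorm0 mul0r.
have [y0|y0] := eqVneq (hnorm y) 0.
  by rewrite (hnorm_eq0 y0) rdot0r hnorm0 mulr0.
have xy0 : 0 < hnorm x * hnorm y by rewrite mulr_gt0// lt0r hnorm_ge0 ?x0 ?y0.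
have : 0 <= rdot ((hnorm y)%:C *: x - (hnorm x)%:C *: y)
                 ((hnorm y)%:C *: x - (hnorm x)%:C *: y).
  by rewrite rdotxx exprn_ge0 ?hnorm_ge0.
rewrite !(rdotDl, rdotDr, rdotNl, rdotNr, rdotZl, rdotZr) !rdotxx (rdotC y x).
set X := hnorm x; set Y := hnorm y; set D := rdot x y => h.
have {h} : 0 <= 2 * (X * Y) * (X * Y - D) by apply: le_trans h _; lra.
by rewrite pmulr_rge0 ?subr_ge0// mulr_gt0.
Qed.

Lemma rdot_abs_le x y : `|rdot x y| <= hnorm x * hnorm y.
Proof.
rewrite ler_norml rdot_le andbT lerNl -rdotNl.
by rewrite (le_trans (rdot_le _ _))// hnormN.
Qed.

Lemma rdot_ext x y : (forall z, rdot z x = rdot z y) -> x = y.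
Proof.
move=> h; apply/eqP; rewrite -subr_eq0; apply/eqP/hnorm_eq0/eqP.
by rewrite -sqrf_eq0 -rdotxx rdotDr rdotNr h subrr.
Qed.

Lemma inner_ext x y : (forall z, inner z x = inner z y) -> x = y.
Proof. by move=> h; apply: rdot_ext => z; rewrite /rdot h. Qed.

Lemma hnorm_cauchy (u : nat -> H) :
  (forall e, 0 < e -> exists N, forall m n, (N <= m)%N -> (N <= n)%N ->
    hnorm (u m - u n) <= e) ->
  exists l, forall e, 0 < e -> exists N, forall n, (N <= n)%N ->
    hnorm (u n - l) <= e.
Proof.
move=> cu.
have posC (e : R[i]) : 0 < e -> 0 < complex.Re e /\ (complex.Re e)%:C = e.
  move=> e0; split; first by move: e0; rewrite ltcE => /andP[].
  by rewrite RRe_real// gtr0_real.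
have : cvg (u @ \oo).
  apply/cauchy_cvgP/cauchyP => e /posC[e0 eE].
  have [N hN] := cu (complex.Re e / 2) (divr_gt0 e0 (ltr0Sn _ 1)).
  exists (u N); exists N => // n /= Nn.
  rewrite -ball_normE /= -hnormE -eE ltcR.
  by rewrite (le_lt_trans (hN _ _ _ _))// ltr_pdivrMr// ltr_pMr// ltr1n.
move=> /cvg_ex[l /cvgrPdist_le ul]; exists l => e e0.
have [|N _ hN] := ul e%:C; first by rewrite (ltcR 0).
exists N => n Nn; rewrite hnormB -lecR hnormE; exact: hN.
Qed.
End RealInner.

(** * Representation of functionals by minimization (Riesz, Lax-Milgram) *)

Section Riesz.
Context {R : realType} (H : hilbertType R).
Implicit Types (x y z : H).

(* Minimizes [rdot (T x) x - 2 phi x]; coercivity makes minimizing sequences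
   Cauchy by the parallelogram identity. *)
Lemma coercive_representation (T : H -> H) (phi : H -> R) (c M N : R) :
  0 < c -> {morph T : x y / x + y} -> (forall t x, T (t%:C *: x) = t%:C *: T x) ->
  (forall x y, rdot (T x) y = rdot x (T y)) ->
  (forall x, c * hnorm x ^+ 2 <= rdot (T x) x) ->
  (forall x, hnorm (T x) <= M * hnorm x) ->
  {morph phi : x y / x + y} -> (forall t x, phi (t%:C *: x) = t * phi x) ->
  (forall x, phi x <= N * hnorm x) ->
  exists u, forall x, phi x = rdot (T u) x.
Proof.
move=> c0 TD TZ Tsym Tc TM phiD phiZ phiN.
have oppE x : - x = (-1)%:C *: x by rewrite rmorphN1 scaleN1r.
have TN x : T (- x) = - T x by rewrite !oppE TZ.
have phN x : phi (- x) = - phi x by rewrite oppE phiZ mulN1r.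
pose J x := rdot (T x) x - 2 * phi x.
have Jlb x : - (N ^+ 2 / c) <= J x.
  (* Completing the square in [hnorm x] bounds the functional from below. *)
  have h : 0 <= (c * hnorm x - N) ^+ 2 / c by rewrite mulr_ge0 ?sqr_ge0 ?invr_ge0 ?ltW.
  have -> : - (N ^+ 2 / c) = (c * hnorm x ^+ 2 - 2 * (N * hnorm x)) -
      (c * hnorm x - N) ^+ 2 / c by field; rewrite gt_eqF.
  by rewrite lerBlDr /J; have := Tc x; have := phiN x; lra.
have JD x y : J (x + y) = J x + J y + 2 * rdot (T x) y.
  by rewrite /J TD phiD !(rdotDl, rdotDr) (rdotC (T y)) -Tsym; ring.
have JZ t x : J (t%:C *: x) = t ^+ 2 * rdot (T x) x - 2 * t * phi x.
  by rewrite /J TZ phiZ rdotZl rdotZr; ring.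
have hI : has_inf (range J).
  split; first by exists (J 0); exists 0.
  by exists (- (N ^+ 2 / c)) => _ [x _ <-].
set I := inf (range J).
have IJ x : I <= J x by apply: ge_inf; [exact: hI.2|exists x].
have ex n : exists x, J x < I + n.+1%:R^-1.
  have [|_ [x _ <-] hx] := @inf_adherent _ (range J) n.+1%:R^-1 _ hI.
    by rewrite invr_gt0.
  by exists x.
have [u hu] := choice ex.
have para x y : c / 4 * hnorm (x - y) ^+ 2 <= J x / 2 + J y / 2 - I.
  have := IJ ((2^-1)%:C *: (x + y)); rewrite JZ => h.
  have {}h : I <= J x / 2 + J y / 2 - rdot (T (x - y)) (x - y) / 4.
    apply: (le_trans h); rewrite le_eqVlt; apply/orP; left; apply/eqP.
    rewrite /J !(TD, phiD, TN, phN) !(rdotDl, rdotDr, rdotNl, rdotNr).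
    rewrite (rdotC (T y) x) -Tsym.
    by field.
  by have := Tc (x - y); lra.
have small := @invS_small R.
have [l hl] : exists l, forall e, 0 < e -> exists n, forall m, (n <= m)%N ->
    hnorm (u m - l) <= e.
  apply: hnorm_cauchy => e e0.
  have [|n hn] := small (c / 4 * e ^+ 2); first by rewrite mulr_gt0 ?exprn_gt0 ?divr_gt0.
  exists n => p q np nq.
  rewrite -(@ler_pXn2r _ 2) ?nnegrE ?hnorm_ge0 ?(ltW e0)//.
  rewrite -(@ler_pM2l _ (c / 4)) ?divr_gt0//.
  have {}hu m : (n <= m)%N -> J (u m) <= I + c / 4 * e ^+ 2.
    by move=> /hn h; rewrite (le_trans (ltW (hu m)))// lerD2l.
  by have := para (u p) (u q); have := hu _ np; have := hu _ nq; lra.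
exists l.
(* A negative [M] is compatible with the bound on [T] only if all norms vanish; [var] treats that
   degenerate space separately. *)
have M0 : 0 <= M \/ forall x, hnorm x = 0.
  have [|M0] := lerP 0 M; [by left|right => x].
  apply/eqP; rewrite eq_le hnorm_ge0 andbT.
  by have := le_trans (hnorm_ge0 _) (TM x); rewrite nmulr_rge0.
(* Minimality at the limit [l], read off along the sequence: [J (u m + h) >= I] while
   [J (u m) <= I + e / 2], and replacing [T (u m)] by [T l] costs another [e / 2]. *)
have var h : 0 <= J h + 2 * rdot (T l) h.
  case: M0 => [M0|H0]; last first.
    have /hnorm_eq0 -> := H0 h; rewrite /J !rdot0r.
    have := phiZ 0 0; rewrite scaler0 mul0r => ->; lra.
  apply/ler_addgt0Pr => e e0.
  have [|n1 hn1] := small (e / 2); first by rewrite divr_gt0.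
  pose d := e / 4 / (M * hnorm h + 1).
  have Mh : 0 <= M * hnorm h by rewrite mulr_ge0 ?hnorm_ge0.
  have d0 : 0 < d by rewrite !divr_gt0//; lra.
  have [n2 hn2] := hl d d0.
  pose m := maxn n1 n2.
  have h1 := hn1 m (leq_maxl _ _); have h2 := hn2 m (leq_maxr _ _).
  have h3 : J (u m) <= I + e / 2 by rewrite (le_trans (ltW (hu m)))// lerD2l.
  have := IJ (u m + h); rewrite JD => h4.
  have : rdot (T (u m)) h - rdot (T l) h <= e / 4.
    rewrite -rdotNl -rdotDl -TN -TD; apply: le_trans (rdot_le _ _) _.
    apply: (@le_trans _ _ (M * d * hnorm h)).
      by rewrite ler_wpM2r ?hnorm_ge0// (le_trans (TM _))// ler_wpM2l.
    have -> : M * d * hnorm h = d * (M * hnorm h) by ring.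
    rewrite /d -mulrA ler_piMr ?divr_ge0 ?(ltW e0)//.
    by rewrite mulrC ler_pdivrMr; lra.
  lra.
move=> h; apply/eqP; rewrite -subr_eq0; apply/eqP.
set D := phi h - _.
(* [var] at [t h] and [- t h], divided by [t], bounds the first variation by the quadratic term;
   small [t] then forces [D = 0]. *)
have key (t : R) : 0 < t -> `|D| * 2 <= t * rdot (T h) h.
  move=> t0; have := var (t%:C *: h); have := var ((- t)%:C *: h).
  rewrite !JZ !rdotZr => h1 h2.
  have h3 : 0 <= t * (t * rdot (T h) h - 2 * D).
    apply: le_trans h2 _; rewrite /D; lra.
  have h4 : 0 <= t * (t * rdot (T h) h + 2 * D).
    apply: le_trans h1 _; rewrite /D; lra.
  rewrite !pmulr_rge0// in h3 h4.
  by case: (ler0P D) => D0; lra.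
apply/normr0_eq0/eqP; rewrite eq_le normr_ge0 andbT; apply/ler_addgt0Pr => e e0; rewrite add0r.
have Th0 : 0 <= rdot (T h) h.
  by apply: le_trans (Tc h); rewrite mulr_ge0 ?sqr_ge0 ?ltW.
have := key (e / (rdot (T h) h + 1)); rewrite divr_gt0//; last lra.
move=> /(_ isT) h1.
have : e / (rdot (T h) h + 1) * rdot (T h) h <= e.
  rewrite -mulrA ler_piMr ?(ltW e0)// mulrC ler_pdivrMr; lra.
have := normr_ge0 D; lra.
Qed.
End Riesz.

(** * Adjoints and spectra *)

Section Adjoint.
Context {R : realType} (H : hilbertType R).
Implicit Types (x y z : H) (A B : bop H).

Lemma bop_argD A x y : A (x + y) = A x + A y.
Proof. by have [h _] := bopP A; have := h 1 x y; rewrite !scale1r. Qed.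
Lemma bop_arg0 A : A 0 = 0.
Proof. by apply: (@addrI _ (A 0)); rewrite -bop_argD !addr0. Qed.
Lemma bop_argZ A (a : R[i]) x : A (a *: x) = a *: A x.
Proof. by have [h _] := bopP A; have := h a x 0; rewrite bop_arg0 !addr0. Qed.
Lemma bop_argN A x : A (- x) = - A x.
Proof. by rewrite -scaleN1r bop_argZ scaleN1r. Qed.
Lemma bop_sum A (I : Type) (r : seq I) (P : pred I) (F : I -> H) :
  A (\sum_(i <- r | P i) F i) = \sum_(i <- r | P i) A (F i).
Proof. exact: (big_morph A (bop_argD A) (bop_arg0 A)). Qed.

Lemma sum_bop (I : Type) (r : seq I) (P : pred I) (F : I -> bop H) x :
  (\sum_(i <- r | P i) F i) x = \sum_(i <- r | P i) F i x.
Proof. by elim/big_rec2: _ => // i y1 y2 _ <-. Qed.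

Lemma bopB A B x : (A - B) x = A x - B x. Proof. by []. Qed.
Lemma bop_eq A B : A =1 B -> A = B.
Proof. by move=> h; apply/val_inj/funext. Qed.

Lemma bop_scaleAl (a : R[i]) A B : a *: A * B = a *: (A * B).
Proof. exact: bop_eq. Qed.
Lemma bop_scaleAr (a : R[i]) A B : A * (a *: B) = a *: (A * B).
Proof. by apply: bop_eq => x; rewrite bopM bopZ bop_argZ. Qed.

Lemma bop_bound A : exists2 M : R, 0 <= M & forall x, hnorm (A x) <= M * hnorm x.
Proof.
have [_ [M h]] := bopP A; exists `|M| => // x.
have /Re_le := h x; rewrite ReZ => hx; apply: (le_trans hx).
by rewrite ler_wpM2r ?hnorm_ge0// ler_norm.
Qed.

Lemma bop_of (f : H -> H) (M : R) :
  (forall x y, f (x + y) = f x + f y) -> (forall (a : R[i]) x, f (a *: x) = a *: f x) ->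
  (forall x, hnorm (f x) <= M * hnorm x) -> exists A : bop H, A =1 f.
Proof.
move=> fD fZ fM.
have fP : f \in bounded_linear_pred (H := H).
  apply/asboolP; split=> [a x y|]; first by rewrite fD fZ.
  by exists M => x; rewrite -!hnormE -rmorphM lecR.
by exists (Bop fP).
Qed.

(** The coercive minimization with [T = id] represents the real part of [phi]; evaluation at
    ['i *: x] gives the imaginary part. *)
Lemma riesz (phi : H -> R[i]) (N : R) :
  {morph phi : x y / x + y} -> (forall a x, phi (a *: x) = a * phi x) ->
  (forall x, complex.Re (phi x) <= N * hnorm x) ->
  exists u, forall x, phi x = inner x u.
Proof.
move=> phiD phiZ phiN.
have [//|//|//|x|x|x y|t x|//|u hu] := @coercive_representation _ _ (@id H)
  (fun x => complex.Re (phi x)) 1 1 N (@ltr01 _).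
- by rewrite mul1r rdotxx.
- by rewrite mul1r.
- by rewrite phiD ReD.
- by rewrite phiZ ReZ.
exists u => x; apply/eqP; rewrite eq_complex; apply/andP; split.
  by rewrite hu -rdotC.
have := hu ('i%C *: x); rewrite rdotC /rdot phiZ innerZl.
by rewrite !(mulrC 'i%C) !ReiNIm => /oppr_inj ->.
Qed.

Lemma adjoint_uniq A B : (forall x y, inner (A x) y = inner x (B y)) -> adjoint A = B.
Proof.
move=> h; rewrite /adjoint; case: xgetP => [B' _ /= hB'|/(_ B)]; last by [].
by apply: bop_eq => y; apply: inner_ext => x; rewrite -h hB'.
Qed.

(** The Riesz vector of [x |-> inner (A x) z] depends linearly and boundedly on [z]; by uniqueness
    this map is the operator selected by [adjoint]. *)
Lemma inner_adjoint A x y : inner (A x) y = inner x (adjoint A y).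
Proof.
have [M M0 AM] := bop_bound A.
have /choice[f hf] z : exists u, forall x, inner (A x) z = inner x u.
  apply: (@riesz (fun x => inner (A x) z) (M * hnorm z)) => [u v|a u|u].
  - by rewrite bop_argD innerDl.
  - by rewrite bop_argZ innerZl.
  - apply: le_trans (rdot_le _ _) _.
    by rewrite mulrAC ler_wpM2r ?hnorm_ge0.
have [u v|a u|z|B hB] := @bop_of f M.
- by apply: inner_ext => w; rewrite innerDr -!hf innerDr.
- by apply: inner_ext => w; rewrite innerZr -!hf innerZr.
- have [->|z0] := eqVneq (hnorm (f z)) 0; first by rewrite mulr_ge0 ?hnorm_ge0.
  rewrite -(@ler_pM2r _ (hnorm (f z))) ?lt0r ?z0 ?hnorm_ge0//.
  rewrite -expr2 -rdotxx /rdot -hf mulrAC.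
  by apply: le_trans (rdot_le _ _) _; rewrite ler_wpM2r ?hnorm_ge0.
have -> : adjoint A = B by apply: adjoint_uniq => u v; rewrite hB -hf.
by rewrite hB -hf.
Qed.

Lemma adjointE A x y : inner (adjoint A x) y = inner x (A y).
Proof. by rewrite inner_conj -inner_adjoint -inner_conj. Qed.

Lemma adjointK A : adjoint (adjoint A) = A.
Proof. by apply: adjoint_uniq => x y; rewrite adjointE. Qed.
Lemma adjointM A B : adjoint (A * B) = adjoint B * adjoint A.
Proof. by apply: adjoint_uniq => x y; rewrite !bopM !inner_adjoint. Qed.
Lemma adjointD A B : adjoint (A + B) = adjoint A + adjoint B.
Proof. by apply: adjoint_uniq => x y; rewrite !bopD innerDl innerDr !inner_adjoint. Qed.
Lemma adjoint0 : adjoint 0 = 0 :> bop H.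
Proof. by apply: adjoint_uniq => x y; rewrite inner0l inner0r. Qed.
Lemma adjointZ (t : R) A : adjoint (t%:C *: A) = t%:C *: adjoint A.
Proof.
apply: adjoint_uniq => x y.
by rewrite !bopZ innerZl innerZr inner_adjoint conjc_real.
Qed.
Lemma adjoint_sum (I : Type) (r : seq I) (P : pred I) (F : I -> bop H) :
  adjoint (\sum_(i <- r | P i) F i) = \sum_(i <- r | P i) adjoint (F i).
Proof. exact: (big_morph _ adjointD adjoint0). Qed.

Lemma selfadjointP A :
  selfadjoint A <-> forall x y, inner (A x) y = inner x (A y).
Proof.
split=> [h x y|]; first by rewrite inner_adjoint h.
exact: adjoint_uniq.
Qed.

Lemma selfadjoint1 : selfadjoint (1 : bop H).
Proof. exact/selfadjointP. Qed.
Lemma selfadjointD A B : selfadjoint A -> selfadjoint B -> selfadjoint (A + B).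
Proof. by rewrite /selfadjoint adjointD => -> ->. Qed.
Lemma selfadjointZ (t : R) A : selfadjoint A -> selfadjoint (t%:C *: A).
Proof. by rewrite /selfadjoint adjointZ => ->. Qed.
Lemma selfadjointN A : selfadjoint A -> selfadjoint (- A).
Proof. by move/(@selfadjointZ (-1)); rewrite rmorphN1 scaleN1r. Qed.
Lemma selfadjointM A B : selfadjoint A -> selfadjoint B -> A * B = B * A ->
  selfadjoint (A * B).
Proof. by rewrite /selfadjoint adjointM => -> -> ->. Qed.
Lemma selfadjointX A n : selfadjoint A -> selfadjoint (A ^+ n).
Proof.
move=> sA; elim: n => [|n IH]; first exact: selfadjoint1.
by rewrite exprS; apply: selfadjointM => //; rewrite -exprS exprSr.
Qed.
Lemma selfadjoint_sum (I : Type) (r : seq I) (P : pred I) (F : I -> bop H) :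
  (forall i, selfadjoint (F i)) -> selfadjoint (\sum_(i <- r | P i) F i).
Proof. by move=> h; rewrite /selfadjoint adjoint_sum; apply: eq_bigr => i _; exact: h. Qed.

Lemma selfadjoint_rdot A x y : selfadjoint A -> rdot (A x) y = rdot x (A y).
Proof. by move=> /selfadjointP h; rewrite /rdot h. Qed.

Lemma selfadjoint_inner A x : selfadjoint A -> inner (A x) x = (rdot (A x) x)%:C.
Proof.
move=> /selfadjointP h; rewrite /rdot.
have : inner (A x) x = ((inner (A x) x)^*)%C by rewrite -inner_conj h.
case: (inner _ _) => u v [/eqP]; rewrite -subr_eq0 opprK -mulr2n mulrn_eq0 /=.
by move/eqP ->.
Qed.

End Adjoint.

Section Spectrum.
Context {R : realType} (H : hilbertType R).
Implicit Types (x y z : H) (A B : bop H) (t s : R).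

Definition invertible A := exists B, B * A = 1 /\ A * B = 1.

Lemma invertible_lr A B B' : B * A = 1 -> A * B' = 1 -> invertible A.
Proof.
move=> h h'; exists B; split=> //.
by rewrite -[B]mulr1 -h' (mulrA B) h mul1r.
Qed.

Lemma invertible_factor A B : A * B = B * A -> invertible (A * B) -> invertible A.
Proof.
move=> c [D [h h']]; apply: (@invertible_lr _ (D * B) (B * D)).
  by rewrite -mulrA -c.
by rewrite mulrA.
Qed.

Lemma invertibleM A B : invertible A -> invertible B -> invertible (A * B).
Proof.
move=> [A' [a a']] [B' [b b']]; exists (B' * A'); split.
  by rewrite mulrA -(mulrA B') a mulr1.
by rewrite mulrA -(mulrA A) b' mulr1.
Qed.

(** Lax-Milgram: the coercive minimization with [T = A] gives surjectivity, and the lower bound [c]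
    gives injectivity and the bound [c^-1] of the inverse. *)
Lemma invertible_coercive A (c : R) : selfadjoint A -> 0 < c ->
  (forall x, c * hnorm x ^+ 2 <= rdot (A x) x) -> invertible A.
Proof.
move=> sA c0 h; have [M M0 AM] := bop_bound A.
have surj y : exists u, A u = y.
  have [||||x|x z|t x|x|u hu] := @coercive_representation _ _ A
    (fun x => rdot y x) c M (hnorm y) c0.
  - exact: bop_argD.
  - by move=> t x; exact: bop_argZ.
  - by move=> x z; exact: selfadjoint_rdot.
  - exact: h.
  - exact: AM.
  - by rewrite rdotDr.
  - by rewrite rdotZr.
  - exact: rdot_le.
  by exists u; apply: rdot_ext => z; rewrite rdotC -hu rdotC.
have [f hf] := choice surj.
have lo x : c * hnorm x <= hnorm (A x).
  have [->|x0] := eqVneq (hnorm x) 0; first by rewrite mulr0 hnorm_ge0.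
  rewrite -(@ler_pM2r _ (hnorm x)) ?lt0r ?x0 ?hnorm_ge0//.
  by rewrite -mulrA -expr2 (le_trans (h x))// rdot_le.
have inj x y : A x = A y -> x = y.
  move=> e; apply/eqP; rewrite -subr_eq0; apply/eqP/hnorm_eq0/eqP.
  rewrite eq_le hnorm_ge0 andbT -(@ler_pM2l _ c)// mulr0.
  by rewrite (le_trans (lo _))// bop_argD bop_argN e subrr hnorm0.
have [x y|a x|x|B hB] := @bop_of _ _ f c^-1.
- by apply: inj; rewrite bop_argD !hf.
- by apply: inj; rewrite bop_argZ !hf.
- by rewrite -(@ler_pM2l _ c)// mulrA mulfV ?gt_eqF// mul1r -{2}(hf x).
exists B; split; apply: bop_eq => x; rewrite bopM hB; last exact: hf.
by apply: inj; rewrite hf.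
Qed.

Lemma selfadjoint_shift A t : selfadjoint A -> selfadjoint (A - t%:C *: (1 : bop H)).
Proof.
by move=> sA; apply: selfadjointD => //; apply/selfadjointN/selfadjointZ/selfadjoint1.
Qed.

(** For [z = s + i t] and [P = A - s], the operator [P - i t] is a factor of [P^2 + t^2], which is
    coercive with constant [t^2] when [t] is nonzero. *)
Lemma spectrum_real A (z : R[i]) : selfadjoint A -> spectrum A z -> complex.Im z = 0.
Proof.
move=> sA sz; apply/eqP/negPn/negP => t0; apply: sz.
case: z t0 => s t /= t0.
pose P : bop H := A - s%:C *: (1 : bop H).
have PA (w : R[i]) : A - (s%:C + w) *: (1 : bop H) = P - w *: (1 : bop H).
  by rewrite scalerDl opprD addrA.
have -> : (s +i* t)%C = s%:C + 'i%C * t%:C.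
  by apply/eqP; rewrite eq_complex /= !(mul0r, mulr0, mul1r, subr0, addr0, add0r) !eqxx.
rewrite PA; set w := 'i%C * t%:C.
have ww : w * w = (- t ^+ 2)%:C.
  rewrite /w mulrACA -[X in X * _]expr2 sqr_i mulN1r -rmorphM -rmorphN.
  by rewrite expr2.
have PP (Q : bop H) (a : R[i]) :
    (Q - a *: (1 : bop H)) * (Q + a *: (1 : bop H)) = Q * Q - (a * a) *: (1 : bop H).
  rewrite mulrBl !mulrDr !bop_scaleAr !bop_scaleAl !(mulr1, mul1r) scalerA.
  by rewrite opprD addrA addrK.
apply: (@invertible_factor _ (P + w *: (1 : bop H))).
  by have := PP P (- w); rewrite mulrNN scaleNr opprK -PP.
rewrite PP ww; apply: (@invertible_coercive _ (t ^+ 2)).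
- apply: selfadjoint_shift; apply: selfadjointM => //; exact: selfadjoint_shift.
- by rewrite exprn_even_gt0.
move=> x; rewrite bopB bopM bopZ bop1E rdotDl rdotNl rdotZl rdotxx.
rewrite (selfadjoint_rdot _ _ (selfadjoint_shift _ sA)) rdotxx mulNr opprK.
by rewrite lerDr sqr_ge0.
Qed.

Lemma spectrum_ge A (a : R) : selfadjoint A ->
  (forall x, a * hnorm x ^+ 2 <= rdot (A x) x) ->
  forall t, spectrum A t%:C -> a <= t.
Proof.
move=> sA h t st; rewrite leNgt; apply/negP => ta; apply: st.
apply: (@invertible_coercive _ (a - t)).
- exact: selfadjoint_shift.
- by rewrite subr_gt0.
move=> x; rewrite bopB bopZ bop1E rdotDl rdotNl rdotZl rdotxx mulrBl.
by rewrite lerD2r.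
Qed.

Lemma spectrumN A (z : R[i]) : spectrum A z -> spectrum (- A) (- z).
Proof.
move=> h [B [b b']]; apply: h; exists (- B).
have -> : A - z *: (1 : bop H) = - (- A - (- z) *: (1 : bop H)).
  by rewrite scaleNr opprK opprD opprK.
by rewrite !mulrNN.
Qed.

Lemma spectrum_le A (b : R) : selfadjoint A ->
  (forall x, rdot (A x) x <= b * hnorm x ^+ 2) ->
  forall t, spectrum A t%:C -> t <= b.
Proof.
move=> sA h t st; rewrite -lerN2; apply: (@spectrum_ge (- A)).
- exact: selfadjointN.
- by move=> x; rewrite rdotNl mulNr lerN2; exact: h.
by rewrite rmorphN; exact: spectrumN.
Qed.

(* Generalized Cauchy-Schwarz for the form of [A], tested at [x - t A x]. *)
Lemma psd_norm A (K : R) x : selfadjoint A -> 0 < K ->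
  (forall x, 0 <= rdot (A x) x) -> (forall x, hnorm (A x) <= K * hnorm x) ->
  hnorm (A x) ^+ 2 <= K * rdot (A x) x.
Proof.
move=> sA K0 A0 AK; have := A0 (x - (K^-1)%:C *: A x).
rewrite bop_argD bop_argN bop_argZ !(rdotDl, rdotDr, rdotNl, rdotNr, rdotZl, rdotZr).
rewrite (selfadjoint_rdot (A x) x sA) rdotxx => h.
have h2 : rdot (A (A x)) (A x) <= K * hnorm (A x) ^+ 2.
  by rewrite (le_trans (rdot_le _ _))// expr2 mulrA ler_wpM2r ?hnorm_ge0.
have h3 : K^-1 * (K^-1 * rdot (A (A x)) (A x)) <= K^-1 * hnorm (A x) ^+ 2.
  by rewrite ler_pM2l ?invr_gt0// ler_pdivrMl.
by rewrite -ler_pdivrMl//; lra.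
Qed.

(* The infimum of the numerical range is an approximate eigenvalue, by [psd_norm]. *)
Lemma spectrum_min A : (exists x : H, x != 0) -> selfadjoint A ->
  exists2 m : R, spectrum A m%:C & forall x, m * hnorm x ^+ 2 <= rdot (A x) x.
Proof.
move=> [x0 x00] sA.
have n0 : 0 < hnorm x0.
  by rewrite lt0r hnorm_ge0 andbT; apply/eqP => /hnorm_eq0/eqP; exact/negP.
pose S := [set rdot (A x) x | x in [set x : H | hnorm x = 1]].
have unit x : hnorm x != 0 -> hnorm ((hnorm x)^-1%:C *: x) = 1.
  by move=> x1; rewrite hnormZ ger0_norm ?invr_ge0 ?hnorm_ge0// mulVf.
have [M M0 AM] := bop_bound A.
have hS : has_inf S.
  split.
    by exists (rdot (A ((hnorm x0)^-1%:C *: x0)) ((hnorm x0)^-1%:C *: x0));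
      exists ((hnorm x0)^-1%:C *: x0) => //=; rewrite unit ?gt_eqF.
  exists (- M) => _ [x /= x1 <-].
  rewrite lerNl -rdotNl; apply: le_trans (rdot_le _ _) _.
  by rewrite hnormN x1 mulr1 (le_trans (AM x))// x1 mulr1.
pose m := inf S.
have lo a : (forall x, hnorm x = 1 -> a <= rdot (A x) x) ->
    forall x, a * hnorm x ^+ 2 <= rdot (A x) x.
  move=> h x; have [/hnorm_eq0 ->|x1] := eqVneq (hnorm x) 0.
    by rewrite hnorm0 rdot0r expr0n mulr0.
  have := h _ (unit _ x1); rewrite bop_argZ rdotZl rdotZr mulrA -expr2 exprVn.
  by rewrite ler_pdivlMl ?exprn_gt0 ?lt0r ?x1 ?hnorm_ge0// mulrC.
have mlo x : m * hnorm x ^+ 2 <= rdot (A x) x.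
  by apply: lo => y y1; apply: ge_inf; [exact: hS.2|exists y].
exists m => // -[B [h _]].
have [N N0 BN] := bop_bound B.
pose P : bop H := A - m%:C *: (1 : bop H).
have sP : selfadjoint P by exact: selfadjoint_shift.
have [K K0 PK] := bop_bound P.
have PE x : rdot (P x) x = rdot (A x) x - m * hnorm x ^+ 2.
  by rewrite /P bopB bopZ bop1E rdotDl rdotNl rdotZl rdotxx.
(* A bounded inverse of [P] gives [1 <= (N + 1) * hnorm (P x)] on unit vectors, and [psd_norm] turns
   this into [d <= rdot (P x) x]; the infimum [m] would then be at least [m + d]. *)
pose d := ((N + 1) ^+ 2 * (K + 1))^-1.
have d0 : 0 < d by rewrite invr_gt0 mulr_gt0 ?exprn_gt0 ?ltr_wpDl.
have : m + d <= m; last by rewrite gerDl leNgt d0.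
rewrite {2}/m; apply: lb_le_inf; first exact: hS.1.
move=> _ [x /= x1 <-].
have h1 : 1 <= (N + 1) * hnorm (P x).
  rewrite -{1}x1 -[x in hnorm x]bop1E -h bopM (le_trans (BN _))//.
  by rewrite ler_wpM2r ?hnorm_ge0// lerDl.
have h2 := @psd_norm P (K + 1) x sP (ltr_wpDl K0 ltr01).
have {}h2 : hnorm (P x) ^+ 2 <= (K + 1) * rdot (P x) x.
  apply: h2 => y; first by rewrite PE subr_ge0.
  by rewrite (le_trans (PK y))// ler_wpM2r ?hnorm_ge0// lerDl.
have h3 : 1 <= (N + 1) ^+ 2 * hnorm (P x) ^+ 2.
  by rewrite -exprMn exprn_ege1.
rewrite -lerBrDl -[m in leRHS]mulr1 -(expr1n _ 2) -x1 -PE.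
rewrite /d -[leLHS]mulr1 ler_pdivrMl ?mulr_gt0 ?exprn_gt0 ?ltr_wpDl//.
by rewrite (le_trans h3)// -[leRHS]mulrA ler_wpM2l ?sqr_ge0.
Qed.

Lemma spectrum_max A : (exists x : H, x != 0) -> selfadjoint A ->
  exists2 m : R, spectrum A m%:C & forall x, rdot (A x) x <= m * hnorm x ^+ 2.
Proof.
move=> hx sA; have [m sm h] := spectrum_min hx (selfadjointN sA).
exists (- m); first by rewrite rmorphN -[A]opprK; exact: spectrumN.
by move=> x; have := h x; rewrite rdotNl lerNr mulNr.
Qed.
End Spectrum.

(** * Weierstrass approximation *)

Section Weierstrass.
Context {R : realType}.
Implicit Types (a b x y e : R) (f g : R -> R) (n : nat).

Lemma segment_unif_continuous f a b : {within `[a, b], continuous f} ->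
  forall e, 0 < e -> exists2 d, 0 < d & forall x y, x \in `[a, b] -> y \in `[a, b] ->
    `|x - y| < d -> `|f x - f y| <= e.
Proof.
move=> cf e e0.
have /compact_near_coveringP cK := @segment_compact R a b.
pose P d x := x \in `[a, b] -> forall y, y \in `[a, b] -> `|x - y| < d -> `|f x - f y| <= e.
have h : \forall d \near 0^'+, `[a, b] `<=` P d.
  apply: cK => x xab; move/subspace_continuousP : cf => /(_ x xab)/cvgrPdist_le.
  move=> /(_ (e / 2) (divr_gt0 e0 (ltr0Sn _ 1))) /nbhs_ballP[r /= r0 hr].
  have r2 : 0 < r / 2 by rewrite divr_gt0.
  exists (ball x (r / 2), [set d | d < r / 2]); first split => /=.
  - by apply/nbhs_ballP; exists (r / 2).
  - exact: nbhs_right_lt.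
  move=> [x' d] /= [xx' dr] x'ab y yab x'y.
  have xyr : `|x - y| < r.
    rewrite (le_lt_trans (ler_distD x' _ _))// (splitr r) ltrD//.
    exact: lt_trans x'y dr.
  have h1 : `|f x - f x'| <= e / 2.
    apply: (hr x') => //; apply: (lt_trans xx').
    by rewrite ltr_pdivrMr// ltr_pMr// ltr1n.
  have h2 : `|f x - f y| <= e / 2 by apply: (hr y).
  by rewrite (le_trans (ler_distD (f x) _ _))// (splitr e) lerD// distrC.
near (0:R)^'+ => d.
exists d => // x y xab yab xy.
by have := near h d; apply.
Unshelve. all: by end_near. Qed.

(* At [x], the mean of [g] over a binomial variable with parameters [n] and [x],
   computed by conditioning on the first trial. *)
Fixpoint bernstein n (g : nat -> R) : {poly R} :=
  if n is m.+1 then (1 - 'X) * bernstein m g + 'X * bernstein m (g \o succn)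
  else (g 0)%:P.

Lemma bernstein_le n (g h : nat -> R) x : 0 <= x <= 1 ->
  (forall k, (k <= n)%N -> g k <= h k) -> (bernstein n g).[x] <= (bernstein n h).[x].
Proof.
move=> /andP[x0 x1]; elim: n g h => [|n IH] g h gh /=.
  by rewrite !hornerC gh.
rewrite !hornerE lerD// ler_wpM2l ?subr_ge0//; apply: IH => k kn /=; apply: gh => //.
exact: leqW.
Qed.

(** Second moment of the binomial law about a free centre [c]: conditioning on a successful first
    trial replaces [c] by [c - 1], so the induction needs every centre. *)
Lemma bernstein_variance n (A K c : R) x :
  (bernstein n (fun k => A + K * (k%:R - c) ^+ 2)).[x] =
  A + K * (n%:R * x * (1 - x) + (n%:R * x - c) ^+ 2).
Proof.
elim: n c => [|n IH] c /=; first by rewrite hornerC; ring.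
rewrite !hornerE IH (_ : _ \o _ = fun k => A + K * (k%:R - (c - 1)) ^+ 2).
  rewrite IH -natr1; ring.
by apply/funext => k /=; rewrite -natr1 opprB addrA.
Qed.

(** Bernstein's proof. The oscillation of [f] is dominated by a constant plus a multiple of the
    squared deviation, and the monotone operator [bernstein] averages this bound by the variance
    formula. *)
Lemma weierstrass f a b e : {within `[a, b], continuous f} -> 0 < e ->
  exists p : {poly R}, forall x, x \in `[a, b] -> `|p.[x] - f x| <= e.
Proof.
move=> cf e0; have [ab|ab] := ltrP a b; last first.
  exists (f a)%:P => x; rewrite in_itv /= => /andP[ax xb].
  rewrite hornerC (_ : x = a) ?subrr ?normr0 ?ltW//.
  by apply/eqP; rewrite eq_le ax (le_trans xb).
have e2 : 0 < e / 2 by rewrite divr_gt0.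
have [d d0 hd] := segment_unif_continuous cf e2.
have [B B0 hB] : exists2 B, 0 <= B & forall x, x \in `[a, b] -> `|f x| <= B.
  have [c _ hc] := EVT_max (ltW ab) cf; have [c' _ hc'] := EVT_min (ltW ab) cf.
  exists (`|f c| + `|f c'|) => [|x xab]; first by rewrite addr_ge0.
  rewrite ler_norml; apply/andP; split.
    by have := hc' x xab; have := ler_norm (- f c'); rewrite normrN; have := normr_ge0 (f c);
      lra.
  by have := hc x xab; have := ler_norm (f c); have := normr_ge0 (f c'); lra.
pose w := b - a; have w0 : 0 < w by rewrite subr_gt0.
pose s k n := a + w * (k%:R / n%:R).
have sab x : 0 <= x <= 1 -> a + w * x \in `[a, b].
  move=> /andP[x0 x1]; rewrite in_itv /= lerDl mulr_ge0 ?(ltW w0)//=.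
  by rewrite -lerBrDl -/w ler_piMr ?(ltW w0).
(* With this [M], the quadratic term exceeds the trivial bound [2 * B] as soon as the sample point
   is at distance at least [d]; [n] then makes its mean at most [e / 2]. *)
pose M := 2 * B * w ^+ 2 / d ^+ 2.
have M0 : 0 <= M.
  by apply: divr_ge0; last exact: sqr_ge0; apply: mulr_ge0; [exact: mulr_ge0|exact: sqr_ge0].
pose n := (Num.truncn (M / (e / 2))).+1.
have n0 : 0 < n%:R :> R by rewrite ltr0n.
have nM : M / n%:R <= e / 2.
  rewrite ler_pdivrMr// mulrC -ler_pdivrMr// ltW// truncnS_gt//.
pose p := bernstein n (fun k => f (a + w * (k%:R / n%:R))).
exists (p \Po (w^-1 *: ('X - a%:P))) => z zab.
pose x := w^-1 * (z - a).
have zE : z = a + w * x by rewrite /x mulVKf ?gt_eqF// addrC subrK.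
have x01 : 0 <= x <= 1.
  move: zab; rewrite in_itv /= => /andP[az zb].
  apply/andP; split; last by rewrite ler_pdivrMl// mulr1 lerD2r.
  by apply: mulr_ge0; rewrite ?subr_ge0// invr_ge0 ltW.
have -> : (p \Po (w^-1 *: ('X - a%:P))).[z] = p.[x].
  by rewrite horner_comp !hornerE.
have key k : (k <= n)%N -> `|f (a + w * (k%:R / n%:R)) - f z| <=
    e / 2 + M / n%:R ^+ 2 * (k%:R - n%:R * x) ^+ 2.
  move=> kn.
  have kab : a + w * (k%:R / n%:R) \in `[a, b].
    by apply: sab; rewrite divr_ge0//= ler_pdivrMr// mul1r ler_nat.
  have -> : M / n%:R ^+ 2 * (k%:R - n%:R * x) ^+ 2 = M * (k%:R / n%:R - x) ^+ 2.
    by field; rewrite gt_eqF.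
  have [h|h] := ltrP `|a + w * (k%:R / n%:R) - z| d.
    by rewrite (le_trans (hd _ _ _ _ h))// lerDl mulr_ge0 ?sqr_ge0.
  rewrite (le_trans (ler_normB _ _))//.
  apply: (@le_trans _ _ (2 * B)).
    by have := hB _ kab; have := hB _ zab; lra.
  apply: (@le_trans _ _ (M * (k%:R / n%:R - x) ^+ 2)); last by rewrite lerDr ltW.
  have -> : M * (k%:R / n%:R - x) ^+ 2 = 2 * B * ((w * (k%:R / n%:R - x)) ^+ 2 / d ^+ 2).
    by rewrite /M exprMn; ring.
  rewrite ler_peMr ?mulr_ge0// ler_pdivlMr ?exprn_gt0// mul1r.
  move: h; rewrite zE opprD addrACA subrr add0r -mulrBr => h.
  by rewrite -(real_normK (num_real (_ * _))) ler_pXn2r ?nnegrE ?(ltW d0).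
have var K A : (bernstein n (fun k => A + K * (k%:R - n%:R * x) ^+ 2)).[x] =
    A + K * (n%:R * x * (1 - x)).
  by rewrite bernstein_variance subrr expr0n addr0.
have xx : M / n%:R ^+ 2 * (n%:R * x * (1 - x)) <= e / 2.
  apply: le_trans nM; rewrite (_ : _ * _ = M / n%:R * (x * (1 - x))).
    by apply: ler_piMr; [rewrite divr_ge0 ?(ltW n0)|move: x01 => /andP[x0 x1]; nra].
  by field; rewrite gt_eqF.
rewrite ler_distl; apply/andP; split.
  apply: (@le_trans _ _ (bernstein n (fun k => (f z - e / 2) +
      (- (M / n%:R ^+ 2)) * (k%:R - n%:R * x) ^+ 2)).[x]).
    by rewrite var; lra.
  apply: bernstein_le => // k kn; have := key k kn; rewrite ler_distl => /andP[]; lra.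
apply: (@le_trans _ _ (bernstein n (fun k => (f z + e / 2) +
      ((M / n%:R ^+ 2)) * (k%:R - n%:R * x) ^+ 2)).[x]).
  apply: bernstein_le => // k kn; have := key k kn; rewrite ler_distl => /andP[]; lra.
by rewrite var; lra.
Qed.
End Weierstrass.

(** * Polynomials of an operator *)

Section PolyOp.
Context {R : realType} (H : hilbertType R).
Implicit Types (x y : H) (A B X T : bop H) (t s : R).

(** Complex coefficients allow the factorization into linear factors behind the spectral mapping
    argument. *)
Definition cpoly_op (p : {poly R[i]}) X : bop H := \sum_(i < size p) p`_i *: X ^+ i.

Lemma cpoly_op_wide (n : nat) (p : {poly R[i]}) X : (size p <= n)%N ->
  cpoly_op p X = \sum_(i < n) p`_i *: X ^+ i.
Proof.
move=> pn; rewrite /cpoly_op (big_ord_widen n (fun i => p`_i *: X ^+ i))//.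
rewrite big_mkcond; apply: eq_bigr => i _; case: ltnP => // h.
by rewrite nth_default ?scale0r.
Qed.

Lemma cpoly_opD p q X : cpoly_op (p + q) X = cpoly_op p X + cpoly_op q X.
Proof.
set n := maxn (size p) (size q).
rewrite (@cpoly_op_wide n) ?size_polyD// (@cpoly_op_wide n p) ?leq_maxl//.
rewrite (@cpoly_op_wide n q) ?leq_maxr// -big_split; apply: eq_bigr => i _.
by rewrite coefD scalerDl.
Qed.

Lemma cpoly_opZ c p X : cpoly_op (c *: p) X = c *: cpoly_op p X.
Proof.
rewrite (@cpoly_op_wide (size p)) ?size_scale_leq// /cpoly_op scaler_sumr.
by apply: eq_bigr => i _; rewrite coefZ scalerA.
Qed.

Lemma cpoly_opC c X : cpoly_op c%:P X = c *: (1 : bop H).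
Proof.
by rewrite (@cpoly_op_wide 1) ?size_polyC_leq1// big_ord1 coefC expr0.
Qed.

Lemma cpoly_opMX p X : cpoly_op (p * 'X) X = cpoly_op p X * X.
Proof.
rewrite (@cpoly_op_wide (size p).+1).
  rewrite big_ord_recl coefMX /= scale0r add0r /cpoly_op mulr_suml.
  by apply: eq_bigr => i _; rewrite coefMX /= bop_scaleAl -exprSr.
have [->|p0] := eqVneq p 0; first by rewrite mul0r size_poly0.
by rewrite size_mulX.
Qed.

Lemma cpoly_opM p q X : cpoly_op (p * q) X = cpoly_op p X * cpoly_op q X.
Proof.
elim/poly_ind: q => [|q c IH].
  by rewrite mulr0 -[0](scale0r (0 : {poly R[i]})) !cpoly_opZ !scale0r mulr0.
rewrite mulrDr !cpoly_opD mulrA !cpoly_opMX IH mulrDr mulrA; congr (_ + _).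
by rewrite mulrC mul_polyC cpoly_opZ cpoly_opC bop_scaleAr mulr1.
Qed.

Notation toC p := (map_poly (real_complex R) p).

Lemma poly_opE (p : {poly R}) X : poly_op p X = cpoly_op (toC p) X.
Proof.
rewrite /poly_op /cpoly_op size_map_poly; apply: eq_bigr => i _.
by rewrite coef_map.
Qed.

Lemma poly_opD (p q : {poly R}) X : poly_op (p + q) X = poly_op p X + poly_op q X.
Proof. by rewrite !poly_opE rmorphD cpoly_opD. Qed.
Lemma poly_opM (p q : {poly R}) X : poly_op (p * q) X = poly_op p X * poly_op q X.
Proof. by rewrite !poly_opE rmorphM cpoly_opM. Qed.
Lemma poly_opC c X : poly_op c%:P X = c%:C *: (1 : bop H).
Proof. by rewrite poly_opE map_polyC cpoly_opC. Qed.
Lemma poly_opZ c (p : {poly R}) X : poly_op (c *: p) X = c%:C *: poly_op p X.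
Proof. by rewrite !poly_opE map_polyZ cpoly_opZ. Qed.
Lemma poly_opN (p : {poly R}) X : poly_op (- p) X = - poly_op p X.
Proof. by rewrite -scaleN1r poly_opZ rmorphN1 scaleN1r. Qed.
Lemma poly_opX X : poly_op 'X X = X.
Proof.
by rewrite poly_opE map_polyX -['X]mul1r cpoly_opMX cpoly_opC scale1r mul1r.
Qed.
Lemma poly_op1 X : poly_op 1 X = 1.
Proof. by rewrite poly_opC scale1r. Qed.
Lemma poly_opXn X n : poly_op 'X^n X = X ^+ n.
Proof.
elim: n => [|n IH]; first by rewrite !expr0 poly_op1.
by rewrite !exprS poly_opM IH poly_opX.
Qed.

Lemma poly_op_selfadjoint p X : selfadjoint X -> selfadjoint (poly_op p X).
Proof.
move=> sX; apply: selfadjoint_sum => i.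
exact/selfadjointZ/selfadjointX.
Qed.

Lemma poly_op_eigen p X x t : X x = t%:C *: x -> poly_op p X x = p.[t]%:C *: x.
Proof.
move=> h; elim/poly_ind: p => [|p c IH].
  by rewrite -[0]polyC0 poly_opC hornerC bopZ.
rewrite poly_opD poly_opM poly_opX poly_opC bopD bopM h bop_argZ IH.
by rewrite scalerA -rmorphM hornerMXaddC bopZ bop1E -scalerDl -rmorphD mulrC.
Qed.

(** [P] splits into linear factors, and each root off the spectrum contributes an invertible one. *)
Lemma cpoly_op_invertible (P : {poly R[i]}) X : P != 0 ->
  (forall z, root P z -> ~ spectrum X z) -> invertible (cpoly_op P X).
Proof.
move=> P0 hP; have [rs PE] := closed_field_poly_normal P.
have lc0 : lead_coef P != 0 by rewrite lead_coef_eq0.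
have h z : z \in rs -> invertible (X - z *: (1 : bop H)).
  move=> zrs; apply: contrapT; apply: hP.
  by rewrite PE rootZ// root_prod_XsubC.
rewrite PE cpoly_opZ.
have inv1 c : c != 0 -> invertible (c *: (1 : bop H)).
  move=> c0; exists (c^-1 *: (1 : bop H)).
  by rewrite !bop_scaleAl !mul1r !scalerA mulfV// mulVf// scale1r.
rewrite -[cpoly_op _ _]mul1r -bop_scaleAl; apply: invertibleM; first exact: inv1.
elim: rs h {PE} => [|z rs IH] h.
  rewrite big_nil cpoly_opC; apply: inv1; exact: oner_neq0.
rewrite big_cons cpoly_opM; apply: invertibleM.
  rewrite cpoly_opD -polyCN cpoly_opC scaleNr.
  rewrite -['X]mul1r cpoly_opMX cpoly_opC scale1r mul1r.
  by apply: h; rewrite inE eqxx.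
by apply: IH => w wrs; apply: h; rewrite inE wrs orbT.
Qed.

(* The least spectral value [m] of [p(X)] is a value of [p] on the spectrum of [X]:
   otherwise all complex roots of [p - m] are regular, and [p(X) - m] is invertible. *)
Lemma poly_op_ge0 p X : selfadjoint X ->
  (forall t, spectrum X t%:C -> 0 <= p.[t]) ->
  forall x, 0 <= rdot (poly_op p X x) x.
Proof.
move=> sX hp x; have [->|x0] := eqVneq x 0; first by rewrite rdot0r.
have hx : exists x : H, x != 0 by exists x.
have [m sm hm] := spectrum_min hx (poly_op_selfadjoint p sX).
apply: le_trans (hm x); rewrite mulr_ge0 ?sqr_ge0// leNgt; apply/negP => m0.
apply: sm; pose q := p - m%:P.
have -> : poly_op p X - m%:C *: (1 : bop H) = cpoly_op (toC q) X.
  by rewrite -poly_opE poly_opD -polyCN poly_opC rmorphN scaleNr.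
have q0 t : spectrum X t%:C -> q.[t] != 0.
  by move=> /hp h; rewrite !hornerE gt_eqF// subr_gt0 (lt_le_trans m0).
apply: cpoly_op_invertible.
  have [t st _] := spectrum_min hx sX.
  by rewrite map_poly_eq0; apply: contraNneq (q0 _ st) => ->; rewrite horner0.
move=> z rz sz; have zr := spectrum_real sX sz.
have zE : z = (complex.Re z)%:C by case: (z) zr => u v /= ->.
rewrite zE in sz rz; have := q0 _ sz.
by move: rz; rewrite /root horner_map fmorph_eq0 => ->.
Qed.

(** Positivity of [poly_op] for the polynomial [M^2 - p^2], nonnegative on the spectrum. *)
Lemma poly_op_norm p X M : selfadjoint X -> 0 <= M ->
  (forall t, spectrum X t%:C -> `|p.[t]| <= M) ->
  forall x, hnorm (poly_op p X x) <= M * hnorm x.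
Proof.
move=> sX M0 hp x.
rewrite -(@ler_pXn2r _ 2) ?nnegrE ?mulr_ge0 ?hnorm_ge0//.
have := @poly_op_ge0 ((M ^+ 2)%:P - p * p) X sX _ x.
rewrite poly_opD poly_opN poly_opC poly_opM bopB bopZ bop1E bopM.
rewrite rdotDl rdotNl rdotZl (selfadjoint_rdot _ _ (poly_op_selfadjoint _ sX)).
rewrite !rdotxx subr_ge0 exprMn; apply => t /hp h.
rewrite !hornerE subr_ge0 -expr2 -(real_normK (num_real p.[t])).
by rewrite ler_pXn2r ?nnegrE.
Qed.
End PolyOp.

(** * Continuous functional calculus *)

Lemma uniform_cvgP {R : realType} (A : set R) (p : nat -> R -> R) (f : R -> R) :
  {uniform A, p @ \oo --> f} <->
  forall e : R, 0 < e -> exists N, forall n, (N <= n)%N ->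
    forall t, A t -> `|p n t - f t| <= e.
Proof.
split=> [pf e e0|h].
  have : nbhs (f : {uniform` A -> R}) [set g | forall t, A t -> `|g t - f t| <= e].
    apply/uniform_nbhs; exists [set xy | ball xy.1 e xy.2]; split.
      exact: (entourage_ball R (PosNum e0)).
    by move=> g hg t /hg /=; rewrite /ball /= distrC => /ltW.
  by move/pf => -[N _ hN]; exists N.
move=> P /uniform_nbhs[E [+ EP]]; rewrite -entourage_ballE => -[e /= e0 eE].
have [N hN] := h (e / 2) (divr_gt0 e0 (ltr0Sn _ 1)).
exists N => // n /= Nn; apply: EP => t At; apply: eE => /=.
by rewrite /ball /= distrC (le_lt_trans (hN _ Nn _ At))// ltr_pdivrMr// ltr_pMr// ltr1n.
Qed.

Lemma cvg0P {R : realType} (u : nat -> R) :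
  u n @[n --> \oo] --> (0 : R) <->
  forall e : R, 0 < e -> exists N, forall n, (N <= n)%N -> `|u n| <= e.
Proof.
split=> [/cvgrPdist_le h e /h[N _ hN]|h].
  by exists N => n Nn; have := hN n Nn; rewrite /= sub0r normrN.
apply/cvgrPdist_le => e /h[N hN]; exists N => // n /= Nn.
by rewrite sub0r normrN hN.
Qed.

Section OpNorm.
Context {R : realType} (H : hilbertType R).
Implicit Types (x y : H) (A B X T : bop H).

Let S A := [set complex.Re `|A x| | x in [set x : H | `|x| <= 1]].

Let S_sup A : has_sup (S A).
Proof.
split; first by exists (hnorm (A 0)); exists 0 => //=; rewrite normr0.
have [M M0 AM] := bop_bound A; exists M => _ [x /= x1 <-].
rewrite -/(hnorm (A x)) (le_trans (AM x))// ler_piMr//.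
by rewrite -lecR hnormE.
Qed.

Lemma opnorm_le A (M : R) : (forall x, hnorm (A x) <= M * hnorm x) -> 0 <= M ->
  opnorm A <= M.
Proof.
move=> AM M0; apply: ge_sup => [|_ [x /= x1 <-]]; first exact: (S_sup A).1.
rewrite -/(hnorm (A x)) (le_trans (AM x))// ler_piMr//.
by rewrite -lecR hnormE.
Qed.

Lemma le_opnorm A x : hnorm (A x) <= opnorm A * hnorm x.
Proof.
have [/hnorm_eq0 ->|x0] := eqVneq (hnorm x) 0.
  by rewrite bop_arg0 hnorm0 mulr0.
have n0 : 0 < hnorm x by rewrite lt0r x0 hnorm_ge0.
rewrite mulrC -ler_pdivrMl//; apply: ub_le_sup; first exact: (S_sup A).2.
exists ((hnorm x)^-1%:C *: x) => /=; last first.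
  by rewrite bop_argZ -/(hnorm _) hnormZ ger0_norm ?invr_ge0 ?hnorm_ge0.
by rewrite -hnormE lecR hnormZ ger0_norm ?invr_ge0 ?hnorm_ge0// mulVf.
Qed.

Lemma hnormZc (a : R[i]) x : hnorm (a *: x) = complex.Re `|a| * hnorm x.
Proof. by rewrite /hnorm normrZ -{1}(@RRe_real _ `|a|) ?normr_real// ReZ. Qed.

(** Completeness of the operators in operator norm; the pointwise limit inherits the explicit rate,
    which also yields its linearity. *)
Lemma bop_limit (P : nat -> bop H) :
  (forall n m, (n <= m)%N -> forall x, hnorm (P n x - P m x) <= n.+1%:R^-1 * hnorm x) ->
  exists T, forall n x, hnorm (P n x - T x) <= n.+1%:R^-1 * hnorm x.
Proof.
move=> hP.
have /choice[T hT] x : exists l, forall n, hnorm (P n x - l) <= n.+1%:R^-1 * hnorm x.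
  have [|l hl] := @hnorm_cauchy _ _ (fun n => P n x).
    move=> e e0; have [|N hN] := @invS_small _ (e / 2 / (hnorm x + 1)).
      by rewrite !divr_gt0// ltr_wpDl ?hnorm_ge0.
    exists N => m n Nm Nn.
    have h k : (N <= k)%N -> hnorm (P N x - P k x) <= e / 2.
      move=> /hP/(_ x) h; apply: (le_trans h).
      apply: (@le_trans _ _ (e / 2 / (hnorm x + 1) * hnorm x)).
        by rewrite ler_wpM2r ?hnorm_ge0// hN.
      rewrite -mulrA ler_piMr ?divr_ge0 ?(ltW e0)//.
      by rewrite mulrC ler_pdivrMr ?ltr_wpDl ?hnorm_ge0// mul1r lerDl.
    rewrite -(subrKA (P N x)) (le_trans (hnormD _ _))// (splitr e).
    by rewrite lerD ?h// hnormB h.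
  exists l => n; apply/ler_addgt0Pr => e e0.
  have [N hN] := hl e e0; have := hN _ (leq_maxl N n).
  have := hP n _ (leq_maxr N n) x; move=> h1 h2.
  by rewrite -(subrKA (P (maxn N n) x)) (le_trans (hnormD _ _))// lerD.
have small (u : H) (K : R) : 0 <= K -> (forall n, hnorm u <= n.+1%:R^-1 * K) -> u = 0.
  move=> K0 h; apply/hnorm_eq0/eqP; rewrite eq_le hnorm_ge0 andbT.
  apply: (@le0_small _ _ K) => e /invS_small[N /(_ N (leqnn N)) hN].
  by rewrite (le_trans (h N))// ler_wpM2r.
have [M M0 PM] := bop_bound (P 0).
have [x y|a x|x|B hB] := @bop_of _ _ T (M + 1).
- apply/eqP; rewrite -subr_eq0; apply/eqP.
  apply: (small _ (hnorm (x + y) + (hnorm x + hnorm y)));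
    first by rewrite !addr_ge0 ?hnorm_ge0.
  move=> n; rewrite (_ : _ - _ = (T (x + y) - P n (x + y)) + ((P n x - T x) + (P n y - T y))).
    rewrite !mulrDr; apply: (le_trans (hnormD _ _)); apply: lerD; first by rewrite hnormB.
    by apply: (le_trans (hnormD _ _)); exact: lerD.
  have -> : P n x - T x + (P n y - T y) = P n (x + y) - (T x + T y).
    by rewrite bop_argD opprD addrACA.
  by rewrite subrKA.
- apply/eqP; rewrite -subr_eq0; apply/eqP.
  apply: (small _ (hnorm (a *: x) + complex.Re `|a| * hnorm x)).
    by rewrite addr_ge0 ?mulr_ge0 ?hnorm_ge0//; exact: (Re_le (normr_ge0 a)).
  move=> n; rewrite (_ : _ - _ = (T (a *: x) - P n (a *: x)) + a *: (P n x - T x)).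
    rewrite !mulrDr; apply: (le_trans (hnormD _ _)); apply: lerD; first by rewrite hnormB.
    rewrite hnormZc mulrCA ler_wpM2l//; exact: (Re_le (normr_ge0 a)).
  by rewrite scalerBr -bop_argZ subrKA.
- rewrite -(subrK (P 0%N x) (T x)) (le_trans (hnormD _ _))// mulrDl addrC lerD//.
  by rewrite hnormB (le_trans (hT _ _))// invr1.
exists B => n x; rewrite hB; exact: hT.
Qed.

(** On the zero space all spectra are empty, so there are no spectral extrema to serve as
    endpoints. *)
Definition nontrivial := exists x : H, x != 0.

(** The extreme values of the quadratic form are themselves in the spectrum, hence in [J]; an
    arbitrary interval is thus replaced by a compact segment on which Weierstrass approximation
    applies. *)
Lemma sp_bounds (J : interval R) X : nontrivial -> sp J X ->
  exists a b, [/\ a \in J, b \in J, spectrum X `<=` [set t%:C | t in `[a, b]],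
    forall x, a * hnorm x ^+ 2 <= rdot (X x) x &
    forall x, rdot (X x) x <= b * hnorm x ^+ 2].
Proof.
move=> ntH [sX XJ]; have [a sa ha] := spectrum_min ntH sX.
have [b sb hb] := spectrum_max ntH sX; exists a, b.
have inJ t : spectrum X t%:C -> t \in J by move=> /XJ[s /= sJ [<-]].
split; rewrite ?inJ// => z sz; exists (complex.Re z); last first.
  by case: (z) (spectrum_real sX sz) => u v /= ->.
have zE : z = (complex.Re z)%:C.
  by case: (z) (spectrum_real sX sz) => u v /= ->.
rewrite zE in sz; rewrite /= in_itv /=; apply/andP; split.
  exact: (spectrum_ge sX ha).
exact: (spectrum_le sX hb).
Qed.

Lemma sp_of_bounds (J : interval R) X a b : selfadjoint X -> a \in J -> b \in J ->
  (forall x, a * hnorm x ^+ 2 <= rdot (X x) x) ->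
  (forall x, rdot (X x) x <= b * hnorm x ^+ 2) -> sp J X.
Proof.
move=> sX aJ bJ ha hb; split=> // z sz.
have zE : z = (complex.Re z)%:C.
  by case: (z) (spectrum_real sX sz) => u v /= ->.
exists (complex.Re z) => //; rewrite zE in sz.
apply: (@interval_is_interval _ J a b) => //; apply/andP; split.
  exact: (spectrum_ge sX ha).
exact: (spectrum_le sX hb).
Qed.

Lemma segment_sub (J : interval R) (a b : R) : a \in J -> b \in J ->
  [set` `[a, b]] `<=` [set` J].
Proof.
by move=> aJ bJ t /=; rewrite in_itv /= => tab; exact: (interval_is_interval aJ bJ).
Qed.

(** Weierstrass polynomials on a segment containing the spectrum give a Cauchy sequence of operators
    by [poly_op_norm]; a limit exists, so [xget] returns one. *)
Lemma cfcP (J : interval R) (f : R -> R) X : {within [set` J], continuous f} ->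
  nontrivial -> sp J X -> is_cfc f X (cfc f X).
Proof.
move=> cf ntH sJ; have [a [b [aJ bJ sab _ _]]] := sp_bounds ntH sJ.
have cfab : {within `[a, b], continuous f}.
  exact: (continuous_subspaceW (segment_sub aJ bJ) cf).
have sX := sJ.1.
(* Half the rate, because the difference of two of these polynomials collects two errors. *)
have /choice[p hp] n : exists p : {poly R}, forall t, t \in `[a, b] ->
    `|p.[t] - f t| <= n.+1%:R^-1 / 2.
  by apply: weierstrass => //; rewrite divr_gt0.
have sp t : spectrum X t%:C -> t \in `[a, b] by move=> /sab[s /= sJ' [<-]].
have [n m nm|T hT] := @bop_limit (fun n => poly_op (p n) X).
  move=> x; rewrite -bopB -poly_opN -poly_opD.
  apply: poly_op_norm => // t /sp tab; rewrite hornerD hornerN.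
  have h1 := hp n t tab; have h2 := hp m t tab.
  rewrite -(subrKA (f t)) (le_trans (ler_normD _ _))// (splitr n.+1%:R^-1).
  rewrite lerD// distrC (le_trans h2)// ler_pM2r// lef_pV2 ?posrE//.
  by rewrite ler_nat.
suff hT' : is_cfc f X T by rewrite /cfc; case: xgetP => // /(_ T).
exists p; split.
  apply/uniform_cvgP => e /invS_small[N hN]; exists N => n Nn t /sp tab.
  apply: (le_trans (hp n t tab)); apply: le_trans (hN n Nn).
  by rewrite ler_piMr// invf_le1// ler1n.
apply/cvg0P => e /invS_small[N hN]; exists N => n Nn.
rewrite ger0_norm.
  by apply: le_trans (hN n Nn); apply: opnorm_le => // x; rewrite bopB.
apply: ub_le_sup; first exact: (S_sup _).2.
by exists 0; [rewrite /= normr0|exact: etrans (congr1 _ (bop_arg0 _)) (@hnorm0 _ H)].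
Qed.

(** The given [p] is compared with the sequence behind the value selected by [xget]; only closeness
    on the spectrum enters, so the estimate does not depend on that selection. *)
Lemma cfc_approx (J : interval R) (f : R -> R) X (p : {poly R}) (e : R) :
  {within [set` J], continuous f} -> nontrivial -> sp J X -> 0 <= e ->
  (forall t, spectrum X t%:C -> `|p.[t] - f t| <= e) ->
  forall x, hnorm (poly_op p X x - cfc f X x) <= e * hnorm x.
Proof.
move=> cf ntH sX e0 hp x; have [q [/uniform_cvgP qf /cvg0P qT]] := cfcP cf ntH sX.
rewrite -subr_le0; apply: (@le0_small _ _ (2 * hnorm x)) => d d0.
have [N1 h1] := qf d d0; have [N2 h2] := qT d d0.
pose n := maxn N1 N2; have {}h1 := h1 n (leq_maxl _ _).
have {}h2 := h2 n (leq_maxr _ _).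
rewrite lerBlDr -(subrKA (poly_op (q n) X x)) (le_trans (hnormD _ _))//.
have -> : d * (2 * hnorm x) + e * hnorm x = (e + d) * hnorm x + d * hnorm x by ring.
rewrite lerD//.
  rewrite -bopB -poly_opN -poly_opD; apply: poly_op_norm; [exact: sX.1|lra|].
  move=> t st; rewrite hornerD hornerN -(subrKA (f t)).
  rewrite (le_trans (ler_normD _ _))// lerD ?hp// distrC; exact: h1.
rewrite -bopB (le_trans (le_opnorm _ _))// ler_wpM2r ?hnorm_ge0//.
exact: le_trans (ler_norm _) h2.
Qed.

Lemma cfc_poly_exists (J : interval R) (f : R -> R) X e :
  {within [set` J], continuous f} -> nontrivial -> sp J X -> 0 < e ->
  exists p : {poly R}, (forall t, spectrum X t%:C -> `|p.[t] - f t| <= e) /\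
  forall x, hnorm (poly_op p X x - cfc f X x) <= e * hnorm x.
Proof.
move=> cf ntH sX e0; have [a [b [aJ bJ sab _ _]]] := sp_bounds ntH sX.
have [p hp] := weierstrass (continuous_subspaceW (segment_sub aJ bJ) cf) e0.
have hp' t : spectrum X t%:C -> `|p.[t] - f t| <= e by move=> /sab[s sJ [<-]]; exact: hp.
by exists p; split=> //; apply: (cfc_approx cf ntH sX (ltW e0)).
Qed.

Lemma cfc_selfadjoint (J : interval R) (f : R -> R) X :
  {within [set` J], continuous f} -> nontrivial -> sp J X -> selfadjoint (cfc f X).
Proof.
move=> cf ntH sX.
have h x y : rdot (cfc f X x) y = rdot x (cfc f X y).
  apply/eqP; rewrite -subr_eq0 -normr_eq0 eq_le normr_ge0 andbT.
  apply: (@le0_small _ _ (2 * (hnorm x * hnorm y))) => e e0.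
  have [p [_ hp]] := cfc_poly_exists cf ntH sX e0.
  have sp := selfadjoint_rdot x y (poly_op_selfadjoint p sX.1).
  have -> : rdot (cfc f X x) y - rdot x (cfc f X y) =
      rdot x (poly_op p X y - cfc f X y) - rdot (poly_op p X x - cfc f X x) y.
    by rewrite !(rdotDl, rdotDr, rdotNl, rdotNr) sp; ring.
  have -> : e * (2 * (hnorm x * hnorm y)) =
    hnorm x * (e * hnorm y) + e * hnorm x * hnorm y by ring.
  rewrite (le_trans (ler_normB _ _))// lerD// (le_trans (rdot_abs_le _ _))//.
    by rewrite ler_wpM2l ?hnorm_ge0.
  by rewrite ler_wpM2r ?hnorm_ge0.
by apply/selfadjointP => x y; rewrite !inner_rdot h -bop_argZ h.
Qed.

(** An eigenvalue lies in the spectrum, where the approximating polynomials are close to [f]. This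
    evaluates the calculus on the finite-dimensional test operators. *)
Lemma cfc_eigen (J : interval R) (f : R -> R) X x t :
  {within [set` J], continuous f} -> sp J X -> X x = t%:C *: x -> x != 0 ->
  cfc f X x = (f t)%:C *: x.
Proof.
move=> cf sX Xx x0; have ntH : nontrivial by exists x.
apply/eqP; rewrite -subr_eq0; apply/eqP/hnorm_eq0/eqP.
rewrite eq_le hnorm_ge0 andbT; apply: (@le0_small _ _ (2 * hnorm x)) => e e0.
have st : spectrum X t%:C.
  move=> [B [h _]]; move/eqP: x0; apply.
  by rewrite -[x]bop1E -h bopM bopB bopZ bop1E Xx subrr bop_arg0.
have [p [pf hp]] := cfc_poly_exists cf ntH sX e0.
rewrite -(subrKA (poly_op p X x)) (le_trans (hnormD _ _))//.
rewrite mulrCA mulr_natl mulr2n lerD//; first by rewrite hnormB.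
rewrite (poly_op_eigen _ Xx) -scalerBl -rmorphB hnormZ.
by rewrite ler_wpM2r ?hnorm_ge0// pf.
Qed.
End OpNorm.

(** * Calculus on the line *)

Section Calculus.
Context {R : realType}.
Implicit Types (f g F G : R -> R) (a b x y t h e : R).

(** Derivatives are global on the line and carried as explicit functions; data on a segment are
    first extended by clamping. *)
Definition has_deriv f f' := forall x, is_derive x (1 : R) f (f' x).

Lemma has_deriv_continuous f f' : has_deriv f f' -> continuous f.
Proof.
by move=> h x; apply/differentiable_continuous/derivable1_diffP; have [] := h x.
Qed.

Lemma has_derivD f f' g g' : has_deriv f f' -> has_deriv g g' ->
  has_deriv (fun x => f x + g x) (fun x => f' x + g' x).
Proof. by move=> hf hg x; apply: (is_deriveD (hf x) (hg x)). Qed.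

Lemma has_derivN f f' : has_deriv f f' ->
  has_deriv (fun x => - f x) (fun x => - f' x).
Proof. by move=> hf x; apply: (is_deriveN (hf x)). Qed.

Lemma has_derivM f f' g g' : has_deriv f f' -> has_deriv g g' ->
  has_deriv (fun x => f x * g x) (fun x => f x * g' x + f' x * g x).
Proof.
move=> hf hg x; apply: (is_derive_eq (is_deriveM (hf x) (hg x))).
by rewrite [X in _ + X]mulrC.
Qed.

Lemma has_derivZ c f f' : has_deriv f f' ->
  has_deriv (fun x => c * f x) (fun x => c * f' x).
Proof. by move=> hf x; apply: (is_deriveZ c (hf x)). Qed.

Lemma has_deriv_poly (p : {poly R}) : has_deriv (horner p) (horner p^`()).
Proof. by move=> x; exact: is_derive_poly. Qed.

Lemma has_deriv_affine f f' c d : has_deriv f f' ->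
  has_deriv (fun x => f (c * x + d)) (fun x => c * f' (c * x + d)).
Proof.
move=> hf x.
have hp : is_derive x (1 : R) (fun x => c * x + d) c.
  rewrite (_ : (fun x => _) = horner (c%:P * 'X + d%:P)); last first.
    by apply/funext => y; rewrite !hornerE.
  apply: (is_derive_eq (has_deriv_poly _ x)).
  by rewrite derivD derivM !derivC derivX !hornerE.
by rewrite mulrC; exact: (@is_derive1_comp R f (fun x => c * x + d) x _ _ (hf _) hp).
Qed.

Lemma has_deriv_sum (I : Type) (r : seq I) (f f' : I -> R -> R) :
  (forall i, has_deriv (f i) (f' i)) ->
  has_deriv (fun x => \sum_(i <- r) f i x) (fun x => \sum_(i <- r) f' i x).
Proof.
move=> h; elim: r => [|i r IH].
  rewrite (_ : (fun x => _) = cst 0); last by apply/funext => x; rewrite big_nil.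
  by move=> x; rewrite big_nil; exact: is_derive_cst.
rewrite (_ : (fun x => _) = (fun x => f i x + \sum_(j <- r) f j x)); last first.
  by apply/funext => x; rewrite big_cons.
by move=> x; rewrite big_cons; exact: (has_derivD (h i) IH).
Qed.

Lemma deriv_unique f (f' f'' : R) x : is_derive x (1 : R) f f' -> is_derive x (1 : R) f f'' ->
  f' = f''.
Proof. by move=> [_ <-] [_ <-]. Qed.

Lemma mvt f f' a b : has_deriv f f' -> a <= b ->
  exists c, [/\ a <= c, c <= b & f b - f a = f' c * (b - a)].
Proof.
move=> h ab; have [|c] := @MVT_segment _ f f' a b ab (fun x _ => h x).
  exact/continuous_subspaceT/(has_deriv_continuous h).
by rewrite in_itv /= => /andP[ac cb] e; exists c.
Qed.

Lemma antiderivative_right f : continuous f -> (forall x, x <= 0 -> f x = 0) ->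
  exists F, has_deriv F f.
Proof.
move=> cf f0.
(* The base point [-1] lies strictly to the left of every [x >= 0], where the fundamental theorem is
   applied; for negative [x] both [F] and [f] vanish. *)
pose F x := (\int[lebesgue_measure]_(t in `[(-1)%R, x]) f t)%R.
have F0 x : x <= 0 -> F x = 0.
  move=> x0; rewrite /F (@eq_Rintegral _ _ _ _ _ (cst 0)).
    by rewrite Rintegral_cst// mul0r.
  by move=> y; rewrite inE /= in_itv /= => /andP[_ yx]; rewrite f0// (le_trans yx).
exists F => x; have [x0|x0] := ltrP x 0.
  rewrite f0 ?(ltW x0)//; apply: (@near_eq_is_derive _ _ _ (cst 0)).
    near=> y; rewrite F0//= ltW//; near: y; exact: lt_nbhsl.
have [df dF] : derivable F x 1 /\ (F^`() x)%classic = f x.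
  apply: (@continuous_FTC1 R f (BLeft (-1)) x (x + 1)).
  - by rewrite ltrDl.
  - apply: continuous_compact_integrable; first exact: segment_compact.
    exact: continuous_subspaceT.
  - by rewrite lte_fin (lt_le_trans _ x0)// ltrN10.
  - exact: cf.
split; first exact: df.
by rewrite -dF derive1E.
Unshelve. all: by end_near. Qed.

(** [f - f 0] is a function vanishing on the left half-line plus the reflection of another such
    function; the constant [f 0] contributes a linear term. *)
Lemma antiderivative f : continuous f -> exists F, has_deriv F f.
Proof.
move=> cf.
have cmax : continuous (fun x : R => Num.max x 0).
  by move=> x; apply: continuous_max => //; exact: cst_continuous.
have cNmax : continuous (fun x : R => - Num.max x 0).
  by move=> x; apply: cvgN; exact: cmax.
have [|x x0|F1 h1] := @antiderivative_right (fun x => f (Num.max x 0) - f 0).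
- move=> x; apply: cvgB; last exact: cvg_cst.
  by apply: (@continuous_comp _ _ _ (fun x : R => Num.max x 0) f); [exact: cmax|exact: cf].
- by rewrite max_r// subrr.
have [|x x0|F2 h2] := @antiderivative_right (fun x => f (- Num.max x 0) - f 0).
- move=> x; apply: cvgB; last exact: cvg_cst.
  by apply: (@continuous_comp _ _ _ (fun x : R => - Num.max x 0) f); [exact: cNmax|exact: cf].
- by rewrite max_r// oppr0 subrr.
have h3 := has_derivN (has_deriv_affine (-1) 0 h2).
have h4 := has_deriv_poly ((f 0)%:P * 'X).
exists (fun x => (F1 x + - F2 (-1 * x + 0)) + ((f 0)%:P * 'X).[x]) => x.
apply: (is_derive_eq (has_derivD (has_derivD h1 h3) h4 x)).
rewrite derivM derivC derivX mul0r add0r mulr1 hornerC !mulN1r opprK addr0.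
have [x0|x0] : 0 <= x \/ x <= 0 by apply/orP; exact: le_total.
  have x1 : - x <= 0 by rewrite oppr_le0.
  by rewrite (max_l x0) (max_r x1) oppr0; ring.
have x1 : 0 <= - x by rewrite oppr_ge0.
by rewrite (max_r x0) (max_l x1) opprK; ring.
Qed.
End Calculus.

Section Smooth.
Context {R : realType}.
Implicit Types (f g F G : R -> R) (a b x y t h e : R) (D E : nat -> R -> R).

(** Class [C^k] data kept as one sequence, so that Rolle and Taylor arguments only shift the
    index. *)
Definition derivs k D :=
  (forall j, (j < k)%N -> has_deriv (D j) (D j.+1)) /\ continuous (D k).

Definition smooth k f := exists2 D, D 0%N = f & derivs k D.

Lemma smoothS k f : smooth k.+1 f <-> exists2 f', has_deriv f f' & smooth k f'.
Proof.
split=> [[D <- [hD cD]]|[f' hf [D D0 [hD cD]]]].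
  exists (D 1%N); first exact: hD.
  by exists (fun j => D j.+1) => //; split=> // j jk; exact: hD.
exists (fun j => if j is i.+1 then D i else f) => //; split=> //.
by move=> [_|j jk]; [rewrite D0|exact: hD].
Qed.

Lemma smooth_continuous k f : smooth k f -> continuous f.
Proof.
case: k => [|k]; first by move=> [D <- []].
by move/smoothS => [f' hf _]; exact: has_deriv_continuous hf.
Qed.

Lemma smoothW k f : smooth k.+1 f -> smooth k f.
Proof.
elim: k f => [|k IH] f hf; last first.
  by move/smoothS : hf => [f' hf /IH hf']; apply/smoothS; exists f'.
by exists (fun=> f) => //; split=> //; exact: smooth_continuous hf.
Qed.

Lemma smooth_poly k (p : {poly R}) : smooth k (horner p).
Proof.
exists (fun j => horner p^`(j)) => //; split=> [j _|]; last exact: continuous_horner.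
by rewrite derivnS; exact: has_deriv_poly.
Qed.

Lemma smoothD k f g : smooth k f -> smooth k g -> smooth k (fun x => f x + g x).
Proof.
elim: k f g => [|k IH] f g sf sg.
  exists (fun=> fun x => f x + g x) => //; split=> // x; apply: cvgD.
    exact: (smooth_continuous sf).
  exact: (smooth_continuous sg).
move/smoothS : sf => [f' hf sf]; move/smoothS : sg => [g' hg sg].
by apply/smoothS; exists (fun x => f' x + g' x); [exact: has_derivD|exact: IH].
Qed.

Lemma smoothM k f g : smooth k f -> smooth k g -> smooth k (fun x => f x * g x).
Proof.
elim: k f g => [|k IH] f g sf sg.
  exists (fun=> fun x => f x * g x) => //; split=> // x; apply: cvgM.
    exact: (smooth_continuous sf).
  exact: (smooth_continuous sg).
have sf' := smoothW sf; have sg' := smoothW sg.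
move/smoothS : sf => [f' hf sf]; move/smoothS : sg => [g' hg sg].
apply/smoothS; exists (fun x => f x * g' x + f' x * g x); first exact: has_derivM.
by apply: smoothD; exact: IH.
Qed.

Lemma smooth_affine k f c d : smooth k f -> smooth k (fun x => f (c * x + d)).
Proof.
elim: k f => [|k IH] f sf.
  exists (fun=> fun x => f (c * x + d)) => //; split=> // x.
  apply: (@continuous_comp _ _ _ (fun x => c * x + d) f); last exact: (smooth_continuous sf).
  by apply: cvgD; [apply: cvgM; [exact: cvg_cst|exact: cvg_id]|exact: cvg_cst].
move/smoothS : sf => [f' hf sf].
apply/smoothS; exists (fun x => c * f' (c * x + d)); first exact: has_deriv_affine.
apply: (@smoothM k (fun=> c)); last exact: IH.
rewrite (_ : (fun=> c) = horner c%:P); first exact: smooth_poly.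
by apply/funext => y; rewrite hornerC.
Qed.

(** Continuity of [D k] at [t] starts the descent; each use of the mean value theorem lowers the
    order by one and gains a factor [y - t]. *)
Lemma peano k D t : derivs k D -> (forall j, (j <= k)%N -> D j t = 0) ->
  forall e, 0 < e -> exists2 d, 0 < d &
    forall y, `|y - t| < d -> `|D 0%N y| <= e * `|y - t| ^+ k.
Proof.
move=> [hD cD] D0 e e0.
have /cvgrPdist_le/(_ e e0)/nbhs_ballP[d /= d0 hd] := cD t.
exists d => // y yt.
suff h m : (m <= k)%N -> forall y, `|y - t| < d -> `|D (k - m)%N y| <= e * `|y - t| ^+ m.
  by have := h k (leqnn k) y yt; rewrite subnn.
elim: m => [_|m IH mk] {}y {}yt.
  rewrite subn0 expr0 mulr1; have /= := hd y; rewrite D0// sub0r normrN; apply.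
  by rewrite /ball /= distrC.
have kmE : (k - m = (k - m.+1).+1)%N by rewrite -subSn.
have hd' : has_deriv (D (k - m.+1)%N) (D (k - m)%N).
  by rewrite kmE; apply: hD; rewrite ltn_subrL /= (leq_trans _ mk).
have D0' : D (k - m.+1)%N t = 0 by rewrite D0// leq_subr.
have mono c : `|c - t| <= `|y - t| -> `|D (k - m)%N c| <= e * `|y - t| ^+ m.
  move=> cy; rewrite (le_trans (IH (ltnW mk) c (le_lt_trans cy yt)))//.
  by rewrite ler_pM2l// lerXn2r ?nnegrE.
have [ty|ty] := orP (le_total t y).
  have [c [tc cy]] := mvt hd' ty; rewrite D0' subr0 => ->.
  rewrite normrM exprSr [leRHS]mulrA; apply: ler_wpM2r => //; apply: mono.
  by rewrite !ger0_norm ?subr_ge0// lerD2r.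
have [c [yc ct]] := mvt hd' ty; rewrite D0' sub0r => /eqP; rewrite eqr_oppLR => /eqP ->.
rewrite normrN normrM exprSr [leRHS]mulrA (distrC t); apply: ler_wpM2r => //; apply: mono.
by rewrite distrC [leRHS]distrC !ger0_norm ?subr_ge0// lerD2l lerN2.
Qed.

(** On the Taylor polynomial of order [m] at [t] the functional sees only the top coefficient,
    multiplied by [e^m]; by [peano] the remainder is [o(e^m)], so dividing by [e^m] leaves the sign
    of [D m t]. *)
Lemma moment_deriv_ge0 (K : finType) (c s : K -> R) m D t : derivs m D ->
  (forall j, (j < m)%N -> \sum_k c k * s k ^+ j = 0) ->
  \sum_k c k * s k ^+ m = 1 ->
  (exists2 e0, 0 < e0 & forall e, 0 < e -> e < e0 ->
     0 <= \sum_k c k * D 0%N (t + e * s k)) ->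
  0 <= D m t.
Proof.
move=> hD c0 c1 [e0 e00 he].
pose P := \poly_(j < m.+1) (D j t / j`!%:R).
pose E j y := D j y + - P^`(j).[1 * y + - t].
have hE : derivs m E.
  split=> [j jm|].
    have h := has_deriv_affine 1 (- t) (has_deriv_poly P^`(j)).
    move=> y; have := has_derivD (hD.1 j jm) (has_derivN h) y.
    by rewrite /= mul1r -derivnS.
  move=> y; apply: cvgD; first exact: hD.2.
  apply: cvgN.
  exact: (smooth_continuous (smooth_affine 1 (- t) (smooth_poly 0 P^`(m)))).
have P0 j : (j <= m)%N -> P^`(j).[0] = D j t.
  move=> jm; rewrite horner_coef0 coef_derivn addn0 ffactnn coef_poly ltnS jm.
  by rewrite -[_ *+ _]mulr_natr divfK// pnatr_eq0 -lt0n fact_gt0.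
have E0 j : (j <= m)%N -> E j t = 0.
  by move=> jm; rewrite /E mul1r subrr P0// subrr.
have pm : P`_m = D m t / m`!%:R by rewrite coef_poly ltnSn.
suff : 0 <= P`_m by rewrite pm pmulr_lge0// invr_gt0 ltr0n fact_gt0.
rewrite -oppr_le0; apply: (@le0_small _ _ (\sum_k `|c k| * `|s k| ^+ m)) => r r0.
have [d d0 hd] := peano hE E0 r0.
(* [S] dominates every node, so [e < d / S] keeps all points [t + e * s k] within [d] of [t]. *)
pose S := 1 + \sum_k `|s k|.
have S0 : 0 < S by rewrite ltr_pwDl// sumr_ge0.
have [e ee0 [e0' ed]] : exists2 e, 0 < e & e < e0 /\ e < d / S.
  exists (Num.min e0 (d / S) / 2); first by rewrite divr_gt0// lt_min e00 divr_gt0.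
  have h : Num.min e0 (d / S) / 2 < Num.min e0 (d / S).
    by rewrite ltr_pdivrMr// ltr_pMr ?ltr1n// lt_min e00 divr_gt0.
  by split; apply: (lt_le_trans h); rewrite ge_min lexx ?orbT.
have Pe y : P.[y] = D 0%N (t + y) - E 0%N (t + y).
  by rewrite /E mul1r (addrC t) addrK opprD opprK addNKr.
have sumP : \sum_k c k * P.[e * s k] = P`_m * e ^+ m.
  have mom a j : \sum_k c k * (a * (e * s k) ^+ j) = a * e ^+ j * \sum_k c k * s k ^+ j.
    by rewrite mulr_sumr; apply: eq_bigr => k _; rewrite exprMn; ring.
  under eq_bigr do rewrite horner_poly mulr_sumr.
  rewrite exchange_big /= (bigD1 ord_max)//= mom c1 mulr1 -pm big1 ?addr0// => j jm.
  have {}jm : (j < m)%N.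
    by rewrite ltn_neqAle -ltnS ltn_ord andbT; apply: contraNneq jm => jm; apply/eqP/val_inj.
  by rewrite mom c0// mulr0.
have em : 0 < e ^+ m by rewrite exprn_gt0.
rewrite -(@ler_pM2r _ (e ^+ m))// mulNr -sumP.
under eq_bigr do rewrite Pe mulrBr.
rewrite sumrB opprB lerBlDr; apply: (@le_trans _ _ (r * (\sum_k `|c k| * `|s k| ^+ m) * e ^+ m)).
  rewrite mulrAC mulr_sumr; apply: ler_sum => k _.
  rewrite (le_trans (ler_norm _))// normrM mulrCA ler_wpM2l//.
  have h := hd (t + e * s k).
  have e1 : t + e * s k - t = e * s k by ring.
  rewrite e1 normrM (gtr0_norm ee0) exprMn mulrA in h; apply: h.
  rewrite (@le_lt_trans _ _ (e * S))// -?ltr_pdivlMr// ler_pM2l//.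
  by rewrite /S (bigD1 k)//= addrCA lerDl addr_ge0// sumr_ge0.
by rewrite lerDl he.
Qed.
End Smooth.

(** * Hermite interpolation by secants *)

Section Hermite.
Context {R : realType}.
Implicit Types (f g G : R -> R) (a b x y z t : R) (D : nat -> R -> R) (s : seq R).

Lemma rolle_strict f f' a b : has_deriv f f' -> a < b -> f a = 0 -> f b = 0 ->
  exists c, [/\ a < c, c < b & f' c = 0].
Proof.
move=> h ab fa fb; have [||c] := @Rolle _ f a b ab _ _ (etrans fa (esym fb)).
- by move=> x _; have [] := h x.
- exact/continuous_subspaceT/(has_deriv_continuous h).
rewrite in_itv /= => /andP[ac cb] hc; exists c; split=> //.
exact: deriv_unique (h c) hc.
Qed.

Lemma rolle_path f f' s x : has_deriv f f' -> path <%R x s ->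
  {in x :: s, forall y, f y = 0} ->
  exists s', [/\ size s' = size s, uniq s', {in s', forall y, f' y = 0},
    {in s', forall y, x < y <= last x s} & {in s', forall y, y \notin x :: s}].
Proof.
move=> h; elim: s x => [|y s IH] x /=; first by exists [::].
move=> /andP[xy ys] f0.
have [|s' [ss us zs bs ns]] := IH y ys; first by move=> z zs; apply: f0; rewrite inE zs orbT.
have [c [xc cy f'c]] := rolle_strict h xy (f0 x (mem_head _ _))
  (f0 y (mem_behead (s := x :: y :: s) (mem_head _ _))).
have yl : y <= last y s.
  case: (s) ys {IH f0 ss ns bs} => // w r ys.
  have := order_path_min lt_trans ys => /allP/(_ (last w r)).
  by rewrite mem_last => /(_ isT) /ltW.
have bs' z : z \in s' -> y < z by move=> /bs /andP[].
exists (c :: s'); split=> /=.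
- by rewrite ss.
- rewrite us andbT; apply/negP => /bs' yc.
  by have := lt_trans cy yc; rewrite ltxx.
- by move=> z; rewrite inE => /orP[/eqP ->|/zs].
- move=> z; rewrite inE => /orP[/eqP ->|zs']; first by rewrite xc (le_trans (ltW cy)).
  by have /andP[yz ->] := bs z zs'; rewrite (lt_trans xy yz).
- move=> z; rewrite inE => /orP[/eqP ->|zs'].
    rewrite !inE gt_eqF//= lt_eqF//=; apply/negP => cs.
    have /allP/(_ c cs) := order_path_min lt_trans ys.
    by move=> /(lt_trans cy); rewrite ltxx.
  by rewrite inE negb_or ns// andbT gt_eqF// (lt_trans xy) ?bs'.
Qed.

(** The zeros of [f'] found here avoid [s], so they can be counted together with the interpolation
    nodes, where [f'] vanishes as well. *)
Lemma rolle_uniq f f' a b s k : has_deriv f f' -> uniq s -> size s = k.+1 ->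
  {in s, forall y, a <= y <= b} -> {in s, forall y, f y = 0} ->
  exists s', [/\ size s' = k, uniq s', {in s', forall y, f' y = 0},
    {in s', forall y, a <= y <= b} & {in s', forall y, y \notin s}].
Proof.
move=> h us ss sab sf; pose r := sort <=%R s.
have rs : r =i s by move=> y; rewrite mem_sort.
have : sorted <%R r by rewrite sort_lt_sorted.
have : size r = k.+1 by rewrite size_sort.
case: r rs => // x r rs [rk] /= xr.
have [|s' [ss' us' zs bs ns]] := rolle_path h xr; first by move=> y; rewrite rs => /sf.
exists s'; split=> //; first by rewrite ss'.
  move=> y /bs /andP[xy yl].
  have /sab/andP[ax _] : x \in s by rewrite -rs mem_head.
  have /sab/andP[_ lb] : last x r \in s by rewrite -rs mem_last.
  by rewrite (le_trans ax (ltW xy)) (le_trans yl).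
by move=> y /ns; rewrite rs.
Qed.

Lemma rolle_iter k D a b s : derivs k D -> uniq s -> size s = k.+1 ->
  {in s, forall y, a <= y <= b} -> {in s, forall y, D 0%N y = 0} ->
  exists2 z, a <= z <= b & D k z = 0.
Proof.
elim: k D s => [|k IH] D s [hD cD] us ss sab sf.
  case: s ss us sab sf => // z s _ _ sab sf.
  by exists z; [apply: sab|apply: sf]; rewrite mem_head.
have [s' [ss' us' zs bs _]] := rolle_uniq (hD 0%N isT) us ss sab sf.
apply: (IH (fun j => D j.+1) s') => //; split=> // j jk; exact: hD.
Qed.

Definition secant (f f' : R -> R) a b x :=
  if a == b then f a + f' a * (x - a)
  else (f a * (x - b) - f b * (x - a)) / (a - b).

Lemma secantC f f' a b x : secant f f' a b x = secant f f' b a x.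
Proof.
rewrite /secant eq_sym; case: eqVneq => [->//|ba].
have h : b - a != 0 by rewrite subr_eq0.
have h' : a - b != 0 by rewrite subr_eq0 eq_sym.
by field; rewrite h h'.
Qed.

Lemma secant_l f f' a b : secant f f' a b a = f a.
Proof.
rewrite /secant; case: eqVneq => [->|ab]; first by rewrite subrr mulr0 addr0.
by rewrite subrr mulr0 subr0 mulfK// subr_eq0.
Qed.

Lemma secant_poly f f' a b : exists2 p : {poly R}, (size p <= 2)%N &
  forall x, p.[x] = secant f f' a b x.
Proof.
have h (c d : R) : (size (c%:P * 'X + d%:P)%R <= 2)%N.
  apply: (leq_trans (size_polyD _ _)); rewrite geq_max.
  rewrite (leq_trans (size_polyC_leq1 _))// andbT.
  by rewrite mul_polyC (leq_trans (size_scale_leq _ _))// size_polyX.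
rewrite /secant; case: eqVneq => [ab|ab].
  exists ((f' a)%:P * 'X + (f a - f' a * a)%:P) => // x.
  by rewrite !(hornerD, hornerM, hornerC, hornerX, hornerN, hornerZ); ring.
exists (((f a - f b) / (a - b))%:P * 'X + ((f b * a - f a * b) / (a - b))%:P) => // x.
have h' : a - b != 0 by rewrite subr_eq0.
by rewrite !(hornerD, hornerM, hornerC, hornerX, hornerN, hornerZ); field.
Qed.

Lemma secant_deriv f f' a : has_deriv (secant f f' a a) (fun=> f' a).
Proof.
rewrite (_ : secant f f' a a = horner ((f' a)%:P * 'X + (f a - f' a * a)%:P)).
  move=> x; apply: (is_derive_eq (has_deriv_poly _ x)).
  by rewrite derivD derivM !derivC derivX mul0r add0r mulr1 addr0 hornerC.
by apply/funext => x; rewrite /secant eqxx !(hornerD, hornerM, hornerC, hornerX, hornerN, hornerZ); ring.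
Qed.

Let chi s : {poly R} := \prod_(d <- s) ('X - d%:P).

(* With [q = sum_b w_b (x - b) chi_b], where [chi_b] is the node polynomial with
   [b] removed, [q^2 G] minus its Hermite interpolant at the doubled nodes takes
   at [x] the value [chi(x)^2 sum_bc w_b w_c (G x - secant b c x)], and it is
   nonnegative there because the derivative of order [2 size s] is. *)
Lemma secant_kernel_ge0_notin f f' s (w : R -> R) a b x n : size s = n ->
  smooth (n + n) f -> has_deriv f f' -> uniq s ->
  {in s, forall y, a <= y <= b} -> a <= x <= b -> x \notin s ->
  (forall (q : {poly R}) D, (size q <= n)%N -> derivs (n + n) D ->
     D 0%N = (fun z => q.[z] ^+ 2 * f z) -> forall z, a <= z <= b -> 0 <= D (n + n)%N z) ->
  0 <= \sum_(c <- s) \sum_(d <- s) w c * w d * (f x - secant f f' c d x).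
Proof.
move=> sn sf hf us sab xab xs hq.
have [n0|n0] := posnP n.
  by move: sn; rewrite n0 => /size0nil ->; rewrite big_nil.
pose k c := chi (rem c s).
have chik c : c \in s -> chi s = ('X - c%:P) * k c.
  by move=> cs; rewrite /chi (big_rem c).
have k0 c e : c \in s -> e \in s -> c != e -> (k c).[e] = 0.
  move=> cs es ce; apply/eqP; rewrite -/(root _ _) root_prod_XsubC.
  by rewrite mem_rem_uniq// inE eq_sym ce.
have sk c : c \in s -> size (k c) = n.
  by move=> cs; rewrite size_prod_XsubC size_rem// sn prednK.
pose q := \sum_(c <- s) (w c * (x - c)) *: k c.
have sq : (size q <= n)%N.
  rewrite /q big_seq; apply: (big_ind (fun p : {poly R} => (size p <= n)%N)).
  - by rewrite size_poly0.
  - by move=> p1 p2 h1 h2; rewrite (leq_trans (size_polyD _ _))// geq_max h1.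
  - by move=> c cs; rewrite (leq_trans (size_scale_leq _ _))// sk.
have /choice[l hl] (cd : R * R) : exists p : {poly R}, (size p <= 2)%N /\
    forall y, p.[y] = secant f f' cd.1 cd.2 y.
  by have [p h1 h2] := secant_poly f f' cd.1 cd.2; exists p.
(* The factors [x - c] and [x - d] complete [k c] and [k d], evaluated at [x], to the full node
   polynomial; this gives [rx]. *)
pose W c d := w c * w d * ((x - c) * (x - d)).
pose pi := \sum_(c <- s) \sum_(d <- s) W c d *: (k c * k d * l (c, d)).
have spi : (size pi <= n + n)%N.
  rewrite /pi big_seq; apply: (big_ind (fun p : {poly R} => (size p <= n + n)%N)).
  - by rewrite size_poly0.
  - by move=> p1 p2 h1 h2; rewrite (leq_trans (size_polyD _ _))// geq_max h1.
  move=> c cs; rewrite big_seq; apply: (big_ind (fun p : {poly R} => (size p <= n + n)%N)).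
  - by rewrite size_poly0.
  - by move=> p1 p2 h1 h2; rewrite (leq_trans (size_polyD _ _))// geq_max h1.
  move=> d ds; rewrite (leq_trans (size_scale_leq _ _))//.
  rewrite (leq_trans (size_polyMleq _ _))//.
  have h1 : (size (k c * k d)%R <= (n + n).-1)%N.
    by rewrite (leq_trans (size_polyMleq _ _))// !sk.
  have [h2 _] := hl (c, d); have := leq_add h1 h2; move: (_ + _)%N => -[//|u].
  by rewrite addn2 ltnS prednK// addn_gt0 n0.
pose r z := \sum_(c <- s) \sum_(d <- s) W c d * ((k c * k d).[z] * (f z - secant f f' c d z)).
have rE z : r z = q.[z] ^+ 2 * f z - pi.[z].
  rewrite /r /q /pi !horner_sum expr2 mulr_suml mulr_suml -sumrB.
  apply: eq_bigr => c _; rewrite horner_sum mulr_sumr mulr_suml -sumrB.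
  apply: eq_bigr => d _; have [_ <-] := hl (c, d);
    rewrite !(hornerD, hornerM, hornerC, hornerX, hornerN, hornerZ) /W; ring.
have chix : (chi s).[x] != 0.
  by rewrite -/(root _ _) root_prod_XsubC.
have rx : r x = (chi s).[x] ^+ 2 *
    \sum_(c <- s) \sum_(d <- s) w c * w d * (f x - secant f f' c d x).
  rewrite /r mulr_sumr big_seq [RHS]big_seq; apply: eq_bigr => c cs.
  rewrite mulr_sumr big_seq [RHS]big_seq; apply: eq_bigr => d ds.
  rewrite expr2 {1}(chik c cs) (chik d ds) !(hornerD, hornerM, hornerC, hornerX, hornerN, hornerZ) /W; ring.
suff : 0 <= r x / (chi s).[x] ^+ 2.
  by rewrite rx mulrAC divff ?mul1r// expf_neq0.
(* Newton's choice: subtracting [kap * chi^2] adds a zero at [x] to the double zeros at the nodes.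
   These [2n + 1] zeros force a zero of the derivative of order [2n], where that of [q^2 f] equals
   [kap * (2n)!], whence the sign of [kap]. *)
set kap := r x / _.
pose P := pi + kap *: (chi s * chi s).
have [D0 D0E hD0] : smooth (n + n) (fun z => q.[z] ^+ 2 * f z).
  apply: smoothM => //; rewrite (_ : (fun z => _) = horner (q ^+ 2)).
    exact: smooth_poly.
  by apply/funext => z; rewrite horner_exp.
pose D j z := D0 j z + - P^`(j).[z].
have hD : derivs (n + n) D.
  split=> [j jn|z].
    have h := has_derivD (hD0.1 j jn) (has_derivN (has_deriv_poly P^`(j))).
    by move=> z; have := h z; rewrite -derivnS.
  by apply: cvgD; [exact: hD0.2|apply: cvgN; exact: continuous_horner].
have Dr z : D 0%N z = r z - kap * (chi s).[z] ^+ 2.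
  by rewrite /D D0E rE /P derivn0 !(hornerD, hornerM, hornerC, hornerX, hornerN, hornerZ);
    ring.
have chi0 c : c \in s -> (chi s).[c] = 0.
  by move=> cs; apply/eqP; rewrite -/(root _ _) root_prod_XsubC.
(* At a node only the diagonal term has a nonzero kernel factor, and there the secant takes the
   value of [f]. *)
have Dc c : c \in s -> D 0%N c = 0.
  move=> cs; rewrite Dr chi0// expr0n mulr0 subr0 /r big_seq big1// => d ds.
  rewrite big_seq big1// => e es; rewrite hornerM.
  have [dc|dc] := eqVneq d c; last by rewrite k0// !mul0r mulr0.
  have [ec|ec] := eqVneq e c; last by rewrite (k0 e c)// mulr0 mul0r mulr0.
  by rewrite dc ec secant_l subrr !mulr0.
have Dx : D 0%N x = 0.
  by rewrite Dr /kap divfK ?subrr// expf_neq0.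
have nn : (0 < n + n)%N by rewrite addn_gt0 n0.
(* In the product rule, the diagonal term at [e] vanishes because its secant is the tangent. If just
   one index is [e], the kernel factor and the secant error both vanish; if neither is, the kernel
   factor has a double zero. *)
have Dc' e : e \in s -> D 1%N e = 0.
  move=> es; pose r' z := \sum_(c <- s) \sum_(d <- s) W c d *
    ((k c * k d).[z] * (f' z + - (l (c, d))^`().[z]) +
     (k c * k d)^`().[z] * (f z + - (l (c, d)).[z])).
  have hr : has_deriv r r'.
    rewrite (_ : r = fun z => \sum_(c <- s) \sum_(d <- s) W c d *
        ((k c * k d).[z] * (f z + - (l (c, d)).[z]))).
      apply: has_deriv_sum => c; apply: has_deriv_sum => d; apply: has_derivZ.
      apply: has_derivM; first exact: has_deriv_poly.
      by apply: has_derivD => //; apply: has_derivN; exact: has_deriv_poly.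
    apply/funext => z; apply: eq_bigr => c' _; apply: eq_bigr => d _.
    by have [_ ->] := hl (c', d).
  have hD1 := has_derivD hr (has_derivN (has_deriv_poly (kap *: (chi s * chi s)))).
  have D0r : D 0%N = fun z => r z + - (kap *: (chi s * chi s)).[z].
    by apply/funext => z; rewrite Dr hornerZ hornerM expr2.
  have := hD.1 0%N nn e; rewrite D0r => h; rewrite (deriv_unique h (hD1 e)).
  rewrite derivZ derivM !(hornerD, hornerM, hornerZ) chi0// !(mulr0, mul0r) addr0 mulr0 subr0.
  rewrite /r' big_seq big1// => c cs; rewrite big_seq big1// => d ds.
  rewrite derivM hornerD !hornerM; have [_ lE] := hl (c, d); rewrite lE /=.
  have [ce|ce] := eqVneq c e; have [de|de] := eqVneq d e.
  - have -> : (l (c, d))^`().[e] = f' e.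
      apply: (deriv_unique (has_deriv_poly _ e)).
      rewrite (_ : horner _ = secant f f' e e); first exact: secant_deriv.
      by apply/funext => z; rewrite lE ce de.
    by rewrite ce de secant_l; ring.
  - by rewrite ce secant_l (k0 d e)//; ring.
  - by rewrite de secantC secant_l (k0 c e)//; ring.
  - by rewrite (k0 d e)// (k0 c e)//; ring.
have [||||s' [ss' us' zs bs ns]] := @rolle_uniq (D 0%N) (D 1%N) a b (x :: s) n (hD.1 0%N nn).
- by rewrite /= xs us.
- by rewrite /= sn.
- by move=> y; rewrite inE => /orP[/eqP ->//|/sab].
- by move=> y; rewrite inE => /orP[/eqP ->//|/Dc].
have nnE : (n + n = (n + n).-1.+1)%N by rewrite prednK.
have [|||||z zab] := @rolle_iter (n + n).-1 (fun j => D j.+1) a b (s' ++ s).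
- split=> [j jn|]; first by apply: hD.1; rewrite nnE ltnS.
  by rewrite -nnE; exact: hD.2.
- rewrite cat_uniq us' us andbT; apply/hasPn => y ys; apply/negP => /ns.
  by rewrite inE ys orbT.
- by rewrite size_cat ss' sn -nnE.
- by move=> y; rewrite mem_cat => /orP[/bs|/sab].
- by move=> y; rewrite mem_cat => /orP[/zs|/Dc'].
rewrite -nnE /D => /eqP; rewrite subr_eq0 => /eqP Dz.
have := hq q D0 sq hD0 D0E z zab; rewrite Dz /P derivnD hornerD derivn_poly0// horner0 add0r.
rewrite derivnZ hornerZ (_ : (chi s * chi s)^`(n + n) = ((n + n)`!)%:R%:P).
  by rewrite hornerC pmulr_lge0// ltr0n fact_gt0.
have mchi : chi s * chi s \is monic by rewrite monicMl ?monic_prod_XsubC.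
have schi : size (chi s * chi s)%R = (n + n).+1.
  by rewrite size_monicM ?monic_prod_XsubC ?monic_neq0 ?monic_prod_XsubC// !size_prod_XsubC sn addnS.
apply/polyP => i; rewrite coef_derivn coefC; case: i => [|i].
  rewrite addn0 ffactnn; move/monicP: mchi; rewrite lead_coefE schi /= => ->.
  by [].
by rewrite nth_default ?mul0rn// schi addnS ltnS leq_addr.
Qed.

(** If [x] is a node, every secant through it is exact at [x]; the node can be removed and the
    previous case used with one node fewer. Hence the hypotheses for all orders up to [size s]. *)
Lemma secant_kernel_ge0 f f' s (w : R -> R) a b x :
  (forall n, (n <= size s)%N -> smooth (n + n) f) -> has_deriv f f' -> uniq s ->
  {in s, forall y, a <= y <= b} -> a <= x <= b ->
  (forall n (q : {poly R}) D, (n <= size s)%N -> (size q <= n)%N -> derivs (n + n) D ->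
     D 0%N = (fun z => q.[z] ^+ 2 * f z) -> forall z, a <= z <= b -> 0 <= D (n + n)%N z) ->
  0 <= \sum_(c <- s) \sum_(d <- s) w c * w d * (f x - secant f f' c d x).
Proof.
move=> sf hf us sab xab hq; have [xs|xs] := boolP (x \in s); last first.
  by apply: (@secant_kernel_ge0_notin _ _ _ _ a b x (size s)) => // [|q D];
    [exact: sf|exact: hq].
have /(@secant_kernel_ge0_notin f f' (rem x s) w a b x (size s).-1) h : size (rem x s) = (size s).-1.
  exact: size_rem.
have sP : ((size s).-1 <= size s)%N by exact: leq_pred.
have zero c d : (c == x) || (d == x) -> f x - secant f f' c d x = 0.
  by case/orP => /eqP ->; rewrite ?(secantC _ _ c) secant_l subrr.
have red (F : R -> R) : F x = 0 -> \sum_(c <- s) F c = \sum_(c <- rem x s) F c.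
  by move=> F0; rewrite (big_rem x xs) /= F0 add0r.
rewrite red; last by rewrite big1// => d _; rewrite zero ?eqxx// mulr0.
under eq_bigr do rewrite red ?zero ?eqxx ?orbT ?mulr0//.
apply: h => //.
- exact: sf.
- exact: rem_uniq.
- by move=> y /mem_rem; exact: sab.
- by rewrite mem_rem_uniq// inE eqxx.
- by move=> q D; apply: hq.
Qed.
End Hermite.

(** * Mollification *)

Section Mollification.
Context {R : realType}.
Implicit Types (f g F G : R -> R) (a b x y z t h e : R) (D : nat -> R -> R).

(* [c] and [s] are the weights and nodes of a functional that kills the degrees below
   [m] and is normalized at degree [m]; [node_ge0] states its positivity on [q^2 f]
   after transport by the affine maps [y |-> t + e y]. *)
Definition moments (K : finType) (m : nat) (c s : K -> R) :=
  [/\ forall k, `|s k| <= 3, forall j, (j < m)%N -> \sum_k c k * s k ^+ j = 0 &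
    \sum_k c k * s k ^+ m = 1].

Definition node_ge0 (K : finType) (n : nat) (c s : K -> R) f a b :=
  forall (q : {poly R}) t e, (size q <= n)%N -> 0 < e -> a <= t - 3 * e -> t + 3 * e <= b ->
    0 <= \sum_k c k * (q.[t + e * s k] ^+ 2 * f (t + e * s k)).

(** The mean value theorem, applied to the whole functional at once, replaces the average by a
    single translate of [f]; translating [q] the other way reduces it to the hypothesis. The
    translate lies up to [h] to the right, whence the loss at [b]. *)
Lemma steklov_node_ge0 (K : finType) (n : nat) (c s : K -> R) f F a b h : has_deriv F f ->
  0 < h -> node_ge0 n c s f a b ->
  node_ge0 n c s (fun x => h^-1 * (F (1 * x + h) + - F x)) a (b - h).
Proof.
move=> hF h0 hf q t e sq e0 ha hb.
pose Phi y := \sum_k c k * q.[t + e * s k] ^+ 2 * F (1 * y + (t + e * s k)).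
pose phi y := \sum_k c k * q.[t + e * s k] ^+ 2 * (1 * f (1 * y + (t + e * s k))).
have hPhi : has_deriv Phi phi.
  by apply: has_deriv_sum => k; apply: has_derivZ; exact: has_deriv_affine.
have [y [y0 yh hy]] := mvt hPhi (ltW h0).
have -> : \sum_k c k * (q.[t + e * s k] ^+ 2 *
    (h^-1 * (F (1 * (t + e * s k) + h) + - F (t + e * s k)))) = h^-1 * (Phi h - Phi 0).
  rewrite /Phi -sumrB mulr_sumr; apply: eq_bigr => k _.
  by rewrite !mul1r add0r (addrC h); ring.
rewrite hy subr0 mulrC mulfK ?gt_eqF//.
have := hf (q \Po ('X - y%:P)) (t + y) e.
rewrite size_comp_poly2 ?size_XsubC// => /(_ sq e0) hfy.
have {hfy} : 0 <= \sum_k c k *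
    ((q \Po ('X - y%:P)).[t + y + e * s k] ^+ 2 * f (t + y + e * s k)).
  by apply: hfy; lra.
congr (_ <= _); apply: eq_bigr => k _.
rewrite horner_comp hornerXsubC (_ : t + y + e * s k - y = t + e * s k); last by ring.
by rewrite (_ : t + y + e * s k = 1 * y + (t + e * s k)); ring.
Qed.

(** Each average gains one derivative and displaces points by at most [h]. A single [G] keeps
    positivity for all functionals, because all orders [n] are used with it simultaneously. *)
Lemma mollification (k : nat) f h : continuous f -> 0 < h ->
  exists G, [/\ smooth k G, forall x, exists2 y, x <= y <= x + k%:R * h & G x = f y &
    forall (K : finType) n (c s : K -> R) a b, node_ge0 n c s f a b ->
      node_ge0 n c s G a (b - k%:R * h)].
Proof.
move=> cf h0; elim: k => [|k [G [sG Gf hG]]].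
  exists f; split=> [|x|K n c s a b].
  - by exists (fun=> f).
  - by exists x => //; rewrite mul0r addr0 lexx.
  - by rewrite mul0r subr0.
have [F hF] := antiderivative (smooth_continuous sG).
exists (fun x => h^-1 * (F (1 * x + h) + - F x)); split=> [|x|K n c s a b hf].
- apply/smoothS; exists (fun x => h^-1 * (1 * G (1 * x + h) + - G x)).
    by apply: has_derivZ; apply: has_derivD; [exact: has_deriv_affine|exact: has_derivN].
  have sc (d : R) : smooth k (fun=> d).
    rewrite (_ : (fun=> d) = horner d%:P); first exact: smooth_poly.
    by apply/funext => y; rewrite hornerC.
  apply: (smoothM (sc _)); apply: smoothD.
    by apply: (smoothM (sc _)); exact: smooth_affine.
  rewrite (_ : (fun x => - G x) = fun x => -1 * G x); first exact: (smoothM (sc _)).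
  by apply/funext => x; rewrite mulN1r.
- have xh : x <= x + h by rewrite lerDl ltW.
  have [z [xz zh hz]] := mvt hF xh.
  have {}hz : F (x + h) - F x = G z * h by rewrite hz; ring.
  have -> : h^-1 * (F (1 * x + h) + - F x) = G z.
    by rewrite mul1r hz mulrC mulfK ?gt_eqF.
  have [y /andP[zy yz] ->] := Gf z.
  by exists y => //; rewrite (le_trans xz zy) -natr1; lra.
- rewrite -natr1 mulrDl mul1r opprD addrA; apply: steklov_node_ge0 => //.
  exact: hG.
Qed.

Lemma smooth_le m n f : (m <= n)%N -> smooth n f -> smooth m f.
Proof.
elim: n => [|n IH]; first by rewrite leqn0 => /eqP ->.
rewrite leq_eqVlt => /orP[/eqP ->//|mn /smoothW]; exact: IH.
Qed.

(** Extends functions on [[a, b]] by constants to the whole line, where averages are defined. *)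
Definition clamp a b x := Num.max a (Num.min b x).

Lemma clamp_itv a b x : a <= b -> a <= clamp a b x <= b.
Proof. by move=> ab; rewrite /clamp le_max lexx /= ge_max ab ge_min lexx. Qed.

Lemma clamp_id a b x : a <= x <= b -> clamp a b x = x.
Proof. by move=> /andP[ax xb]; rewrite /clamp (min_r xb) (max_r ax). Qed.

Lemma clamp_lipschitz a b x y : `|clamp a b x - clamp a b y| <= `|x - y|.
Proof.
wlog xy : x y / x <= y => [h|].
  by have /orP[/h//|/h] := le_total x y; rewrite distrC [leRHS]distrC.
have cxy : clamp a b x <= clamp a b y.
  by rewrite /clamp le_max2 // ?le_min2.
rewrite distrC ger0_norm ?subr_ge0// distrC ger0_norm ?subr_ge0//.
rewrite /clamp !minEle; do !(case: ifPn; rewrite -?ltNge => ?);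
by rewrite !maxEle; do !(case: ifPn; rewrite -?ltNge => ?); lra.
Qed.

Lemma clamp_continuous f a b : a <= b -> {within `[a, b], continuous f} ->
  continuous (f \o clamp a b).
Proof.
move=> ab cf x; apply/cvgrPdist_le => e e0.
have [d d0 hd] := segment_unif_continuous cf e0.
apply/nbhs_ballP; exists d => // y; rewrite /ball /= => xy.
apply: hd; rewrite ?in_itv/= ?clamp_itv//.
exact: le_lt_trans (clamp_lipschitz _ _ _ _) xy.
Qed.

Lemma secant_affine (f f' : R -> R) a b :
  exists mn : R * R, forall x, secant f f' a b x = mn.1 + mn.2 * x.
Proof.
have [p sp hp] := secant_poly f f' a b; exists (p`_0, p`_1) => x /=.
by rewrite -hp (horner_coef_wide _ sp) !big_ord_recl big_ord0 /= expr0 expr1 mulr1 addr0.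
Qed.

End Mollification.

(** * The affine certificate for a continuous function *)

Section Certificate.
Context {R : realType}.
Implicit Types (f g F G : R -> R) (a b x y z t h e : R) (D : nat -> R -> R).

(** The strict margins around [[a', b']] leave room for the nodes [z + e * s k] with [e] small, so
    the derivative can be extracted at every point of it. *)
Lemma node_ge0_deriv (K : finType) (n : nat) (c s : K -> R) G a b a' b' (q : {poly R}) D z :
  moments (n + n) c s -> node_ge0 n c s G a b -> a < a' -> b' < b ->
  (size q <= n)%N -> derivs (n + n) D -> D 0%N = (fun z => q.[z] ^+ 2 * G z) ->
  a' <= z <= b' -> 0 <= D (n + n)%N z.
Proof.
move=> [s3 c0 c1] hG aa bb sq hD D0 /andP[az zb].
apply: (moment_deriv_ge0 hD c0 c1).
exists (Num.min (a' - a) (b - b') / 3) => [|e e0].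
  by rewrite divr_gt0// lt_min !subr_gt0 aa.
rewrite ltr_pdivlMr// lt_min => /andP[e1 e2]; rewrite D0.
by apply: hG => //; lra.
Qed.

Lemma affine_certificate (N : nat) f a b (bs : 'I_N -> R) e :
  {within `[a, b], continuous f} -> 0 < e -> (forall i, a <= bs i <= b) ->
  (forall n, (0 < n <= N)%N -> exists K : finType, exists c s : K -> R,
     moments (n + n) c s /\ node_ge0 n c s f a b) ->
  exists M P : 'I_N -> 'I_N -> R,
    (forall i, f (bs i) - e <= M i i + P i i * bs i) /\
    forall x, a <= x <= b -> forall y : 'I_N -> R,
      \sum_i \sum_j y i * y j * (M i j + P i j * x) <= (f x + e) * (\sum_i y i) ^+ 2.
Proof.
move=> cf e0 bsab hf.
have [N0|N0] := posnP N.
  have no (i : 'I_N) : False by have := ltn_ord i; rewrite [X in (_ < X)%N]N0.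
  exists (fun _ _ => 0), (fun _ _ => 0); split=> [i|x _ y]; first by case: (no i).
  by rewrite !big1 ?expr0n ?mulr0// => i; case: (no i).
pose i0 : 'I_N := Ordinal N0.
have ab : a <= b by have /andP[h1 h2] := bsab i0; exact: le_trans h1 h2.
(* The contraction used below needs [a < b]; on a one-point segment the constant [f a] serves. *)
have := ab; rewrite le_eqVlt => /orP[/eqP abE|{}ab'].
  exists (fun _ _ => f a), (fun _ _ => 0); split=> [i|x].
    rewrite mul0r addr0 (_ : bs i = a) ?gerBl ?ltW//.
    by apply/eqP; rewrite eq_le andbC {2}abE; exact: bsab.
  rewrite -abE => xa y; rewrite (_ : x = a); last first.
    by apply/eqP; rewrite eq_le andbC.
  rewrite mulrDl -[leLHS]addr0 lerD//; last by apply: mulr_ge0; [exact: ltW|exact: sqr_ge0].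
  rewrite expr2 mulr_suml mulr_sumr le_eqVlt; apply/orP; left; apply/eqP.
  apply: eq_bigr => i _; rewrite !mulr_sumr; by apply: eq_bigr => j _; ring.
have [d d0 hd] := segment_unif_continuous cf e0.
(* [A] displaces points by at most [del] and the averages by at most [del / 2], so [d / 4] stays
   within the modulus of continuity; [(b - a) / 4] keeps the factor [kap] nonnegative. *)
pose del := Num.min (d / 4) ((b - a) / 4).
have del0 : 0 < del by rewrite lt_min; apply/andP; split; apply: divr_gt0; rewrite ?subr_gt0.
have del1 : del <= d / 4 by rewrite ge_min lexx.
have del2 : del <= (b - a) / 4 by rewrite ge_min lexx orbT.
(* [N + N] averages provide the [2N] derivatives needed for [N] double nodes, with total
   displacement [del / 2]. *)
pose h := del / 2 / (N + N)%:R.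
have NN0 : 0 < (N + N)%:R :> R by rewrite ltr0n addn_gt0 N0.
have h0 : 0 < h by rewrite !divr_gt0.
have Nh : (N + N)%:R * h = del / 2 by rewrite /h mulrCA mulfV ?mulr1// gt_eqF.
have [G [sG Gf hG]] := mollification (N + N) (clamp_continuous ab cf) h0.
rewrite Nh in Gf hG.
(* [A] contracts [[a, b]] affinely onto [[a + del, b - del]]; secants of [G] composed with [A]
   remain affine in [x]. *)
pose kap := 1 - 2 * del / (b - a).
pose A x := a + del + (x - a) * kap.
have ba0 : 0 < b - a by rewrite subr_gt0.
have kap0 : 0 <= kap.
  by rewrite subr_ge0 ler_pdivrMr// mul1r; lra.
have Aab x : a <= x <= b -> [/\ a + del <= A x, A x <= b - del & `|A x - x| <= del].
  move=> /andP[ax xb].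
  have h1 : (x - a) * kap = (x - a) - 2 * ((x - a) / (b - a) * del).
    by rewrite /kap; ring.
  have h2 : 0 <= (x - a) / (b - a) <= 1.
    by rewrite divr_ge0 ?subr_ge0//= ler_pdivrMr// mul1r lerD2r.
  have h3 : 0 <= (x - a) * kap by rewrite mulr_ge0// subr_ge0.
  have h4 : (x - a) * kap <= (b - a) * kap by rewrite ler_wpM2r// lerD2r.
  have h5 : (b - a) * kap = b - a - 2 * del.
    by rewrite /kap; field; rewrite gt_eqF.
  have [h6 h7] : 0 <= (x - a) / (b - a) * del /\ (x - a) / (b - a) * del <= del.
    move/andP : h2 => [h21 h22]; split; first by rewrite mulr_ge0// ltW.
    by rewrite ler_piMl// ltW.
  split; rewrite ?ler_norml /A; [lra|lra|].
  by apply/andP; split; rewrite h1; lra.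
have GA x : a <= x <= b -> `|G (A x) - f x| <= e.
  move=> xab; have [h1 h2 h3] := Aab x xab.
  have [y /andP[y1 y2] ->] := Gf (A x).
  have yab : a <= y <= b by apply/andP; split; lra.
  rewrite /= clamp_id//; apply: hd; rewrite ?in_itv//.
  apply: (@le_lt_trans _ _ (del + del)); last by lra.
  rewrite -(subrKA (A x)) (le_trans (ler_normD _ _))// lerD//.
  by rewrite ger0_norm; lra.
have [G' hG' _] : exists2 G', has_deriv G G' & smooth 0 G'.
  by apply/smoothS; apply: smooth_le sG; rewrite addn_gt0 N0.
have /choice[mn hmn] (ij : 'I_N * 'I_N) : exists mn : R * R, forall x,
    secant G G' (A (bs ij.1)) (A (bs ij.2)) (A x) = mn.1 + mn.2 * x.
  have [mn hmn] := secant_affine G G' (A (bs ij.1)) (A (bs ij.2)).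
  exists (mn.1 + mn.2 * (a + del - a * kap), mn.2 * kap) => x.
  by rewrite hmn /A /=; ring.
exists (fun i j => (mn (i, j)).1), (fun i j => (mn (i, j)).2); split=> [i|x xab y].
  rewrite -(hmn (i, i)) /= secant_l.
  by have := GA _ (bsab i); rewrite ler_norml => /andP[]; lra.
(* Eigenvalues may repeat while interpolation needs distinct nodes: equal ones are merged and their
   weights added in [w]. *)
pose s := undup [seq A (bs i) | i <- enum 'I_N].
pose w c := \sum_(i | A (bs i) == c) y i.
have ss : (size s <= N)%N.
  by rewrite (leq_trans (size_undup _))// size_map size_enum_ord.
have sA i : A (bs i) \in s.
  by rewrite mem_undup; apply/mapP; exists i => //; rewrite mem_enum.
have sab c : c \in s -> a + del <= c <= b - del.
  rewrite mem_undup => /mapP[i _ ->].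
  by have [-> -> _] := Aab _ (bsab i).
have Axab : a + del <= A x <= b - del by have [-> -> _] := Aab _ xab.
have := @secant_kernel_ge0 _ G G' s w (a + del) (b - del) (A x).
have sumE (F : R -> R -> R) :
    \sum_(c <- s) \sum_(d <- s) w c * w d * F c d =
    \sum_i \sum_j y i * y j * F (A (bs i)) (A (bs j)).
  have one (Q : R -> R) : \sum_(c <- s) w c * Q c = \sum_i y i * Q (A (bs i)).
    rewrite /w; under eq_bigr do rewrite mulr_suml big_mkcond.
    rewrite exchange_big /=; apply: eq_bigr => i _.
    rewrite (bigD1_seq (A (bs i)))//= ?undup_uniq// eqxx big1 ?addr0// => c ci.
    by rewrite eq_sym (negbTE ci).
  transitivity (\sum_(c <- s) w c * (\sum_(d <- s) w d * F c d)).
    by apply: eq_bigr => c _; rewrite mulr_sumr; apply: eq_bigr => c' _; rewrite mulrA.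
  rewrite one; apply: eq_bigr => i _; rewrite one mulr_sumr.
  by apply: eq_bigr => j _; rewrite mulrA.
rewrite (sumE (fun c d => G (A x) - secant G G' c d (A x))) => ker.
have {ker} : 0 <= \sum_i \sum_j y i * y j *
    (G (A x) - secant G G' (A (bs i)) (A (bs j)) (A x)).
  apply: ker => //.
  - by move=> n ns; apply: smooth_le sG; rewrite leq_add// (leq_trans ns).
  - exact: undup_uniq.
  move=> n q D ns sq hD D0 z zab.
  have [n0|n0] := posnP n.
    move: sq; rewrite n0 leqn0 size_poly_eq0 => /eqP q0.
    by rewrite D0 q0 horner0 expr0n mul0r.
  have [|K [c [u [mo hfu]]]] := hf n; first by rewrite n0 (leq_trans ns).
  apply: (@node_ge0_deriv K n c u G a (b - del / 2) (a + del) (b - del) q D z) => //.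
  (* The bound 3 on the nodes keeps all sample points in [[a, b]], where the clamp is the
     identity. *)
  - apply: hG => p t r sp r0 h1 h2.
    have := hfu p t r sp r0 h1 h2; congr (_ <= _); apply: eq_bigr => k _.
    rewrite /= clamp_id//; have [u3 _ _] := mo; have := u3 k.
    rewrite ler_norml => /andP[k1 k2].
    have h3 : r * - 3 <= r * u k by rewrite ler_pM2l.
    have h4 : r * u k <= r * 3 by rewrite ler_pM2l.
    by apply/andP; split; lra.
  - by rewrite ltrDl.
  - by lra.
have yy : (\sum_i y i) ^+ 2 = \sum_i \sum_j y i * y j.
  by rewrite expr2 mulr_suml; apply: eq_bigr => i _; rewrite mulr_sumr.
have -> : \sum_i \sum_j y i * y j * (G (A x) - secant G G' (A (bs i)) (A (bs j)) (A x)) =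
    G (A x) * (\sum_i y i) ^+ 2 - \sum_i \sum_j y i * y j * ((mn (i, j)).1 + (mn (i, j)).2 * x).
  rewrite yy mulr_sumr -sumrB; apply: eq_bigr => i _; rewrite mulr_sumr -sumrB.
  by apply: eq_bigr => j _; rewrite -(hmn (i, j)) /=; ring.
rewrite subr_ge0 => /le_trans; apply; rewrite ler_wpM2r ?sqr_ge0//.
by have := GA x xab; rewrite ler_norml => /andP[]; lra.
Qed.
End Certificate.

(** * Compressions to finite-dimensional subspaces *)

Section Quadrature.
Context {R : realType} (H : hilbertType R).
Implicit Types (x y z : H) (X : bop H).

Definition orthonormal n (u : 'I_n -> H) := forall i j, inner (u i) (u j) = (i == j)%:R.

(** Stated as the orthonormal expansion, so that membership can be used directly for rewriting. *)
Definition in_span n (u : 'I_n -> H) z := z = \sum_i inner z (u i) *: u i.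

Lemma inner_comb n (u : 'I_n -> H) (c : 'I_n -> R[i]) j : orthonormal u ->
  inner (\sum_i c i *: u i) (u j) = c j.
Proof.
move=> ou; rewrite inner_suml (bigD1 j)//= innerZl ou eqxx mulr1 big1 ?addr0// => i ij.
by rewrite innerZl ou (negbTE ij) mulr0.
Qed.

Lemma in_span_comb n (u : 'I_n -> H) (c : 'I_n -> R[i]) : orthonormal u ->
  in_span u (\sum_i c i *: u i).
Proof. by move=> ou; apply: eq_bigr => j _; rewrite inner_comb. Qed.

Lemma in_span_inner n (u : 'I_n -> H) y z : in_span u y ->
  inner y z = \sum_i inner y (u i) * inner (u i) z.
Proof.
by move=> hy; rewrite {1}hy inner_suml; apply: eq_bigr => i _; rewrite innerZl.
Qed.

(** Dependent vectors are skipped, so [n] may be smaller than [m]; as the family is orthonormal in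
    [H], its size cannot exceed the dimension. *)
Lemma gram_schmidt m (z : nat -> H) : exists n, exists2 u : 'I_n -> H,
  orthonormal u & forall i, (i < m)%N -> in_span u (z i).
Proof.
elim: m => [|m [n [u ou uz]]]; first by exists 0%N, (fun _ => 0) => // -[].
pose y := z m - \sum_i inner (z m) (u i) *: u i.
have yu i : inner y (u i) = 0 by rewrite innerDl innerNl inner_comb// subrr.
have uy i : inner (u i) y = 0 by rewrite inner_conj yu conjc0.
have [y0|y0] := eqVneq y 0.
  exists n, u => // i; rewrite ltnS leq_eqVlt => /orP[/eqP ->|/uz//].
  by apply/eqP; rewrite -subr_eq0 -/y y0.
have ny : hnorm y != 0 by apply: contra_neq y0; exact: hnorm_eq0.
pose y' := (hnorm y)^-1%:C *: y.
pose u' (i : 'I_(n + 1)) := match fintype.split i with inl j => u j | inr _ => y' end.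
have u'l j : u' (lshift 1 j) = u j by rewrite /u' (fintype.unsplitK (inl j)).
have u'r : u' (rshift n ord0) = y' by rewrite /u' (fintype.unsplitK (inr ord0)).
have ou' : orthonormal u'.
  move=> i j; rewrite -(fintype.splitK i) -(fintype.splitK j).
  case: (fintype.split i) => i'; case: (fintype.split j) => j' /=;
    rewrite ?(ord1 i') ?(ord1 j') ?u'l ?u'r.
  - by rewrite ou (inj_eq (@lshift_inj _ _)).
  - by rewrite innerZr uy mulr0 eq_lrshift.
  - by rewrite innerZl yu mulr0 eq_rlshift.
  - rewrite innerZl innerZr conjc_real inner_norm -hnormE eqxx -rmorphXn -!rmorphM /=.
    by rewrite expr2 mulrA mulrACA !mulVf// mulr1.
exists (n + 1)%N, u' => // i; rewrite ltnS leq_eqVlt => /orP[/eqP ->|im].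
  have -> : z m = \sum_i (match fintype.split i with inl j => inner (z m) (u j)
      | inr _ => (hnorm y)%:C end) *: u' i; last exact: in_span_comb.
  rewrite big_split_ord /= big_ord1 u'r (fintype.unsplitK (inr ord0)) scalerA -rmorphM mulfV// scale1r.
  under eq_bigr do rewrite u'l (fintype.unsplitK (inl _)).
  by rewrite addrC subrK.
have -> : z i = \sum_i0 (match fintype.split i0 with inl j => inner (z i) (u j)
      | inr _ => 0 end) *: u' i0; last exact: in_span_comb.
rewrite big_split_ord /= big_ord1 (fintype.unsplitK (inr ord0)) scale0r addr0.
under eq_bigr do rewrite u'l (fintype.unsplitK (inl _)).
exact: uz.
Qed.

(** Spectral theorem for the Hermitian matrix of [X] in the frame [u]. Only the compression is
    diagonalized: the [w l] need not be eigenvectors of [X]. *)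
Lemma compression_eigenbasis n (u : 'I_n -> H) X : orthonormal u -> selfadjoint X ->
  exists (w : 'I_n -> H) (x : 'I_n -> R), [/\ orthonormal w,
    forall l k, inner (X (w l)) (w k) = (x l)%:C *+ (l == k) &
    forall z, in_span u z -> in_span w z].
Proof.
move=> ou sX; pose A : 'M[R[i]]_n := \matrix_(i, j) inner (X (u i)) (u j).
have nA : A \is normalmx.
  have AA : (A ^t Num.conj)%sesqui = A.
    apply/matrixP => i j; rewrite !mxE [RHS]inner_conj.
    by move/selfadjointP : sX => ->.
  by apply/normalmxP; rewrite AA.
have uP := spectral_unitarymx A.
set P := spectralmx A in uP *.
have AE : P *m A *m (P ^t Num.conj)%sesqui = diag_mx (spectral_diag A).
  move/orthomx_spectralP : nA => {1}->; rewrite -/P.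
  rewrite !mulmxA mulmxV ?unitarymx_unit// mul1mx -invmx_unitary//.
  by rewrite mulmxK ?unitarymx_unit.
pose w l := \sum_i P l i *: u i.
have ww l k : inner (w l) (w k) = \sum_i P l i * (P k i)^*%C.
  rewrite inner_suml; apply: eq_bigr => i _; rewrite innerZl; congr (_ * _).
  by rewrite inner_conj inner_comb.
have ow : orthonormal w.
  move=> l k; rewrite ww; move/unitarymxP : uP => /matrixP/(_ l k).
  by rewrite !mxE => <-; apply: eq_bigr => i _; rewrite !mxE.
have Xw l k : inner (X (w l)) (w k) = spectral_diag A 0 l *+ (l == k).
  have := congr1 (fun M : 'M[R[i]]_n => M l k) AE; rewrite !mxE => <-.
  rewrite inner_sumr; apply: eq_bigr => j _; rewrite innerZr !mxE mulrC; congr (_ * _).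
  rewrite /w bop_sum inner_suml; apply: eq_bigr => i _.
  by rewrite bop_argZ innerZl !mxE.
exists w, (fun l => rdot (X (w l)) (w l)); split=> // [l k|z hz].
  rewrite Xw; case: eqVneq => // ->.
  by rewrite -selfadjoint_inner// Xw eqxx.
have uw i : u i = \sum_l (P l i)^*%C *: w l.
  have PP : (P ^t Num.conj)%sesqui *m P = 1%:M.
    by rewrite -invmx_unitary// mulVmx// unitarymx_unit.
  rewrite /w; under eq_bigr do rewrite scaler_sumr.
  rewrite exchange_big /= (bigD1 i)//= [X in _ = _ + X]big1 => [|j ji].
    under eq_bigr do rewrite scalerA.
    rewrite -scaler_suml addr0; have := congr1 (fun M : 'M[R[i]]_n => M i i) PP.
    rewrite !mxE eqxx; under eq_bigr do rewrite !mxE.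
    by move=> ->; rewrite scale1r.
  under eq_bigr do rewrite scalerA.
  rewrite -scaler_suml; have := congr1 (fun M : 'M[R[i]]_n => M i j) PP.
  rewrite !mxE eq_sym (negbTE ji); under eq_bigr do rewrite !mxE.
  by move=> ->; rewrite scale0r.
have -> : z = \sum_l (\sum_i inner z (u i) * (P l i)^*%C) *: w l; last exact: in_span_comb.
rewrite {1}hz; under eq_bigr do rewrite {2}uw scaler_sumr.
rewrite exchange_big /=; apply: eq_bigr => l _.
by rewrite scaler_suml; apply: eq_bigr => i _; rewrite scalerA.
Qed.

Lemma orthonormal_node n (w : 'I_n -> H) (x : 'I_n -> R) X (a b : R) l : orthonormal w ->
  (forall l k, inner (X (w l)) (w k) = (x l)%:C *+ (l == k)) ->
  (forall x, a * hnorm x ^+ 2 <= rdot (X x) x) ->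
  (forall x, rdot (X x) x <= b * hnorm x ^+ 2) -> a <= x l <= b.
Proof.
move=> ow Xw ha hb.
have n1 : hnorm (w l) ^+ 2 = 1 by rewrite -rdotxx /rdot ow eqxx.
have xE : rdot (X (w l)) (w l) = x l by rewrite /rdot Xw eqxx mulr1n.
by have := ha (w l); have := hb (w l); rewrite n1 !mulr1 xE => -> ->.
Qed.

(* Gauss quadrature: exact up to degree [m] because the compression is taken to a
   space containing the vectors [X ^+ k (z i)], [k <= m]. *)
Lemma quadrature r (z : nat -> H) m X : selfadjoint X ->
  exists n (w : 'I_n -> H) (x : 'I_n -> R), [/\ orthonormal w,
    forall l k, inner (X (w l)) (w k) = (x l)%:C *+ (l == k),
    forall i, (i < r)%N -> in_span w (z i) &
    forall i j (p : {poly R}), (i < r)%N -> (j < r)%N -> (size p <= m.+1)%N ->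
      inner (poly_op p X (z i)) (z j) =
      \sum_l (p.[x l])%:C * (inner (z i) (w l) * (inner (z j) (w l))^*%C)].
Proof.
move=> sX.
(* The index encodes the starting vector by its quotient and the power of [X] by its remainder
   modulo [m.+1]. *)
have [n [u ou uz]] := gram_schmidt (r * m.+1) (fun k => (X ^+ (k %% m.+1)%N) (z (k %/ m.+1)%N)).
have {uz} uz i k : (i < r)%N -> (k <= m)%N -> in_span u ((X ^+ k) (z i)).
  move=> ir km; have := uz (i * m.+1 + k)%N.
  rewrite divnMDl// modnMDl modn_small// divn_small// addn0; apply.
  by rewrite (leq_trans (n := i.+1 * m.+1)%N) ?leq_mul// mulSn addnC ltn_add2r.
have [w [x [ow Xw uw]]] := compression_eigenbasis ou sX.
have wz i k : (i < r)%N -> (k <= m)%N -> in_span w ((X ^+ k) (z i)).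
  by move=> ir km; apply/uw/uz.
(* As long as the powers stay in the span, compressing after each application of [X] loses
   nothing. *)
have coord i k l : (i < r)%N -> (k <= m)%N ->
    inner ((X ^+ k) (z i)) (w l) = (x l ^+ k)%:C * inner (z i) (w l).
  move=> ir; elim: k => [|k IH] km; first by rewrite !expr0 bop1E mul1r.
  rewrite !exprS bopM; move/selfadjointP: (sX) => ->.
  rewrite (in_span_inner _ (wz _ _ ir (ltnW km))) (bigD1 l)//= big1 => [|j jl].
    move/selfadjointP: (sX) => <-.
    by rewrite Xw eqxx IH 1?ltnW// mulr1n addr0 mulrC mulrA -rmorphM.
  by move/selfadjointP: (sX) => <-; rewrite Xw (negbTE jl) mulr0.
have zw i : (i < r)%N -> in_span w (z i) by move=> ir; have := wz i 0%N ir isT; rewrite expr0.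
exists n, w, x; split=> // i j p ir jr sp.
rewrite /poly_op sum_bop inner_suml.
transitivity (\sum_(k < size p) \sum_l (p`_k * x l ^+ k)%:C *
    (inner (z i) (w l) * (inner (z j) (w l))^*%C)).
  apply: eq_bigr => k _; rewrite bopZ innerZl.
  have km : (k <= m)%N by rewrite -ltnS (leq_trans (ltn_ord k)).
  rewrite (in_span_inner _ (wz _ _ ir km)) mulr_sumr; apply: eq_bigr => l _.
  by rewrite coord// rmorphM -!mulrA -inner_conj.
rewrite exchange_big /=; apply: eq_bigr => l _.
by rewrite -mulr_suml -rmorph_sum horner_coef.
Qed.
End Quadrature.

(** * Moments of the convexity defect *)

Section Pivot.
Context {R : realType} (H : hilbertType R).
Implicit Types (x y z : H) (X B W : bop H).

Lemma in_spanD n (u : 'I_n -> H) y z : in_span u y -> in_span u z -> in_span u (y + z).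
Proof.
rewrite /in_span => {1}-> {1}->; rewrite -big_split; apply: eq_bigr => i _.
by rewrite innerDl scalerDl.
Qed.

Lemma in_spanZ n (u : 'I_n -> H) (c : R[i]) z : in_span u z -> in_span u (c *: z).
Proof.
rewrite /in_span => {1}->; rewrite scaler_sumr; apply: eq_bigr => i _.
by rewrite innerZl scalerA.
Qed.

Lemma in_span_basis n (u : 'I_n -> H) i : orthonormal u -> in_span u (u i).
Proof.
move=> ou; rewrite /in_span (bigD1 i)//= ou eqxx scale1r big1 ?addr0// => j ji.
by rewrite ou eq_sym (negbTE ji) scale0r.
Qed.

Lemma in_span0 n (u : 'I_n -> H) : in_span u 0.
Proof. by rewrite /in_span big1// => i _; rewrite inner0l scale0r. Qed.

(** When the range of [X] lies in the span, [X] agrees with its compression there, and the basis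
    consists of true eigenvectors. *)
Lemma eigen_of_compression n (u w : 'I_n -> H) (x : 'I_n -> R) X : orthonormal w ->
  (forall l k, inner (X (w l)) (w k) = (x l)%:C *+ (l == k)) ->
  (forall z, in_span u z -> in_span w z) -> (forall z, in_span u (X z)) ->
  forall l, X (w l) = (x l)%:C *: w l.
Proof.
move=> ow Xw uw Xu l; rewrite {1}(uw _ (Xu (w l))) (bigD1 l)//= Xw eqxx mulr1n.
by rewrite big1 ?addr0// => k kl; rewrite Xw eq_sym (negbTE kl) scale0r.
Qed.

Definition wnorm2 (a : R[i]) : R := complex.Re (a * a^*%C).

Lemma rdot_comb n (w : 'I_n -> H) (al : 'I_n -> R[i]) (c d : 'I_n -> R) : orthonormal w ->
  rdot (\sum_l (c l)%:C *: (al l *: w l)) (\sum_l (d l)%:C *: (al l *: w l)) =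
  \sum_l wnorm2 (al l) * (c l * d l).
Proof.
move=> ow; rewrite /rdot inner_sumr Re_sum; apply: eq_bigr => l _.
under eq_bigr do rewrite scalerA.
rewrite scalerA innerZr inner_comb//.
have -> : (((d l)%:C * al l)^* = (d l)%:C * (al l)^*)%C.
  by rewrite [LHS]rmorphM; congr (_ * _); exact: conjc_real.
rewrite mulrACA -rmorphM ReZ mulrC; congr (_ * _).
  by rewrite /wnorm2 mulrC.
by rewrite mulrC.
Qed.

Lemma poly_op_comb n (w : 'I_n -> H) (x : 'I_n -> R) (al : 'I_n -> R[i]) X (p : {poly R}) :
  (forall l, X (w l) = (x l)%:C *: w l) ->
  poly_op p X (\sum_l al l *: w l) = \sum_l (p.[x l])%:C *: (al l *: w l).
Proof.
move=> Xw; rewrite bop_sum; apply: eq_bigr => l _.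
by rewrite bop_argZ (poly_op_eigen _ (Xw l)) !scalerA mulrC.
Qed.

Lemma orthonormal_neq0 n (w : 'I_n -> H) l : orthonormal w -> w l != 0.
Proof.
move=> ow; apply/eqP => w0; have := ow l l; rewrite w0 inner0l eqxx.
by move/eqP; rewrite eq_sym oner_eq0.
Qed.

Section Nodes.
Variables (J : interval R) (f : R -> R) (n : nat) (u : 'I_n -> H) (B W : bop H) (e : H).
Hypotheses (cf : {within [set` J], continuous f}) (fconv : operator_convex H J f).
Hypotheses (n0 : (0 < n)%N) (ou : orthonormal u) (sB : selfadjoint B) (sW : selfadjoint W).
Hypotheses (ue : in_span u e) (uB : forall z, in_span u (B z)) (uW : forall z, in_span u (W z)).
Hypothesis WB : forall k, (k < n.-1)%N -> W ((B ^+ k) e) = 0.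
Hypothesis WBn : W ((B ^+ n.-1) e) != 0.

Let X (sg : R) : bop H := B + sg%:C *: W.

Hypothesis X_bound : forall sg : R, `|sg| <= 1 ->
  forall x, `|rdot (X sg x) x| <= hnorm x ^+ 2.

Let sX sg : selfadjoint (X sg).
Proof. by apply: selfadjointD => //; exact: selfadjointZ. Qed.

Let Xk sg k : (k <= n.-1)%N -> (X sg ^+ k) e = (B ^+ k) e.
Proof.
elim: k => [//|k IH] kn; rewrite !exprS !bopM IH ?(ltnW kn)//.
by rewrite /X bopD bopZ WB// scaler0 addr0.
Qed.

Let Xpoly sg (q : {poly R}) : (size q <= n)%N -> poly_op q (X sg) e = poly_op q B e.
Proof.
move=> sq; rewrite /poly_op !sum_bop; apply: eq_bigr => k _; rewrite !bopZ Xk//.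
by rewrite -ltnS prednK// (leq_trans (ltn_ord k)).
Qed.

Let Xeigen sg : exists wx : ('I_n -> H) * ('I_n -> R), [/\ orthonormal wx.1,
  forall l, X sg (wx.1 l) = (wx.2 l)%:C *: wx.1 l, in_span wx.1 e &
  `|sg| <= 1 -> forall l, `|wx.2 l| <= 1].
Proof.
have [w [x [ow Xw uw]]] := compression_eigenbasis ou (sX sg).
exists (w, x); split=> //=; last 2 first.
- exact: uw.
- move=> sg1 l; have nw : hnorm (w l) ^+ 2 = 1 by rewrite -rdotxx /rdot ow eqxx.
  by have := X_bound sg1 (w l); rewrite nw /rdot Xw eqxx.
apply: (eigen_of_compression ow Xw uw) => z.
by rewrite /X bopD bopZ; apply: in_spanD; [exact: uB|exact: in_spanZ].
Qed.

Let rdotX sg j k : rdot ((X sg ^+ (j + k)) e) e = rdot ((X sg ^+ j) e) ((X sg ^+ k) e).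
Proof.
by rewrite addnC exprD bopM (selfadjoint_rdot _ _ (selfadjointX _ (sX sg))).
Qed.

Let a := (B ^+ n.-1) e.

(* Splitting [X^j] symmetrically, only the middle factors at [j = 2n - 1] and [j = 2n]
   see [W]; the former is odd in [sg]. *)
Let moment_avg j : (j <= n + n)%N ->
  2^-1 * rdot ((X 1 ^+ j) e) e + 2^-1 * rdot ((X (-1) ^+ j) e) e - rdot ((X 0 ^+ j) e) e =
  hnorm (W a) ^+ 2 *+ (j == n + n)%N.
Proof.
have nE : n = n.-1.+1 by rewrite prednK.
have Xa sg : (X sg ^+ n) e = B a + sg%:C *: W a.
  by rewrite {1}nE exprS bopM Xk// /X bopD bopZ.
rewrite leq_eqVlt => /orP[/eqP ->|jn].
  rewrite eqxx mulr1n !rdotX !Xa !(rdotDl, rdotDr, rdotZl, rdotZr) (rdotC (W a) (B a)).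
  by rewrite -rdotxx; field.
rewrite (ltn_eqF jn) mulr0n.
have [jle|jgt] := leqP j (n.-1 + n.-1).
  have jE : j = (j - minn j n.-1 + minn j n.-1)%N by rewrite subnK// geq_minl.
  have h1 : (j - minn j n.-1 <= n.-1)%N.
    by rewrite leq_subLR /minn; case: ifP => _; rewrite ?leq_addr.
  have h2 : (minn j n.-1 <= n.-1)%N by exact: geq_minr.
  by rewrite jE !rdotX !Xk//; field.
have -> : j = (n + n.-1)%N.
  apply/eqP; rewrite eqn_leq; apply/andP; split.
    by rewrite -ltnS -addnS prednK.
  by rewrite {1}nE addSn.
by rewrite !rdotX !Xa !Xk// -/a !(rdotDl, rdotZl); field.
Qed.

(** The functional is the midpoint defect of the three spectral measures of [e]: nodes are
    eigenvalues, weights are squared coordinates of [e]. Dividing by [hnorm (W a) ^+ 2], the value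
    found by [moment_avg] at degree [2n], normalizes it. *)
Lemma convexity_nodes : exists K : finType, exists c s : K -> R, moments (n + n) c s /\
  forall l r, l \in J -> r \in J -> node_ge0 n c s f l r.
Proof.
have [wx hwx] := choice Xeigen.
pose sg (i : 'I_3) : R := [:: 1; -1; 0]`_i.
pose wt (i : 'I_3) : R := [:: 2^-1; 2^-1; -1]`_i.
have sg1 i : `|sg i| <= 1.
  by case: i => -[|[|[|//]]] ?; rewrite /sg /= ?normrN ?normr1 ?normr0.
pose w i := (wx (sg i)).1; pose x i := (wx (sg i)).2.
have ow i : orthonormal (w i) by have [] := hwx (sg i).
have Xw i l : X (sg i) (w i l) = (x i l)%:C *: w i l.
  by case: (hwx (sg i)) => _ h _ _; exact: h.
pose al i l := inner e (w i l).
have eE i : e = \sum_l al i l *: w i l by case: (hwx (sg i)).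
pose gam := hnorm (W a) ^+ 2.
have gam0 : 0 < gam.
  by rewrite exprn_gt0// lt0r hnorm_ge0 andbT; apply: contra_neq WBn; exact: hnorm_eq0.
have sum3 (F : R -> R) : \sum_(i < 3) wt i * F (sg i) = 2^-1 * F 1 + 2^-1 * F (-1) - F 0.
  by rewrite !big_ord_recl big_ord0 /wt /sg /= addr0 addrA mulN1r.
have mom i j : rdot ((X (sg i) ^+ j) e) e = \sum_l wnorm2 (al i l) * x i l ^+ j.
  rewrite -poly_opXn {1}(eE i) (poly_op_comb _ _ (Xw i)) {1}(eE i).
  rewrite (_ : \sum_l al i l *: w i l = \sum_l 1%:C *: (al i l *: w i l)).
    by rewrite (rdot_comb _ _ _ (ow i)); apply: eq_bigr => l _; rewrite hornerXn mulr1.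
  by apply: eq_bigr => l _; rewrite scale1r.
exists ('I_3 * 'I_n)%type, (fun k => gam^-1 * (wt k.1 * wnorm2 (al k.1 k.2))),
  (fun k => x k.1 k.2).
have moE j : (j <= n + n)%N -> \sum_(k : 'I_3 * 'I_n)
    gam^-1 * (wt k.1 * wnorm2 (al k.1 k.2)) * x k.1 k.2 ^+ j =
    gam^-1 * (gam *+ (j == n + n)%N).
  move=> jn; rewrite -(moment_avg jn) -(sum3 (fun s => rdot ((X s ^+ j) e) e)).
  rewrite mulr_sumr -(pair_bigA _ (fun i l => gam^-1 * (wt i * wnorm2 (al i l)) * x i l ^+ j)) /=.
  apply: eq_bigr => i _; rewrite mom !mulr_sumr; apply: eq_bigr => l _; ring.
split.
  split=> [[i l]|j jn|] /=.
  - have [_ _ _ /(_ (sg1 i)) h] := hwx (sg i).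
    by rewrite (le_trans (h l))// ler1n.
  - by rewrite moE ?(ltnW jn)// (ltn_eqF jn) mulr0n mulr0.
  - by rewrite moE// eqxx mulr1n mulVf// gt_eqF.
move=> lo hi loJ hiJ q t ep sq ep0 hlo hhi.
(* The operators on which convexity is tested: [Y 0] is the mean of [Y 1] and [Y (-1)], and the
   bound on [X s] keeps their spectra within [[lo, hi]]. *)
pose Y s : bop H := t%:C *: (1 : bop H) + ep%:C *: X s.
have YE s z : Y s z = t%:C *: z + ep%:C *: X s z by [].
have sY s : selfadjoint (Y s).
  apply: selfadjointD; apply: selfadjointZ => //; exact: selfadjoint1.
have spY s : `|s| <= 1 -> sp J (Y s).
  move=> s1; apply: (sp_of_bounds (sY s) loJ hiJ) => z;
  rewrite YE rdotDl !rdotZl rdotxx; have := X_bound s1 z; rewrite ler_norml => /andP[h1 h2].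
  - have h3 : ep * - hnorm z ^+ 2 <= ep * rdot (X s z) z by rewrite ler_pM2l.
    have h4 : lo * hnorm z ^+ 2 <= (t - 3 * ep) * hnorm z ^+ 2 by rewrite ler_wpM2r ?sqr_ge0.
    have h5 : 0 <= ep * hnorm z ^+ 2 by rewrite mulr_ge0 ?sqr_ge0 ?ltW.
    lra.
  - have h3 : ep * rdot (X s z) z <= ep * hnorm z ^+ 2 by rewrite ler_pM2l.
    have h4 : (t + 3 * ep) * hnorm z ^+ 2 <= hi * hnorm z ^+ 2 by rewrite ler_wpM2r ?sqr_ge0.
    have h5 : 0 <= ep * hnorm z ^+ 2 by rewrite mulr_ge0 ?sqr_ge0 ?ltW.
    lra.
(* The reparametrization makes [qe] of [X s] equal to [q] of [Y s]; as its size is at most [n], the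
   vector [v] is common to the three operators. *)
pose qe := q \Po (ep *: 'X + t%:P).
have sqe : (size qe <= n)%N.
  rewrite size_comp_poly2// size_addl ?size_scale ?size_polyX ?gt_eqF//.
  by rewrite (leq_ltn_trans (size_polyC_leq1 _)).
pose v := poly_op qe B e.
have qeE (y : R) : qe.[y] = q.[t + ep * y].
  by rewrite horner_comp hornerD hornerZ hornerX hornerC addrC.
have vE i : v = \sum_l (q.[t + ep * x i l])%:C *: (al i l *: w i l).
  rewrite /v -(Xpoly (sg i) sqe) {1}(eE i) (poly_op_comb _ _ (Xw i)).
  by apply: eq_bigr => l _; rewrite qeE.
have fE i : rdot (cfc f (Y (sg i)) v) v =
    \sum_l wnorm2 (al i l) * (q.[t + ep * x i l] ^+ 2 * f (t + ep * x i l)).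
  have -> : cfc f (Y (sg i)) v =
      \sum_l (f (t + ep * x i l) * q.[t + ep * x i l])%:C *: (al i l *: w i l).
    rewrite (vE i) bop_sum; apply: eq_bigr => l _; rewrite !bop_argZ.
    have Yw : Y (sg i) (w i l) = (t + ep * x i l)%:C *: w i l.
      by rewrite YE Xw scalerA -rmorphM -scalerDl -rmorphD.
    rewrite (cfc_eigen cf (spY _ (sg1 i)) Yw (orthonormal_neq0 l (ow i))).
    by rewrite !scalerA rmorphM /=; congr (_ *: _); ring.
  rewrite [X in rdot _ X](vE i) (rdot_comb _ _ _ (ow i)).
  by apply: eq_bigr => l _; ring.
have -> : \sum_(k : 'I_3 * 'I_n) gam^-1 * (wt k.1 * wnorm2 (al k.1 k.2)) *
      (q.[t + ep * x k.1 k.2] ^+ 2 * f (t + ep * x k.1 k.2)) =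
    gam^-1 * (2^-1 * rdot (cfc f (Y 1) v) v + 2^-1 * rdot (cfc f (Y (-1)) v) v -
      rdot (cfc f (Y 0) v) v).
  rewrite -(sum3 (fun s => rdot (cfc f (Y s) v) v)) mulr_sumr.
  rewrite -(pair_bigA _ (fun i l => gam^-1 * (wt i * wnorm2 (al i l)) *
     (q.[t + ep * x i l] ^+ 2 * f (t + ep * x i l)))) /=.
  apply: eq_bigr => i _; rewrite fE !mulr_sumr; apply: eq_bigr => l _; ring.
rewrite mulr_ge0 ?invr_ge0 ?(ltW gam0)//.
have Y1 : sp J (Y 1) by apply: spY; rewrite normr1.
have YN1 : sp J (Y (-1)) by apply: spY; rewrite normrN normr1.
have mid : 2^-1 *: (Y 1 + Y (-1)) = Y 0.
  apply: bop_eq => z; rewrite bopZ bopD !YE /X !bopD !bopZ.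
  rewrite rmorph0 scale0r addr0 rmorphN1 scaleN1r scale1r !(scalerDr ep%:C) scalerN !addrA.
  set c := t%:C *: z; set d := ep%:C *: B z; set g := ep%:C *: W z.
  have -> : c + d + g + c + d - g = (2 : R[i]) *: (c + d).
    by rewrite -(addrA (c + d + g)) addrAC addrK scaler_nat mulr2n.
  by rewrite scalerA mulVf ?scale1r ?pnatr_eq0.
have /(_ v)/Re_le := fconv Y1 YN1.
rewrite mid bopB bopZ bopD -/(rdot _ _) rdotDl rdotNl.
have half z : rdot (2^-1 *: z) v = 2^-1 * rdot z v.
  by rewrite -rdotZl fmorphV rmorph_nat.
by rewrite half rdotDl mulrDr.
Qed.
End Nodes.
End Pivot.

(** * The path operator and its Krylov vectors *)

Section Path.
Context {R : realType} (H : hilbertType R).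
Implicit Types (x y z : H).

(** Multiplying [u] by the value [c] of the inner product makes the latter real, which reduces the
    claim to [rdot_le]. *)
Lemma inner_norm_le x u : complex.Re `|inner x u| <= hnorm x * hnorm u.
Proof.
set c := inner x u; have [->|c0] := eqVneq c 0.
  by rewrite normr0 mulr_ge0 ?hnorm_ge0.
have n0 : 0 < complex.Re `|c|.
  have cp : 0 < `|c| by rewrite normr_gt0.
  by move: cp; rewrite ltcE => /andP[].
rewrite -(@ler_pM2l _ (complex.Re `|c|))//.
have := rdot_le x (c *: u); rewrite /rdot innerZr -/c hnormZc mulrCA.
apply: le_trans; rewrite -ReZ !(@RRe_real _ `|c|) ?normr_real//.
by rewrite -expr2 sqr_normc mulrC.
Qed.

Lemma rank1_bounded (u v : H) : (fun x => inner x u *: v) \in bounded_linear_pred (H := H).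
Proof.
apply/asboolP; split=> [a x y|]; first by rewrite innerDl innerZl scalerDl scalerA.
exists (hnorm u * hnorm v) => x; rewrite -!hnormE -rmorphM lecR hnormZc.
rewrite (mulrC (hnorm u * _)) mulrA ler_wpM2r ?hnorm_ge0//; exact: inner_norm_le.
Qed.

Definition rank1 (u v : H) : bop H := Bop (rank1_bounded u v).

Lemma rank1E u v x : rank1 u v x = inner x u *: v. Proof. by []. Qed.

Lemma adjoint_rank1 u v : adjoint (rank1 u v) = rank1 v u.
Proof.
apply: adjoint_uniq => x y; rewrite !rank1E innerZl innerZr -inner_conj.
by rewrite mulrC.
Qed.

Lemma selfadjoint_rank1_sym u v : selfadjoint (rank1 u v + rank1 v u).
Proof. by rewrite /selfadjoint adjointD !adjoint_rank1 addrC. Qed.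

Variables (n : nat) (u : 'I_n -> H).
Hypothesis ou : orthonormal u.

(** Natural indices make successors available; the zero vector stands in beyond [n]. *)
Let e (i : nat) : H := if insub i is Some j then u j else 0.

Let ee i j : (i < n)%N -> (j < n)%N -> inner (e i) (e j) = (i == j)%:R.
Proof. by move=> hi hj; rewrite /e !insubT ou. Qed.

Let span_e i : in_span u (e i).
Proof.
by rewrite /e; case: insubP => [j _ _|_]; [exact: in_span_basis|exact: in_span0].
Qed.

Definition path_op : bop H :=
  \sum_(i < n.-1) (rank1 (e i) (e i.+1) + rank1 (e i.+1) (e i)).

Lemma selfadjoint_path_op : selfadjoint path_op.
Proof. by apply: selfadjoint_sum => i; exact: selfadjoint_rank1_sym. Qed.

Let end_op : bop H := rank1 (e n.-1) (e n.-1).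

Let selfadjoint_end_op : selfadjoint end_op.
Proof. exact: adjoint_rank1. Qed.

Lemma path_op_span z : in_span u (path_op z).
Proof.
rewrite sum_bop; elim/big_ind: _ => [|x y|i _]; [exact: in_span0|exact: in_spanD|].
by rewrite bopD !rank1E; apply: in_spanD; exact: in_spanZ.
Qed.

(** A walk of [k] steps from the vertex 0 goes no further than [k], and exactly one walk reaches it,
    so the coefficient there is [t^k]. *)
Lemma path_op_krylov (t : R) k : t != 0 -> (k < n)%N ->
  (forall j, (k < j < n)%N -> inner (((t%:C *: path_op) ^+ k) (e 0)) (e j) = 0) /\
  inner (((t%:C *: path_op) ^+ k) (e 0)) (e k) != 0.
Proof.
move=> t0; elim: k => [|k IH] kn.
  split=> [j /andP[j0 jn]|]; rewrite expr0 bop1E ee//; last by rewrite oner_neq0.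
  by rewrite eq_sym gt_eqF.
have [z0 z1] := IH (ltnW kn).
set y := ((t%:C *: path_op) ^+ k) (e 0) in z0 z1 *.
have step j : (k < j < n)%N ->
    inner (((t%:C *: path_op) ^+ k.+1) (e 0)) (e j) = t%:C * (inner y (e k) *+ (j == k.+1)).
  move=> /andP[kj jn]; rewrite exprS bopM bopZ innerZl; congr (_ * _).
  move/selfadjointP: selfadjoint_path_op => ->; rewrite sum_bop inner_sumr -/y.
  under eq_bigr do rewrite bopD !rank1E innerDr !innerZr.
  have knp : (k < n.-1)%N by rewrite -ltnS prednK// (leq_ltn_trans _ kn).
  rewrite (bigD1 (Ordinal knp))//= big1 ?addr0 => [|i ik].
    rewrite !ee ?(ltnW kn)// gtn_eqF// conjc0 mul0r add0r.
    by case: eqP => _; rewrite ?conjc1 ?mul1r// conjc0 mul0r mulr0n.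
  have in1 : (i.+1 < n)%N by have := ltn_ord i; rewrite -ltnS prednK// (leq_ltn_trans _ kn).
  rewrite !ee ?(ltnW in1)//.
  have -> : ((j == i)%:R : R[i])^*%C * inner y (e i.+1) = 0.
    have [ji|_] := eqVneq j (i : nat); last by rewrite conjc0 mul0r.
    by rewrite z0 ?mulr0// in1 andbT ltnW// ltnS -ji.
  rewrite add0r; have [ji|_] := eqVneq j i.+1; last by rewrite conjc0 mul0r.
  rewrite z0 ?mulr0// (ltnW in1) andbT ltn_neqAle -ltnS -ji kj andbT.
  by apply: contraNneq ik => ik; apply/eqP/val_inj.
split=> [j /andP[kj jn]|].
  by rewrite step ?(ltnW kj)// gtn_eqF// mulr0.
rewrite step ?ltnSn// eqxx mulr1n mulf_neq0//.
by rewrite -(rmorph0 (real_complex R)) (inj_eq (@complexI R)).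
Qed.

Lemma convex_nodes (J : interval R) (f : R -> R) :
  {within [set` J], continuous f} -> operator_convex H J f -> (0 < n)%N ->
  exists K : finType, exists c s : K -> R, moments (n + n) c s /\
  forall l r, l \in J -> r \in J -> node_ge0 n c s f l r.
Proof.
move=> cf fconv n0.
have [M M0 BM] := bop_bound path_op; have [N N0 WN] := bop_bound end_op.
(* Scaling by [t] makes [B + sg W] a contraction for every [sg] of modulus at most 1. *)
pose t := (1 + M + N)^-1.
have t0 : 0 < t by rewrite invr_gt0 !ltr_wpDr.
have tn : t != 0 by rewrite gt_eqF.
have n1 : (n.-1 < n)%N by rewrite prednK.
have WB k : end_op (((t%:C *: path_op) ^+ k) (e 0)) =
    inner (((t%:C *: path_op) ^+ k) (e 0)) (e n.-1) *: e n.-1 by [].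
apply: (@convexity_nodes _ _ J f n u (t%:C *: path_op) (t%:C *: end_op) (e 0)) => //.
- by apply: selfadjointZ; exact: selfadjoint_path_op.
- exact: selfadjointZ.
- by move=> z; rewrite bopZ; apply: in_spanZ; exact: path_op_span.
- by move=> z; rewrite bopZ rank1E; apply: in_spanZ; exact: in_spanZ.
- move=> k kn; rewrite bopZ WB.
  have [h _] := path_op_krylov tn (leq_trans kn (leq_pred n)).
  by rewrite h ?kn ?n1// scale0r scaler0.
- have [_ h] := path_op_krylov tn n1; rewrite bopZ WB scalerA.
  apply/eqP => h0; have := congr1 (fun z => inner z (e n.-1)) h0.
  rewrite innerZl inner0l ee// eqxx mulr1 => /eqP; rewrite mulf_eq0 (negbTE h) orbF.
  by rewrite -(rmorph0 (real_complex R)) (inj_eq (@complexI R)) (negbTE tn).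
move=> sg sg1 x; apply: (le_trans (rdot_abs_le _ _)).
rewrite expr2 ler_wpM2r ?hnorm_ge0//.
rewrite bopD !bopZ; apply: (le_trans (hnormD _ _)).
rewrite !hnormZ (gtr0_norm t0).
have h1 : `|sg| * (t * hnorm (end_op x)) <= t * (N * hnorm x).
  apply: (@le_trans _ _ (t * hnorm (end_op x))).
    by rewrite ler_piMl// mulr_ge0 ?hnorm_ge0// ltW.
  by rewrite ler_pM2l.
have h2 : t * hnorm (path_op x) <= t * (M * hnorm x) by rewrite ler_pM2l.
apply: (le_trans (lerD h2 h1)); rewrite -mulrDr -mulrDl mulrA ler_piMl ?hnorm_ge0//.
by rewrite /t ler_pdivrMl ?mulr1 -?addrA ?lerDr// ltr_wpDr// addr_ge0.
Qed.
End Path.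

(** * Jensen's operator inequality *)

Section Jensen.
Context {R : realType} (H : hilbertType R).
Implicit Types (x y z v : H) (X T : bop H).

Lemma wnorm2E (a : R[i]) : wnorm2 a = complex.Re a ^+ 2 + complex.Im a ^+ 2.
Proof. by case: a => u v; rewrite /wnorm2 /= mulrN opprK !expr2. Qed.

Lemma Im_sum (I : Type) (r : seq I) (P : pred I) (F : I -> R[i]) :
  complex.Im (\sum_(i <- r | P i) F i) = \sum_(i <- r | P i) complex.Im (F i).
Proof. by apply: (big_morph (@complex.Im R)) => // -[? ?] [? ?]. Qed.

(** Since [L] is real, the real inequality can be applied to real and imaginary parts separately and
    added. *)
Lemma certificate_complex n (L : 'I_n -> 'I_n -> R) (F : R) :
  (forall y : 'I_n -> R, \sum_i \sum_j y i * y j * L i j <= F * (\sum_i y i) ^+ 2) ->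
  forall y : 'I_n -> R[i],
  \sum_i \sum_j complex.Re (y i * (y j)^*%C) * L i j <= F * wnorm2 (\sum_i y i).
Proof.
move=> h y; rewrite wnorm2E Re_sum Im_sum mulrDr.
apply: le_trans (lerD (h (fun i => complex.Re (y i))) (h (fun i => complex.Im (y i)))).
rewrite -big_split /= le_eqVlt; apply/orP; left; apply/eqP; apply: eq_bigr => i _.
rewrite -big_split /=; apply: eq_bigr => j _; rewrite -mulrDl; congr (_ * _).
by case: (y i) => ? ?; case: (y j) => ? ? /=; rewrite mulrN opprK.
Qed.

Lemma rdot_span n (w : 'I_n -> H) z : in_span w z ->
  hnorm z ^+ 2 = \sum_l wnorm2 (inner z (w l)).
Proof.
move=> wz; rewrite -rdotxx /rdot (in_span_inner _ wz) Re_sum.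
by apply: eq_bigr => l _; rewrite (inner_conj (w l)).
Qed.

(** At each node [x s] of a quadrature for [X], the scalar certificate is used with [y k] the
    coordinate of [be k *: g k]; summing over [s] reassembles the operator expressions, which on the
    left have degree at most 1 in [X]. *)
Lemma certificate_cfc (J : interval R) (f : R -> R) X (a b e : R) n
    (M P : 'I_n -> 'I_n -> R) (g : 'I_n -> H) (be : 'I_n -> R[i]) :
  {within [set` J], continuous f} -> nontrivial H -> sp J X -> a \in J -> b \in J ->
  (forall x, a * hnorm x ^+ 2 <= rdot (X x) x) ->
  (forall x, rdot (X x) x <= b * hnorm x ^+ 2) -> 0 < e ->
  (forall t, a <= t <= b -> forall y : 'I_n -> R,
      \sum_i \sum_j y i * y j * (M i j + P i j * t) <= (f t + e) * (\sum_i y i) ^+ 2) ->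
  forall v, v = \sum_k be k *: g k ->
  \sum_k \sum_l complex.Re (be k * (be l)^*%C *
     ((M k l)%:C * inner (g k) (g l) + (P k l)%:C * inner (X (g k)) (g l))) <=
  rdot (cfc f X v) v + 3 * e * hnorm v ^+ 2.
Proof.
move=> cf ntH sX aJ bJ ha hb e0 cert v vE.
have cfab : {within `[a, b], continuous f}.
  exact: (continuous_subspaceW (segment_sub aJ bJ) cf).
have [p hp] := weierstrass cfab e0.
(* The default value matters: index [n] carries [v], so that one quadrature serves the [g k] and [v]
   together. *)
pose z i := if insub i is Some k then g k else v.
have zk (k : 'I_n) : z k = g k by rewrite /z valK.
have zn : z n = v by rewrite /z insubN// ltnn.
(* This degree covers both [p] and the affine polynomials, even when [p] is zero. *)
have [N [w [x [ow Xw wz quad]]]] := quadrature n.+1 z (size p).+1 sX.1.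
have xab s : a <= x s <= b by exact: (orthonormal_node _ ow Xw ha hb).
have wv : in_span w v by rewrite -zn; apply: wz.
pose al k s := inner (g k) (w s).
have vw s : inner v (w s) = \sum_k be k * al k s.
  by rewrite vE inner_suml; apply: eq_bigr => k _; rewrite innerZl.
have pv : rdot (poly_op p X v) v = \sum_s p.[x s] * wnorm2 (inner v (w s)).
  have := quad n n p (ltnSn n) (ltnSn n) (leqW (leqnSn _)); rewrite zn /rdot => ->.
  by rewrite Re_sum; apply: eq_bigr => s _; rewrite ReZ.
have lin k l : (M k l)%:C * inner (g k) (g l) + (P k l)%:C * inner (X (g k)) (g l) =
    \sum_s (M k l + P k l * x s)%:C * (al k s * (al l s)^*%C).
  have sq : (size ((M k l)%:P + P k l *: 'X)%R <= (size p).+2)%N.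
    rewrite (leq_trans (size_polyD _ _))// geq_max (leq_trans (size_polyC_leq1 _))//.
    by rewrite (leq_trans (size_scale_leq _ _))// size_polyX.
  have := quad k l _ (ltnW (ltn_ord k)) (ltnW (ltn_ord l)) sq; rewrite !zk.
  rewrite poly_opD poly_opC poly_opZ poly_opX bopD !bopZ bop1E innerDl !innerZl => ->.
  by apply: eq_bigr => s _; rewrite hornerD hornerC hornerZ hornerX.
have tf : hnorm (poly_op p X v - cfc f X v) <= e * hnorm v.
  apply: (cfc_approx cf ntH sX (ltW e0)) => t st; apply: hp; rewrite in_itv /=.
  by rewrite (spectrum_ge sX.1 ha st) (spectrum_le sX.1 hb st).
have pf : rdot (poly_op p X v) v <= rdot (cfc f X v) v + e * hnorm v ^+ 2.
  rewrite -lerBlDl -rdotNl -rdotDl (le_trans (rdot_le _ _))//.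
  by rewrite expr2 mulrA ler_wpM2r ?hnorm_ge0.
apply: (@le_trans _ _ (\sum_s (f (x s) + e) * wnorm2 (inner v (w s)))).
  have -> : \sum_k \sum_l complex.Re (be k * (be l)^*%C *
     ((M k l)%:C * inner (g k) (g l) + (P k l)%:C * inner (X (g k)) (g l))) =
     \sum_s \sum_k \sum_l complex.Re ((be k * al k s) * (be l * al l s)^*%C) * (M k l + P k l * x s).
    rewrite [RHS]exchange_big /=; apply: eq_bigr => k _; rewrite [RHS]exchange_big /=.
    apply: eq_bigr => l _; rewrite lin mulr_sumr Re_sum; apply: eq_bigr => s _.
    rewrite mulrCA ReZ mulrC; congr (complex.Re _ * _).
    have -> : ((be l * al l s)^* = (be l)^* * (al l s)^*)%C by exact: rmorphM.
    by rewrite mulrACA.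
  apply: ler_sum => s _; rewrite vw; apply: certificate_complex => y; exact: cert.
(* The quadrature is exact for [p], not for [f]: the exchange costs [e] at the nodes here, and
   another [e] when [p(X)] is replaced by [f(X)]. *)
apply: (@le_trans _ _ (\sum_s (p.[x s] + 2 * e) * wnorm2 (inner v (w s)))).
  apply: ler_sum => s _; apply: ler_wpM2r; first by rewrite wnorm2E addr_ge0 ?sqr_ge0.
  have := hp (x s); rewrite in_itv /= => /(_ (xab s)); rewrite ler_norml => /andP[]; lra.
under eq_bigr do rewrite mulrDl.
rewrite big_split /= -pv -mulr_sumr -(rdot_span wv).
by move: pf; move: (rdot (cfc f X v) v) (rdot (poly_op p X v) v) => A B; lra.
Qed.

Lemma common_bounds (J : interval R) r (X : 'I_r -> bop H) : (0 < r)%N -> nontrivial H ->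
  (forall i, sp J (X i)) -> exists a b, [/\ a \in J, b \in J,
    forall i x, a * hnorm x ^+ 2 <= rdot (X i x) x &
    forall i x, rdot (X i x) x <= b * hnorm x ^+ 2].
Proof.
move=> r0 ntH sX; have /choice[ab hab] i := sp_bounds ntH (sX i).
have /choice[b' hb] := hab.
pose i0 : 'I_r := Ordinal r0.
case: (Order.TotalTheory.arg_minP ab (isT : xpredT i0)) => i _ hi.
case: (Order.TotalTheory.arg_maxP b' (isT : xpredT i0)) => j _ hj.
exists (ab i), (b' j); split.
- by have [] := hb i.
- by have [] := hb j.
- move=> k x; have [_ _ _ h _] := hb k; apply: le_trans (h x).
  by rewrite ler_wpM2r ?sqr_ge0// hi.
- move=> k x; have [_ _ _ _ h] := hb k; apply: (le_trans (h x)).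
  by rewrite ler_wpM2r ?sqr_ge0//; exact: hj.
Qed.

(** * Combinations with operator coefficients *)

Section Combination.
Variables (r : nat) (C : 'I_r -> bop H).
Hypothesis C1 : \sum_(i < r) adjoint (C i) * C i = 1.

Lemma cstar_inner (Y : 'I_r -> bop H) x y :
  inner ((\sum_(i < r) adjoint (C i) * Y i * C i) x) y =
  \sum_(i < r) inner (Y i (C i x)) (C i y).
Proof. by rewrite sum_bop inner_suml; apply: eq_bigr => i _; rewrite !bopM adjointE. Qed.

Lemma cstar_inner1 x y : inner x y = \sum_(i < r) inner (C i x) (C i y).
Proof.
rewrite -{1}[x]bop1E -C1 sum_bop inner_suml; apply: eq_bigr => i _.
by rewrite bopM adjointE.
Qed.

Lemma cstar_rdot (Y : 'I_r -> bop H) x y :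
  rdot ((\sum_(i < r) adjoint (C i) * Y i * C i) x) y =
  \sum_(i < r) rdot (Y i (C i x)) (C i y).
Proof. by rewrite /rdot cstar_inner Re_sum. Qed.

Lemma cstar_hnorm x : hnorm x ^+ 2 = \sum_(i < r) hnorm (C i x) ^+ 2.
Proof.
rewrite -rdotxx /rdot cstar_inner1 Re_sum; apply: eq_bigr => i _.
by rewrite -rdotxx.
Qed.

(** Bounds on quadratic forms pass to the combination because the [hnorm (C i x) ^+ 2] add up to
    [hnorm x ^+ 2]; the spectrum is controlled through them. *)
Lemma cstar_sp (J : interval R) (X : 'I_r -> bop H) a b : (forall i, sp J (X i)) ->
  a \in J -> b \in J ->
  (forall i x, a * hnorm x ^+ 2 <= rdot (X i x) x) ->
  (forall i x, rdot (X i x) x <= b * hnorm x ^+ 2) ->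
  [/\ sp J (\sum_(i < r) adjoint (C i) * X i * C i),
    forall x, a * hnorm x ^+ 2 <= rdot ((\sum_(i < r) adjoint (C i) * X i * C i) x) x &
    forall x, rdot ((\sum_(i < r) adjoint (C i) * X i * C i) x) x <= b * hnorm x ^+ 2].
Proof.
move=> sX aJ bJ ha hb; set T := \sum_(i < r) _.
have sT : selfadjoint T.
  apply: selfadjoint_sum => i; rewrite /selfadjoint !adjointM adjointK mulrA.
  by have [-> _] := sX i.
have haT x : a * hnorm x ^+ 2 <= rdot (T x) x.
  by rewrite cstar_rdot cstar_hnorm mulr_sumr; apply: ler_sum => i _; exact: ha.
have hbT x : rdot (T x) x <= b * hnorm x ^+ 2.
  by rewrite cstar_rdot cstar_hnorm mulr_sumr; apply: ler_sum => i _; exact: hb.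
by split=> //; exact: (sp_of_bounds sT aJ bJ).
Qed.

Lemma cstar_jensen (J : interval R) (f : R -> R) (X : 'I_r -> bop H) v :
  {within [set` J], continuous f} -> operator_convex H J f -> (0 < r)%N -> nontrivial H ->
  (forall i, sp J (X i)) ->
  rdot (cfc f (\sum_(i < r) adjoint (C i) * X i * C i) v) v <=
  \sum_(i < r) rdot (cfc f (X i) (C i v)) (C i v).
Proof.
move=> cf fconv r0 ntH sX; have [a [b [aJ bJ ha hb]]] := common_bounds r0 ntH sX.
have [] := cstar_sp sX aJ bJ ha hb; set T := \sum_(i < r) _ => sT haT hbT.
(* Six errors [e]: one between [p(T)] and [f(T)], two at the diagonal nodes ([p] against [f], and
   the certificate), three from [certificate_cfc]. *)
rewrite -subr_le0; apply: (@le0_small _ _ (6 * hnorm v ^+ 2)) => e e0.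
have cfab : {within `[a, b], continuous f}.
  exact: (continuous_subspaceW (segment_sub aJ bJ) cf).
have [p hp] := weierstrass cfab e0.
have [n [u [bs [ou Tu uz quad]]]] := quadrature 1 (fun=> v) (size p) sT.1.
have uv : in_span u v by exact: (uz 0%N).
have bsab l : a <= bs l <= b by exact: (orthonormal_node _ ou Tu haT hbT).
have nodes k : (0 < k <= n)%N -> exists K : finType, exists c s : K -> R,
    moments (k + k) c s /\ node_ge0 k c s f a b.
  (* The first [k] vectors of the frame are an orthonormal family in [H], so convexity on [H] itself
     supplies the functional of order [k]. *)
  move=> /andP[k0 kn]; pose u' (i : 'I_k) := u (widen_ord kn i).
  have ou' : orthonormal u' by move=> i j; rewrite ou.
  have [K [c [s [mo nd]]]] := convex_nodes ou' cf fconv k0.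
  by exists K, c, s; split=> //; exact: nd.
have [M [P [diag cert]]] := affine_certificate cfab e0 bsab nodes.
pose be l := inner v (u l).
have vE : v = \sum_l be l *: u l by exact: uv.
have pT : rdot (poly_op p T v) v = \sum_l p.[bs l] * wnorm2 (be l).
  have := quad 0%N 0%N p isT isT (leqnSn _); rewrite /rdot => ->.
  by rewrite Re_sum; apply: eq_bigr => s _; rewrite ReZ.
have tf : hnorm (poly_op p T v - cfc f T v) <= e * hnorm v.
  apply: (cfc_approx cf ntH sT (ltW e0)) => t st; apply: hp; rewrite in_itv /=.
  by rewrite (spectrum_ge sT.1 haT st) (spectrum_le sT.1 hbT st).
have pf : rdot (cfc f T v) v <= rdot (poly_op p T v) v + e * hnorm v ^+ 2.
  rewrite -lerBlDl -rdotNl -rdotDl (le_trans (rdot_le _ _))// hnormB.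
  by rewrite expr2 mulrA ler_wpM2r ?hnorm_ge0.
have Cv i : C i v = \sum_k be k *: C i (u k).
  by rewrite {1}vE bop_sum; apply: eq_bigr => k _; rewrite bop_argZ.
have up : \sum_(i < r) \sum_k \sum_l complex.Re (be k * (be l)^*%C *
     ((M k l)%:C * inner (C i (u k)) (C i (u l)) +
      (P k l)%:C * inner (X i (C i (u k))) (C i (u l)))) <=
    \sum_(i < r) rdot (cfc f (X i) (C i v)) (C i v) + 3 * e * hnorm v ^+ 2.
  rewrite cstar_hnorm mulr_sumr -big_split; apply: ler_sum => i _.
  exact: (certificate_cfc cf ntH (sX i) aJ bJ (ha i) (hb i) e0 cert (Cv i)).
have lo : \sum_l (p.[bs l] - 2 * e) * wnorm2 (be l) <=
    \sum_(i < r) \sum_k \sum_l complex.Re (be k * (be l)^*%C *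
     ((M k l)%:C * inner (C i (u k)) (C i (u l)) +
      (P k l)%:C * inner (X i (C i (u k))) (C i (u l)))).
  rewrite exchange_big /=; apply: ler_sum => k _; rewrite exchange_big /=.
  (* The normalization of the [C i] enters here: the sum over [i] becomes a Gram entry and an entry
     of the compression of [T], both zero off the diagonal. *)
  have kl l : \sum_(i < r) complex.Re (be k * (be l)^*%C *
     ((M k l)%:C * inner (C i (u k)) (C i (u l)) +
      (P k l)%:C * inner (X i (C i (u k))) (C i (u l)))) =
      (M k l + P k l * bs k) * wnorm2 (be k) *+ (k == l).
    rewrite -Re_sum -mulr_sumr big_split /= -!mulr_sumr -cstar_inner1 -cstar_inner -/T.
    rewrite Tu ou; have [<-|_] := eqVneq k l; last by rewrite !mulr0n !mulr0 addr0 mulr0.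
    by rewrite !mulr1n mulr1 -rmorphM -rmorphD /= mulrC ReZ.
  rewrite (bigD1 k)//= kl eqxx mulr1n big1 ?addr0 => [|l lk]; last first.
    by rewrite kl eq_sym (negbTE lk).
  apply: ler_wpM2r; first by rewrite wnorm2E addr_ge0 ?sqr_ge0.
  have := diag k; have := hp (bs k); rewrite in_itv /= => /(_ (bsab k)).
  by rewrite ler_norml => /andP[]; lra.
have loE : \sum_l (p.[bs l] - 2 * e) * wnorm2 (be l) =
    rdot (poly_op p T v) v - 2 * e * hnorm v ^+ 2.
  by rewrite pT (rdot_span uv) mulr_sumr -sumrB; apply: eq_bigr => l _; rewrite mulrBl.
rewrite loE in lo; have := le_trans lo up.
move: pf; move: (hnorm v ^+ 2) (rdot (cfc f T v) v) (rdot (poly_op p T v) v) => N A B.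
by move: (\sum_(i < r) rdot _ _) => S; lra.
Qed.
End Combination.
End Jensen.

(** * The two implications *)

Section MainDirections.
Context {R : realType} (H : hilbertType R).

(** The points [(X, f(X))] and [(Y, f(Y))] of the epigraph are combined with two equal scalar
    coefficients, the square root of one half, giving the midpoint. *)
Lemma cstar_convex_operator_convex (J : interval R) (f : R -> R) :
  cstar_convex (operator_epigraph H J f) -> operator_convex H J f.
Proof.
move=> cstar X Y sX sY; pose c : bop H := (Num.sqrt 2^-1)%:C *: (1 : bop H).
have ac : adjoint c = c by exact/selfadjointZ/selfadjoint1.
have cZc (Z : bop H) : adjoint c * Z * c = 2^-1 *: Z.
  rewrite ac /c bop_scaleAr bop_scaleAl bop_scaleAl mul1r mulr1 scalerA -rmorphM -expr2.
  by rewrite sqr_sqrtr ?invr_ge0// fmorphV rmorph_nat.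
have sum2 (F : 'I_2 -> bop H) : \sum_(i < 2) F i = F ord0 + F ord_max.
  by rewrite big_ord_recl big_ord1; congr (_ + F _); exact/val_inj.
pose Z (A B : bop H) (i : 'I_2) := if i == ord0 then A else B.
have Z0 A B : Z A B ord0 = A by [].
have Z1 A B : Z A B ord_max = B by [].
have [|||_ ] := cstar 2%N (Z X Y) (Z (cfc f X) (cfc f Y)) (fun=> c).
- by [].
- move=> i; rewrite /Z; case: eqP => _; split=> //= x; by rewrite subrr inner0l.
- have := cZc 1; rewrite mulr1 => cc; rewrite sum2 cc.
  by rewrite -scalerDl -[2^-1]mul1r -mulrDl divff ?scale1r// pnatr_eq0.
have eZ A B : \sum_(i < 2) adjoint c * Z A B i * c = 2^-1 *: (A + B).
  by rewrite sum2 Z0 Z1 !cZc scalerDr.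
by rewrite -eZ -(eZ (cfc f X)).
Qed.

Lemma operator_convex_cstar_convex (J : interval R) (f : R -> R) :
  {within [set` J], continuous f} ->
  operator_convex H J f -> cstar_convex (operator_epigraph H J f).
Proof.
move=> cf fconv r X Y C r0 hK C1.
(* On the zero space all operators coincide, so membership is inherited from any one of the given
   pairs. *)
have [ntH|trH] := pselect (nontrivial H); last first.
  have x0 (x : H) : x = 0 by apply/eqP/negPn/negP => xn; apply: trH; exists x.
  have eqb (A B : bop H) : A = B by apply: bop_eq => x; rewrite [A x]x0 [B x]x0.
  have [sX _] := hK (Ordinal r0); split=> [|x] /=.
    by rewrite (eqb (\sum_(i < r) _) (X (Ordinal r0))).
  by rewrite (x0 x) inner0r.
have sX i : sp J (X i) by have [] := hK i.
have [a [b [aJ bJ ha hb]]] := common_bounds r0 ntH sX.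
have [sT _ _] := cstar_sp C1 sX aJ bJ ha hb.
split=> //= v; rewrite bopB innerDl innerNl cstar_inner.
(* The order of [R[i]] compares only numbers with equal imaginary parts; self-adjointness makes both
   sides of Jensen's inequality real, so the estimate on [rdot] lifts. *)
rewrite (selfadjoint_inner _ (cfc_selfadjoint cf ntH sT)).
have hf i : inner (cfc f (X i) (C i v)) (C i v) =
    (rdot (cfc f (X i) (C i v)) (C i v))%:C.
  by rewrite selfadjoint_inner//; exact: (cfc_selfadjoint cf ntH (sX i)).
have := cstar_jensen C1 v cf fconv r0 ntH sX; rewrite -lecR rmorph_sum => hJ.
rewrite subr_ge0 (le_trans hJ)//; apply: ler_sum => i _; rewrite /= -hf.
have [_ /(_ (C i v))] := hK i.
by rewrite bopB innerDl innerNl subr_ge0.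
Qed.
End MainDirections.

Theorem theorem2p1 (R : realType) (H : hilbertType R) (J : interval R)
    (f : R -> R) (cf : {within [set` J], continuous f}) :
  operator_convex H J f <-> cstar_convex (operator_epigraph H J f).
Proof.
split; first exact: operator_convex_cstar_convex.
exact: cstar_convex_operator_convex.
Qed.
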